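(* Let $\Gamma$ be a lattice in $\mathbb{R}^3$. Let $X:=(\mathbb{R}^3/\Gamma)\times\mathbb{R}$ with the Euclidean metric $g_X$ for which $\mathbb{R}^3/\Gamma$ and $\mathbb{R}$ are orthogonal, equipped with the complex structure induced by an $\mathbb{R}$-linear isomorphism $\mathbb{R}^4\simeq\mathbb{C}^2$ for which the multiplication by $\sqrt{-1}$ is an isometry. Let $\varphi_{\mathbb{R}}:\mathbb{R}\to(0,\infty)$ be a $C^\infty$-function with $\varphi_{\mathbb{R}}(t)=e^{-\delta|t|}$ for $|t|>1$, for some $\delta>0$, and let $\varphi_X:X\to(0,\infty)$ be the pull-back of $\varphi_{\mathbb{R}}$ by the projection $X\to\mathbb{R}$. Then $\int_X\varphi_X\,\mathrm{dvol}_X<\infty$, and there exists a function $C_X:\mathbb{R}_{>0}\to\mathbb{R}_{>0}$ such that the following holds. \begin{itemize} \item If $f:X\to[0,\infty)$ is a bounded function such that $\Delta_Xf\le B\varphi_X$ as distributions for a positive number $B$, then \[ \sup_{P\in X}f(P)\le C_X(B)\Bigl(1+\int_Xf\varphi_X\,\mathrm{dvol}_X\Bigr). \] \item If moreover a bounded function $f$ satisfies the stronger condition $\Delta_Xf\le0$ on $X$, then $\Delta_Xf=0$. \end{itemize}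
   Context: $\mathrm{dvol}_X$ is the volume form of $g_X$ and $\Delta_X:=-\sqrt{-1}\Lambda\partial_X\bar\partial_X$, where $\Lambda$ is the adjoint of multiplication by the Kähler form; $\Delta_X$ is one half of the nonnegative Laplacian of the Riemannian metric. Inequalities for $\Delta_Xf$ are understood in the sense of distributions; functions are considered up to null sets and $\sup$ is the essential supremum. *)

(* Defs.v *)
From HB Require Import structures.
From mathcomp Require Import all_boot all_order all_algebra.
From mathcomp Require Import all_classical all_reals all_analysis.
From mathcomp Require Import measurable_realfun ess_sup_inf complex ring lra.

Set Implicit Arguments.
Unset Strict Implicit.
Unset Printing Implicit Defensive.

Import Order.TTheory GRing.Theory Num.Theory.
Import numFieldNormedType.Exports.

Local Open Scope classical_set_scope.
Local Open Scope ring_scope.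
Local Open Scope complex_scope.

(* R^3 and R^4 = R^3 * R are iterated products, so that they carry both the
   normed module structure and the product sigma-algebra of the library. *)
Notation E3 R := (R * R * R)%type.
Notation E4 R := (R * R * R * R)%type.

(* The library's Lebesgue measure lives on measurableTypeR R, a copy of R. *)
Notation mE3 R := (measurableTypeR R * measurableTypeR R * measurableTypeR R)%type.

Section vectors.
Variable R : realType.

Definition coord3 (x : E3 R) (i : 'I_3) : R :=
  [:: x.1.1; x.1.2; x.2]`_i.

Definition std4 (i : 'I_4) : E4 R :=
  [:: (1, 0, 0, 0); (0, 1, 0, 0); (0, 0, 1, 0); (0, 0, 0, 1)]`_i.

(* The Euclidean inner product of R^4; the norm of the library on a product is
   the sup norm and is only used for the topology. *)
Definition dot4 (u v : E4 R) : R :=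
  u.1.1.1 * v.1.1.1 + u.1.1.2 * v.1.1.2 + u.1.2 * v.1.2 + u.2 * v.2.

End vectors.
Arguments std4 {R}.

Record lattice3 (R : realType) := Lattice3 {
  lat_basis :> 'I_3 -> E3 R;
  lat_free : forall s : 'I_3 -> R,
    \sum_i s i *: lat_basis i = 0 -> forall i, s i = 0 }.

Section lattice.
Variables (R : realType) (G : lattice3 R).

Definition in_lattice : set (E3 R) :=
  [set x | exists n : 'I_3 -> int, x = \sum_i (n i)%:~R *: G i].

Definition fundamental_domain : set (E3 R) :=
  [set x | exists2 s : 'I_3 -> R,
     forall i, 0 <= s i < 1 & x = \sum_i s i *: G i].

Definition lat_eq (x y : E3 R) : bool := `[< in_lattice (x - y) >].

Lemma lat_eq_refl : reflexive lat_eq.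
Proof.
move=> x; apply/asboolP; exists (fun=> 0); rewrite subrr big1// => i _.
by rewrite scale0r.
Qed.

Lemma lat_eq_sym : symmetric lat_eq.
Proof.
have h x y : lat_eq x y -> lat_eq y x.
  move=> /asboolP[n xyE]; apply/asboolP; exists (fun i => - n i).
  rewrite -opprB xyE -sumrN; apply: eq_bigr => i _.
  by rewrite rmorphN scaleNr.
by move=> x y; apply/idP/idP; exact: h.
Qed.

Lemma lat_eq_trans : transitive lat_eq.
Proof.
move=> y x z /asboolP[n xyE] /asboolP[m yzE]; apply/asboolP.
exists (fun i => n i + m i); rewrite -(subrKA y) xyE yzE -big_split/=.
by apply: eq_bigr => i _; rewrite rmorphD scalerDl.
Qed.

Canonical lat_equiv := EquivRel lat_eq lat_eq_refl lat_eq_sym lat_eq_trans.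

Let gram : 'M[R]_3 := \matrix_(i, j) coord3 (G i) j.

Lemma coord3_comb (s : 'I_3 -> R) (j : 'I_3) :
  coord3 (\sum_i s i *: G i) j = \sum_i s i * coord3 (G i) j.
Proof.
by rewrite !big_ord_recl !big_ord0; case: j => -[|[|[|//]]] ? /=.
Qed.

Lemma coord3_inj (x y : E3 R) : (forall j, coord3 x j = coord3 y j) -> x = y.
Proof.
move: x y => [[x0 x1] x2] [[y0 y1] y2] xy.
have := xy 0; have := xy 1; have := xy 2%:R.
by rewrite /coord3/= => -> -> ->.
Qed.

Lemma lat_basis_unitmx : gram \in unitmx.
Proof.
rewrite -row_free_unit -kermx_eq0; apply/eqP/row_matrixP => k.
rewrite row0; set v := row k _.
have vM : v *m gram = 0 by rewrite -row_mul mulmx_ker row0.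
apply/rowP => i; rewrite [RHS]mxE.
apply: (@lat_free R G (fun i => v 0 i)); apply: coord3_inj => j.
rewrite coord3_comb.
have := congr1 (fun A : 'rV_3 => A 0 j) vM; rewrite !mxE.
under eq_bigr do rewrite [gram _ _]mxE.
by move=> ->; case: (j) => -[|[|[|//]]].
Qed.

Let icoord (x : E3 R) (i : 'I_3) : R :=
  \sum_j coord3 x j * invmx gram j i.

Lemma fundamental_domainE :
  fundamental_domain = \bigcap_(i in [set: 'I_3]) ((icoord^~ i) @^-1` `[0, 1[).
Proof.
have combE (s : 'I_3 -> R) x : x = \sum_i s i *: G i <-> forall i, s i = icoord x i.
  have E : (\row_j coord3 x j = (\row_i s i) *m gram) <-> x = \sum_i s i *: G i.
    split => [xs|->].
      apply: coord3_inj => j; rewrite coord3_comb.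
      by have := congr1 (fun A : 'rV_3 => A 0 j) xs; rewrite !mxE => ->;
        apply: eq_bigr => i _; rewrite !mxE.
    apply/rowP => j; rewrite !mxE coord3_comb.
    by apply: eq_bigr => i _; rewrite !mxE.
  have F : (\row_i s i = (\row_j coord3 x j) *m invmx gram) <->
      forall i, s i = icoord x i.
    split => [sx i|sx].
      have := congr1 (fun A : 'rV_3 => A 0 i) sx; rewrite !mxE => ->.
      by apply: eq_bigr => j _; rewrite mxE.
    apply/rowP => i; rewrite !mxE sx.
    by apply: eq_bigr => j _; rewrite mxE.
  rewrite -E -F; split => ->.
    by rewrite mulmxK// lat_basis_unitmx.
  by rewrite mulmxKV// lat_basis_unitmx.
apply/seteqP; split => [x [s s01 /combE sx] i _|x x01].
  by rewrite /= in_itv/= -sx.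
exists (icoord x); last exact/combE.
by move=> i; have := x01 i I; rewrite /= in_itv.
Qed.

Lemma measurable_fundamental_domain :
  measurable (fundamental_domain : set (mE3 R)).
Proof.
rewrite fundamental_domainE; apply: fin_bigcap_measurable => // i _.
rewrite -[X in measurable X]setTI; apply: (_ : measurable_fun _ _) => //.
rewrite /icoord; apply: measurable_sum => j.
apply: measurable_funM => //.
have m0 : measurable_fun [set: E3 R] (fun x : E3 R => x.1.1).
  exact: (measurableT_comp measurable_fst measurable_fst).
have m1 : measurable_fun [set: E3 R] (fun x : E3 R => x.1.2).
  exact: (measurableT_comp measurable_snd measurable_fst).
have m2 : measurable_fun [set: E3 R] (fun x : E3 R => x.2).
  exact: measurable_snd.
by case: j => -[|[|[|//]]] ?.
Qed.

End lattice.

Section torus.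
Local Open Scope quotient_scope.
Variables (R : realType) (G : lattice3 R).

Definition torus := {eq_quot (lat_equiv G)}.

HB.instance Definition _ := Topological.copy torus (quotient_topology torus).
HB.instance Definition _ := Quotient.on torus.
HB.instance Definition _ := isPointed.Build torus (\pi_torus (0 : E3 R)).

Definition torus_proj : E3 R -> torus := \pi_torus.

(* The quotient sigma-algebra, which is the Borel sigma-algebra of the torus. *)
Definition torus_measurable : set (set torus) :=
  [set A | measurable (torus_proj @^-1` A : set (mE3 R))].

Let tm0 : torus_measurable set0.
Proof. by rewrite /torus_measurable/= preimage_set0. Qed.

Let tmC A : torus_measurable A -> torus_measurable (~` A).
Proof. by rewrite /torus_measurable/= preimage_setC; exact: measurableC. Qed.

Let tmU (F : (set torus)^nat) : (forall i, torus_measurable (F i)) ->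
  torus_measurable (\bigcup_i F i).
Proof.
by move=> mF; rewrite /torus_measurable/= preimage_bigcup; exact: bigcupT_measurable.
Qed.

HB.instance Definition _ :=
  @isMeasurable.Build default_measure_display torus torus_measurable tm0 tmC tmU.

Lemma measurable_torus_proj :
  measurable_fun [set: mE3 R] (torus_proj : mE3 R -> torus).
Proof. by move=> _ A mA; rewrite setTI. Qed.

Definition lebesgue3 : {measure set (mE3 R) -> \bar R} :=
  ((@lebesgue_measure R \x @lebesgue_measure R) \x @lebesgue_measure R)%E.

Let leb3_fd : {measure set (mE3 R) -> \bar R} :=
  mrestr lebesgue3 (measurable_fundamental_domain G).

(* The Riemannian measure of the flat torus: the volume of A is the Lebesgue
   measure of the part of its preimage lying in a fundamental domain. *)
Definition dvol_torus : set torus -> \bar R :=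
  pushforward (mrestr lebesgue3 (measurable_fundamental_domain G))
    (torus_proj : mE3 R -> torus).

Let dt0 : dvol_torus set0 = 0%E.
Proof. by rewrite /dvol_torus/pushforward preimage_set0 (measure0 leb3_fd). Qed.

Let dt_ge0 A : (0 <= dvol_torus A)%E.
Proof. exact: (measure_ge0 leb3_fd). Qed.

Let dt_sigma_additive : semi_sigma_additive dvol_torus.
Proof.
move=> F mF tF mUF; rewrite /dvol_torus /pushforward preimage_bigcup.
apply: (@measure_semi_sigma_additive _ _ _ leb3_fd) => //.
- apply/trivIsetP => /= i j _ _ ij; rewrite -preimage_setI.
  by move/trivIsetP : tF => /(_ _ _ _ _ ij) ->//; rewrite preimage_set0.
Qed.

HB.instance Definition _ :=
  isMeasure.Build _ _ _ dvol_torus dt0 dt_ge0 dt_sigma_additive.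

Definition dvol : {measure set (torus * measurableTypeR R) -> \bar R} :=
  (dvol_torus \x @lebesgue_measure R)%E.

End torus.

Notation cylinder G := (torus G * measurableTypeR _)%type.

Section smooth.
Variables (R : realType) (V : normedModType R).

Definition iter_derive (vs : seq V) (F : V -> R) : V -> R :=
  foldr (fun v g => fun x => 'D_v g x) F vs.

Definition smooth (F : V -> R) : Prop :=
  forall (vs : seq V) (x : V), differentiable (iter_derive vs F) x.

End smooth.

Record complex_iso (R : realType) := ComplexIso {
  ci_fun :> E4 R -> 'rV[R[i]]_2;
  ci_inv : 'rV[R[i]]_2 -> E4 R;
  ci_add : forall u v, ci_fun (u + v) = ci_fun u + ci_fun v;
  ci_scale : forall (a : R) u, ci_fun (a *: u) = a%:C *: ci_fun u;
  ci_funK : cancel ci_fun ci_inv;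
  ci_invK : cancel ci_inv ci_fun }.

Section complex_structure.
Variables (R : realType) (L : complex_iso R).

Definition cstruct (v : E4 R) : E4 R := ci_inv L ('i *: L v).

Definition cstruct_isometry : Prop :=
  forall u v : E4 R, dot4 (cstruct u) (cstruct v) = dot4 u v.

Definition cderive (v : E4 R) (F : E4 R -> R[i]) : E4 R -> R[i] :=
  fun x => 'D_v (fun y => complex.Re (F y)) x +i* 'D_v (fun y => complex.Im (F y)) x.

(* Complex-valued differential forms on R^4, as functions of the point and of
   one (resp. two) constant vector fields. *)
Definition form1 := E4 R -> E4 R -> R[i].
Definition form2 := E4 R -> E4 R -> E4 R -> R[i].

(* The (0,1)-part of dF. *)
Definition dbar (F : E4 R -> R[i]) : form1 :=
  fun x v => (cderive v F x + 'i * cderive (cstruct v) F x) / 2%:R.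

Definition ext_d (a : form1) : form2 := fun x u v =>
  cderive u (fun y => a y v) x - cderive v (fun y => a y u) x.

(* If a is of type (0,1), then ext_d a is the sum of a (1,1)-form, which is
   invariant under cstruct, and of a (0,2)-form, which is anti-invariant; the
   former is the image of a by the operator \partial. *)
Definition del (a : form1) : form2 := fun x u v =>
  (ext_d a x u v + ext_d a x (cstruct u) (cstruct v)) / 2%:R.

Definition kahler (u v : E4 R) : R := dot4 (cstruct u) v.

Definition kahler_mul (F : E4 R -> R[i]) : form2 :=
  fun x u v => F x * (kahler u v)%:C.

(* The pointwise Hermitian product induced on 2-forms by dot4. *)
Definition form2_dot (a b : form2) (x : E4 R) : R[i] :=
  \sum_(i < 4) \sum_(j < 4 | (i < j)%N)
    a x (std4 i) (std4 j) * (b x (std4 i) (std4 j))^*.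

Definition Lambda (a : form2) : E4 R -> R[i] :=
  form2_dot a (kahler_mul (fun=> 1)).

Lemma Lambda_adjoint (F : E4 R -> R[i]) (a : form2) (x : E4 R) :
  form2_dot (kahler_mul F) a x = F x * (Lambda a x)^*.
Proof.
rewrite /Lambda /form2_dot rmorph_sum mulr_sumr; apply: eq_bigr => i _.
rewrite rmorph_sum mulr_sumr; apply: eq_bigr => j _.
rewrite /kahler_mul mul1r rmorphM -mulrA mulrC [in RHS]mulrC; congr (_ * _).
rewrite mulrC; congr (_ * _).
by apply/eqP; rewrite eq_complex /= opprK !eqxx.
Qed.

Definition complex_laplacian (F : E4 R -> R[i]) : E4 R -> R[i] :=
  fun x => - 'i * Lambda (del (dbar F)) x.

(* Taking the real part loses nothing: on a real-valued C^2 function, the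
   imaginary part of complex_laplacian vanishes by symmetry of the second
   derivatives. See laplacianE below for an explicit formula. *)
Definition laplacian (F : E4 R -> R) : E4 R -> R :=
  fun x => complex.Re (complex_laplacian (fun y => (F y)%:C) x).

End complex_structure.

Lemma antisym_sum (R : realType) (om A : 'I_4 -> 'I_4 -> R) :
  (forall i j, om j i = - om i j) ->
  \sum_(i < 4) \sum_(j < 4 | (i < j)%N) (A i j - A j i) * om i j =
  \sum_i \sum_j om i j * A i j.
Proof.
move=> omN.
have om0 i : om i i = 0 by have := omN i i; lra.
transitivity (\sum_(i < 4) (\sum_(j < 4 | (i < j)%N) om i j * A i j +
                      \sum_(j < 4 | (j < i)%N) om i j * A i j)).
  rewrite big_split /=.
  have -> : \sum_(i < 4) \sum_(j < 4 | (j < i)%N) om i j * A i j =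
            \sum_(i < 4) \sum_(j < 4 | (i < j)%N) om j i * A j i.
    under eq_bigr do rewrite big_mkcond.
    by rewrite exchange_big /=; apply: eq_bigr => i _; rewrite -big_mkcond.
  rewrite -big_split; apply: eq_bigr => i _; rewrite -big_split.
  by apply: eq_bigr => j _; rewrite /= (omN i j); ring.
apply: eq_bigr => i _.
rewrite [RHS](bigID (fun j : 'I_4 => (i < j)%N)) /=; congr (_ + _).
rewrite [RHS](bigD1 i) ?ltnn//= om0 mul0r add0r.
by apply: eq_bigl => j; rewrite -leqNgt ltn_neqAle andbC.
Qed.

Section laplacianE.
Variables (R : realType) (L : complex_iso R).
Local Notation J := (cstruct L).

Lemma cstructD u v : J (u + v) = J u + J v.
Proof.
apply: (can_inj (ci_funK L)); rewrite ci_add /cstruct !ci_invK ci_add.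
by rewrite scalerDr.
Qed.

Lemma cstructZ (a : R) u : J (a *: u) = a *: J u.
Proof.
apply: (can_inj (ci_funK L)); rewrite ci_scale /cstruct !ci_invK ci_scale.
by rewrite !scalerA mulrC.
Qed.

Lemma cstructK u : J (J u) = - u.
Proof.
apply: (can_inj (ci_funK L)); rewrite /cstruct !ci_invK -scaleN1r.
rewrite (_ : -1 = (-1 : R)) // ci_scale scalerA; congr (_ *: _).
by apply/eqP; rewrite eq_complex /=; apply/andP; split; apply/eqP; ring.
Qed.

Let entry (u : E4 R) (i : 'I_4) : R := dot4 (std4 i) u.

Lemma E4_sum (u : E4 R) : u = \sum_i entry u i *: std4 i.
Proof.
case: u => [[[a b] c] d]; rewrite !big_ord_recl big_ord0 /entry /dot4 /=.
by congr (_, _, _, _); rewrite /= /GRing.scale /=; ring.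
Qed.

Variable (F : E4 R -> R).
Hypothesis sF : smooth F.
Let dF y : differentiable F y. Proof. exact: (sF [::] y). Qed.
Let ddF v y : differentiable (fun z => 'D_v F z) y.
Proof. exact: (sF [:: v] y). Qed.

Lemma dbarE y v :
  dbar L (fun z => (F z)%:C) y v = (2^-1 * 'D_v F y) +i* (2^-1 * 'D_(J v) F y).
Proof.
rewrite /dbar /cderive /= !derive_cst.
rewrite (_ : (2%:R : R[i])^-1 = (2^-1)%:C); last by rewrite fmorphV rmorph_nat.
by apply/eqP; rewrite eq_complex /=; apply/andP; split; apply/eqP; ring.
Qed.

Let H x u v : R := 'D_u (fun y => 'D_v F y) x.

Lemma hess_suml x (s : 'I_4 -> R) (w : 'I_4 -> E4 R) v :
  H x (\sum_i s i *: w i) v = \sum_i s i * H x (w i) v.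
Proof.
rewrite /H deriveE// linear_sum; apply: eq_bigr => i _.
by rewrite linearZ /= deriveE.
Qed.

Lemma hess_sumr x (s : 'I_4 -> R) (w : 'I_4 -> E4 R) u :
  H x u (\sum_i s i *: w i) = \sum_i s i * H x u (w i).
Proof.
rewrite /H (_ : (fun y => 'D_(\sum_i s i *: w i) F y) =
    \sum_i (s i \*: (fun y => 'D_(w i) F y))); last first.
  apply/funext => y; rewrite deriveE// linear_sum fct_sumE; apply: eq_bigr => i _.
  by rewrite linearZ /= deriveE.
rewrite derive_sum; last by move=> i; apply/derivableZ/diff_derivable.
apply: eq_bigr => i _; rewrite deriveZ//; exact/diff_derivable.
Qed.

Lemma hessNl x u v : H x (- u) v = - H x u v.
Proof. by rewrite /H !deriveE// linearN. Qed.

Lemma hessNr x u v : H x u (- v) = - H x u v.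
Proof.
rewrite /H (_ : (fun y => 'D_(- v) F y) = - (fun y => 'D_v F y)); last first.
  by apply/funext => y; rewrite fctE !deriveE// linearN.
by rewrite deriveN//; exact/diff_derivable.
Qed.

Hypothesis isoL : cstruct_isometry L.

Let om i j := kahler L (std4 i) (std4 j).

Lemma kahler_antisym u v : kahler L u v = - kahler L v u.
Proof.
rewrite /kahler -isoL cstructK /dot4 /= ; ring.
Qed.

Lemma omE i : J (std4 i) = \sum_j om i j *: std4 j.
Proof.
rewrite [LHS]E4_sum; apply: eq_bigr => j _; congr (_ *: _).
by rewrite /entry /om /kahler /dot4; ring.
Qed.

Lemma JomE j : std4 j = \sum_i om i j *: J (std4 i).
Proof.
have -> : \sum_i om i j *: J (std4 i) = J (\sum_i om i j *: std4 i).
  have J0 : J 0 = 0 by have := cstructZ 0 0; rewrite !scale0r.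
  by rewrite (big_morph J cstructD J0); apply: eq_bigr => i _; rewrite cstructZ.
have -> : \sum_i om i j *: std4 i = - J (std4 j).
  rewrite omE -sumrN; apply: eq_bigr => i _.
  by rewrite /om kahler_antisym scaleNr.
by rewrite -scaleN1r cstructZ cstructK scaleN1r opprK.
Qed.

Lemma Im_del x u v : complex.Im (del L (dbar L (fun z => (F z)%:C)) x u v) =
  (H x u (J v) - H x v (J u) + H x (J v) u - H x (J u) v) / 4.
Proof.
have E w w' : complex.Im
    (cderive w (fun y => dbar L (fun z => (F z)%:C) y w') x) = 2^-1 * H x w (J w').
  change ('D_w (fun y => complex.Im (dbar L (fun z => (F z)%:C) y w')) x =
    2^-1 * H x w (J w')).
  rewrite (_ : (fun y => _) = 2^-1 \*: (fun y => 'D_(J w') F y)).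
    by rewrite deriveZ//; exact/diff_derivable.
  by apply/funext => y; rewrite dbarE.
have ImE (a b c d : R[i]) (k : R) : complex.Im ((a - b + (c - d)) * k%:C) =
    (complex.Im a - complex.Im b + (complex.Im c - complex.Im d)) * k.
  by case: a b c d => [? ?] [? ?] [? ?] [? ?] /=; ring.
rewrite /del /ext_d.
rewrite (_ : (2%:R : R[i])^-1 = (2^-1)%:C); last by rewrite fmorphV rmorph_nat.
move: (E u v) (E v u) (E (J u) (J v)) (E (J v) (J u)).
move: (cderive _ _ _) (cderive _ _ _) (cderive _ _ _) (cderive _ _ _).
move=> a b c d Ea Eb Ec Ed; rewrite ImE Ea Eb Ec Ed !cstructK !hessNr.
by move: (H x u _) (H x v _) (H x _ u) (H x _ v) => p q r t; field.
Qed.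

Lemma laplacianE x : laplacian L F x = - 2^-1 * \sum_i 'D_(std4 i) (fun y => 'D_(std4 i) F y) x.
Proof.
have -> : laplacian L F x = \sum_(i < 4) \sum_(j < 4 | (i < j)%N)
    complex.Im (del L (dbar L (fun z => (F z)%:C)) x (std4 i) (std4 j)) * om i j.
  rewrite /laplacian /complex_laplacian /Lambda /form2_dot.
  rewrite (_ : forall z : R[i], complex.Re (- 'i * z) = complex.Im z); last first.
    by move=> -[a b] /=; ring.
  rewrite raddf_sum; apply: eq_bigr => i _.
  rewrite raddf_sum; apply: eq_bigr => j _.
  rewrite /kahler_mul mul1r /om.
  by case: (del _ _ _ _ _) => a b /=; ring.
transitivity (\sum_i \sum_j om i j * ((H x (std4 i) (J (std4 j)) - H x (J (std4 i)) (std4 j)) / 4)).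
  under eq_bigr do under eq_bigr do rewrite Im_del.
  rewrite -(@antisym_sum R om); last first.
    by move=> i j; rewrite /om kahler_antisym.
  apply: eq_bigr => i _; apply: eq_bigr => j _; congr (_ * _).
  move: (H x _ (J (std4 j))) (H x (J (std4 i)) _) (H x _ (J (std4 i)))
    (H x (J (std4 j)) _) => p q r t; by field.
have -> : \sum_i \sum_j om i j *
      ((H x (std4 i) (J (std4 j)) - H x (J (std4 i)) (std4 j)) / 4) =
    (\sum_i H x (std4 i) (\sum_j om i j *: J (std4 j)) -
     \sum_j H x (\sum_i om i j *: J (std4 i)) (std4 j)) / 4.
  under [X in _ = (X - _) / 4]eq_bigr do rewrite hess_sumr.
  under [X in _ = (_ - X) / 4]eq_bigr do rewrite hess_suml.
  rewrite [X in _ = (_ - X) / 4]exchange_big -sumrB mulr_suml.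
  apply: eq_bigr => i _; rewrite -sumrB mulr_suml; apply: eq_bigr => j _.
  move: (H x _ _) (H x (J _) _) (om i j) => p q r. by field.
have E2 : \sum_j H x (\sum_i om i j *: J (std4 i)) (std4 j) =
    \sum_j H x (std4 j) (std4 j).
  by apply: eq_bigr => j _; rewrite -JomE.
have E1 : \sum_i H x (std4 i) (\sum_j om i j *: J (std4 j)) =
    - \sum_i H x (std4 i) (std4 i).
  rewrite -sumrN; apply: eq_bigr => i _; rewrite -hessNr; congr (H x _ _).
  rewrite [in RHS]JomE -sumrN; apply: eq_bigr => j _.
  by rewrite /om kahler_antisym scaleNr.
transitivity ((- (\sum_i H x (std4 i) (std4 i)) - \sum_i H x (std4 i) (std4 i)) / 4).
  exact: (congr2 (fun a b => (a - b) / 4) E1 E2).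
rewrite -[RHS]/(- 2^-1 * (\sum_i H x (std4 i) (std4 i))).
by move: (\sum_i _) => p; field.
Qed.
End laplacianE.

Section distributions.
Variables (R : realType) (G : lattice3 R) (L : complex_iso R).

Definition lift (f : cylinder G -> R) : E4 R -> R :=
  fun p => f (torus_proj G p.1, p.2).

Definition test_function (chi : cylinder G -> R) : Prop :=
  smooth (lift chi) /\ compact (closure [set p : cylinder G | chi p != 0]).

(* The lift of f is invariant under the translations by the lattice, and so is
   its Laplacian: the choice of a representative is irrelevant. *)
Definition laplacianX (f : cylinder G -> R) : cylinder G -> R :=
  fun p => laplacian L (lift f) (repr p.1, p.2).

(* The distribution \Delta_X f, for f locally integrable: \Delta_X is
   formally self-adjoint. *)
Definition dist_laplacian (f chi : cylinder G -> R) : \bar R :=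
  (\int[dvol G]_p (f p * laplacianX chi p)%:E)%E.

Definition dist_laplacian_le (f h : cylinder G -> R) : Prop :=
  forall chi, test_function chi -> (forall p, 0 <= chi p) ->
    (dist_laplacian f chi <= \int[dvol G]_p (h p * chi p)%:E)%E.

Definition dist_laplacian_eq0 (f : cylinder G -> R) : Prop :=
  forall chi, test_function chi -> dist_laplacian f chi = 0%E.

Definition ess_bounded (f : cylinder G -> R) : Prop :=
  exists M : R, \forall p \ae dvol G, `|f p| <= M.

End distributions.

(* Main.v *)
(* Testing Delta f <= B phi against suitable nonnegative functions turns it
   into integral estimates, without any regularity theory. Put I = int f phi.

   First, take functions u(t) of the height alone, cut off at a height tending
   to infinity. If u is a smooth version of t |-> min(t, s) for t > 0 and of 0
   for t < 0 (and symmetrically for s < 0), then Delta u is a bump at height s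
   minus a bump at height 0 that decays like phi. Hence f has mass at most
   K (B + I) on the slab |t - s| <= 1, uniformly in s.

   Second, take chi = (|x - P|^2 + eps^2)^-1 cut off at a fixed radius smaller
   than the shortest lattice vector. In real dimension 4,
   Delta chi = 4 eps^2 / (|x - P|^2 + eps^2)^3 near P, which is of order eps^-4
   on the cube of size eps; elsewhere Delta chi >= -D, with D independent of
   eps, and int chi is bounded independently of eps. With the first step, the
   mean of f over every cube of size eps is at most K (B + I), and so f is
   almost everywhere at most K (B + I) <= K (B + 1) (1 + I).

   If Delta f <= 0, let psi_n be a cutoff at height n. Since Delta psi_n is
   O(n^-2) on a slab of height O(n), the integral of f Delta psi_n tends to 0.
   A test function chi satisfies |chi| <= C psi_n for n large, and the
   inequality for C psi_n + chi and C psi_n - chi forces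
   int f Delta chi = 0. *)
From HB Require Import structures.
Require Import Defs.
From mathcomp Require Import all_boot all_order all_algebra.
From mathcomp Require Import all_classical all_reals all_analysis.
From mathcomp Require Import measurable_realfun ess_sup_inf complex ring lra.

Set Implicit Arguments.
Unset Strict Implicit.
Unset Printing Implicit Defensive.

Import Order.TTheory GRing.Theory Num.Theory.
Import numFieldNormedType.Exports.

Local Open Scope classical_set_scope.
Local Open Scope ring_scope.

(** * Smooth functions and cutoffs *)

(** Pointwise values of [f] have no meaning, so the inequality is used only through integrals,
    always in one shape ([test_inequality]): a test function [chi] with [A <= Delta chi + E], where
    [A] is a multiple of the indicator of the set whose mass is wanted and the integral of [f * E]
    is already controlled. For slabs, [E] is the bump at height 0, dominated by [phi], plus a cutoff
    error. For cubes, [E] is a multiple of the indicator of a slab; this is why slabs come before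
    cubes and why their estimate must be uniform in [s]. The bound [M] of [f] must not enter the
    constant: it multiplies only the cutoff error, which tends to 0. The kernel regularises |x|^-2,
    which is harmonic off the origin in dimension 4. Smoothing at scale [eps] spreads its point mass
    into a density of order eps^-4, the inverse volume of the cube, so that the bound on the mean
    does not degenerate as [eps] tends to 0. To pass from means to values, a weak density theorem is
    enough: a set of positive measure fills half of some arbitrarily small cube. *)

Section smooth_functions.
Variables (R : realType).

(** [smooth] speaks of lists of directions. Peeling off one derivative at a time, with a finite
    order, allows closure under products, inverses and composition to be proved by induction on the
    order. *)
Fixpoint differentiable_upto (V : normedModType R) (n : nat) (F : V -> R) : Prop :=
  (forall x, differentiable F x) /\
  (if n is m.+1 then forall v, differentiable_upto m (fun x => 'D_v F x) else True).

Section basics.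
Variable V : normedModType R.
Implicit Types F G : V -> R.
Local Notation Ck := (@differentiable_upto V).

Lemma smoothP F : smooth F <-> forall n, Ck n F.
Proof.
split.
  move=> sF n; elim: n F sF => [|n IH] F sF; split => //; try exact: (sF [::]).
  move=> v; apply: IH => vs x; have := sF (rcons vs v) x.
  by rewrite /iter_derive -cats1 foldr_cat.
move=> H vs; elim/last_ind: vs F H => [|vs v IH] F H x; first exact: (H 0%N).1.
rewrite /iter_derive -cats1 foldr_cat /=.
by apply: (IH (fun y => 'D_v F y)) => n; exact: (H n.+1).2.
Qed.

Lemma Ck_diff n F x : Ck n F -> differentiable F x.
Proof. by case: n => [|n] []. Qed.

Lemma CkW n F : Ck n.+1 F -> Ck n F.
Proof.
elim: n F => [|n IH] F [dF HF]; split => //.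
by move=> v; apply: IH; exact: HF.
Qed.

Lemma Ck_cst n c : Ck n (fun=> c).
Proof.
elim: n c => [|n IH] c; split => //; try by move=> x; exact: differentiable_cst.
move=> v; rewrite (_ : (fun x => 'D_v _ x) = fun=> 0); first exact: IH.
by apply/funext => x; rewrite [LHS]derive_cst.
Qed.

Lemma CkD n F G : Ck n F -> Ck n G -> Ck n (fun x => F x + G x).
Proof.
elim: n F G => [|n IH] F G [dF HF] [dG HG]; split => //;
  try by move=> x; exact: differentiableD.
move=> v; rewrite (_ : (fun x => 'D_v _ x) = fun x => 'D_v F x + 'D_v G x).
  exact: IH (HF v) (HG v).
by apply/funext => x; rewrite deriveD//; exact: diff_derivable.
Qed.

Lemma CkM n F G : Ck n F -> Ck n G -> Ck n (fun x => F x * G x).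
Proof.
elim: n F G => [|n IH] F G HF HG.
  by split => // x; apply: differentiableM; [exact: HF.1|exact: HG.1].
have [dF HF'] := HF; have [dG HG'] := HG.
split => [x|v]; first exact: differentiableM.
rewrite (_ : (fun x => 'D_v _ x) = fun x => F x * 'D_v G x + G x * 'D_v F x).
  exact: CkD (IH _ _ (CkW HF) (HG' v)) (IH _ _ (CkW HG) (HF' v)).
by apply/funext => x; rewrite deriveM//; exact: diff_derivable.
Qed.

Lemma CkN n F : Ck n F -> Ck n (fun x => - F x).
Proof.
move=> HF; rewrite (_ : (fun x => _) = fun x => -1 * F x).
  by apply: CkM => //; exact: Ck_cst.
by apply/funext => x; rewrite mulN1r.
Qed.

Lemma CkV n F : (forall x, F x != 0) -> Ck n F -> Ck n (fun x => (F x)^-1).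
Proof.
move=> F0; elim: n => [|n IH] HF.
  by split => // x; apply: differentiableV => //; exact: HF.1.
have [dF HF'] := HF.
split => [x|v]; first exact: differentiableV.
rewrite (_ : (fun x => 'D_v _ x) = fun x => (- ((F x)^-1 * (F x)^-1)) * 'D_v F x).
  apply: (CkM _ (HF' v)); apply: CkN.
  exact: CkM (IH (CkW HF)) (IH (CkW HF)).
apply/funext => x; rewrite deriveV//; last exact: diff_derivable.
by rewrite /GRing.scale/= -exprVn expr2.
Qed.

Lemma Ck_linear n F : (forall x, differentiable F x) ->
  (forall v x, 'D_v F x = F v) -> Ck n F.
Proof.
move=> dF DF; case: n => [|n]; split => // v.
rewrite (_ : (fun x => 'D_v _ x) = fun=> F v); first exact: Ck_cst.
exact/funext.
Qed.

Lemma near0_differentiable F x : (\forall y \near x, F y = 0) -> differentiable F x.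
Proof.
move=> F0; apply/diffP => /=.
(* The differential is chosen by [get] among the continuous linear maps with the right expansion, so
   one witness is enough: here the zero map. *)
apply: (@getPex _ (fun (df : {linear V -> R}) => continuous df /\
  forall y, F y = F (lim (nbhs x)) + df (y - lim (nbhs x))
                  +o_(y \near x) (y - lim (nbhs x)))).
exists (\0 : {linear V -> R}); split => [y|]; first exact: cst_continuous.
have H : F =o_x (fun z => z - x).
  apply/eqoP => e e0; near=> z; rewrite (near F0 z)// normr0.
  exact: mulr_ge0 (ltW e0) (normr_ge0 _).
by apply: eqaddoEx => y; rewrite lim_id//= (nbhs_singleton F0) !add0r {1}H.
Unshelve. all: by end_near. Qed.

Lemma near_eq_differentiable F G x :
  (\forall y \near x, F y = G y) -> differentiable G x -> differentiable F x.
Proof.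
move=> FG dG; rewrite (_ : F = G + (F - G)); last by rewrite addrC subrK.
apply: differentiableD => //; apply: near0_differentiable.
by near=> y; rewrite fctE (near FG y)// subrr.
Unshelve. all: by end_near. Qed.

(** Needed for the kernel on the cylinder: its lift is given near each point by a formula that
    changes from point to point. *)
Lemma Ck_local n F :
  (forall x : V, exists2 G, Ck n G & \forall y \near x, F y = G y) -> Ck n F.
Proof.
elim: n F => [|n IH] F H; split => //.
- by move=> x; have [G [dG _] FG] := H x; apply: near_eq_differentiable FG (dG x).
- by move=> x; have [G [dG _] FG] := H x; apply: near_eq_differentiable FG (dG x).
- move=> v; apply: IH => x; have [G [_ HG] FG] := H x.
  exists (fun x => 'D_v G x); first exact: HG.
  by have := near_join FG; apply: filterS => y; exact: near_eq_derive.
Qed.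

End basics.

Lemma Ck_comp n (V : normedModType R) (F : V -> R) (g : R -> R) :
  differentiable_upto n g -> differentiable_upto n F ->
  differentiable_upto n (fun x => g (F x)).
Proof.
elim: n g F => [|n IH] g F Hg HF.
  by split => // x; apply: differentiable_comp; [exact: HF.1|exact: Hg.1].
have [dF HF'] := HF; have [dg Hg'] := Hg.
split => [x|v]; first exact: differentiable_comp.
rewrite (_ : (fun x => 'D_v _ x) = fun x => 'D_1 g (F x) * 'D_v F x).
  exact: CkM (IH _ _ (Hg' 1) (CkW HF)) (HF' v).
apply/funext => x; rewrite deriveE; last exact: differentiable_comp.
rewrite diff_comp//= (_ : 'd F x v = 'd F x v *: 1); last exact/esym/mulr1.
by rewrite linearZ/= -!deriveE// mulrC.
Qed.

End smooth_functions.

(** * A smooth cutoff on the line *)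

Section cutoff_function.
Variable R : realType.
Local Notation Ck := (@differentiable_upto R R).

Lemma Ck_real_step n (g g' : R -> R) :
  (forall x, is_derive (x : R) (1 : R) g (g' x)) -> Ck n g' -> Ck n.+1 g.
Proof.
move=> dg Hg'; have dfg x : differentiable g x by apply/derivable1_diffP.
split => // v; rewrite (_ : (fun x => 'D_v g x) = fun x => v * g' x).
  by apply: CkM => //; exact: Ck_cst.
apply/funext => x; rewrite deriveE//.
rewrite (_ : v = v *: 1); last exact/esym/mulr1.
by rewrite linearZ/= -deriveE// derive_val /GRing.scale/= mulr1.
Qed.

Lemma is_derive_quadratic (F : R -> R) (C : R) :
  F 0 = 0 -> (forall x, `|F x| <= C * x ^+ 2) -> is_derive (0 : R) (1 : R) F 0.
Proof.
move=> F00 FC.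
have C0 : 0 <= C by have := FC 1; rewrite expr1n mulr1; exact: le_trans.
have H : h^-1 *: ((F \o shift 0) (h *: (1 : R)) - F 0) @[h --> (0:R)^'] --> (0:R).
  apply/cvgrPdist_le => e e0; near=> h.
  have h0 : h != 0 by near: h; exact: nbhs_dnbhs_neq.
  rewrite sub0r normrN /= F00 subr0 addr0 [h *: 1]mulr1 /GRing.scale/= normrM.
  rewrite normfV ler_pdivrMl ?normr_gt0// (le_trans (FC h))//.
  rewrite -(@real_normK _ h) ?num_real// expr2 mulrCA ler_wpM2l//.
  apply: (@le_trans _ _ (C * (e / (C + 1)))).
    apply: ler_wpM2l => //; near: h.
    apply: dnbhs0_le; rewrite divr_gt0// ltr_wpDl//.
  have C1 : 0 < C + 1 by rewrite ltr_wpDl.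
  rewrite mulrCA; apply: ler_piMr; first exact: ltW.
  by rewrite ler_pdivrMr// mul1r lerDl.
apply: DeriveDef; first by apply/cvg_ex; exists 0.
exact: cvg_lim H.
Unshelve. all: by end_near. Qed.

Lemma near_lt (x a : R) : x < a -> \forall y \near x, y < a.
Proof. exact: (@cvgr_lt _ _ _ _ id x cvg_id). Qed.

Lemma near_gt (x a : R) : a < x -> \forall y \near x, a < y.
Proof. exact: (@cvgr_gt _ _ _ _ id x cvg_id). Qed.

(** The functions x^-n e^(-1/x), extended by 0, have derivatives that are linear combinations of
    functions of the same family, whence smoothness by induction. Only [flat 0] enters the
    cutoff. *)
Definition flat (n : nat) (x : R) : R :=
  if 0 < x then x^-1 ^+ n * expR (- x^-1) else 0.

Lemma flat_ge0 n x : 0 <= flat n x.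
Proof.
rewrite /flat; case: ifPn => // x0.
by rewrite mulr_ge0 ?expR_ge0// exprn_ge0// invr_ge0 ltW.
Qed.

Lemma flat_le n x : `|flat n x| <= (n.+2)`!%:R * x ^+ 2.
Proof.
rewrite ger0_norm ?flat_ge0// /flat; case: ifPn => x0; last first.
  by rewrite mulr_ge0// sqr_ge0.
(* In terms of [y] the claim is y^(n+2) <= (n+2)! e^y, which keeps a single term of the exponential
   series. *)
set y := x^-1; have y0 : 0 < y by rewrite invr_gt0.
have -> : x = y^-1 by rewrite invrK.
have := @expR_ge1Dxn R y n.+1 (ltW y0).
move=> /(le_trans (ler_wpDl ler01 (lexx _))).
rewrite ler_pdivrMr ?ltr0n ?fact_gt0// => H.
rewrite expRN ler_pdivrMr ?expR_gt0// [y^-1 ^+ 2]exprVn mulrAC ler_pdivlMr ?exprn_gt0//.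
by rewrite -exprD addn2 mulrC.
Qed.

Lemma is_derive_flat n x :
  is_derive (x : R) (1 : R) (flat n) (- n%:R * flat n.+1 x + flat n.+2 x).
Proof.
have [x0|x0|->] := ltgtP x 0.
- rewrite {2 3}/flat ltNge (ltW x0)/= mulr0 addr0.
  apply: (near_eq_is_derive _ (is_derive_cst (0 : R) x (1 : R))).
  near=> y; rewrite /flat ifF//; apply/negbTE; rewrite -leNgt.
  by apply: ltW; near: y; exact: near_lt.
- rewrite {2 3}/flat x0.
  have xn0 : x != 0 by rewrite gt_eqF.
  have dV : is_derive (x : R) (1 : R) (fun y : R => y^-1) (- x ^- 2).
    have := @is_deriveV R id x 1 1 xn0 (is_derive_id _ _).
    by rewrite /GRing.scale/= mulr1.
  have dE : is_derive (x : R) (1 : R) (fun y : R => expR (- y^-1)) (expR (- x^-1) * x ^- 2).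
    have := @is_derive1_comp _ expR (fun y => - y^-1) x _ _ (is_derive_expR _) (is_deriveN dV).
    by rewrite opprK.
  have := is_deriveM (is_deriveX n dV) dE.
  move=> H; apply: is_derive_eq (near_eq_is_derive _ H) _.
    near=> y; have y0 : 0 < y by near: y; exact: near_gt.
    by rewrite /flat y0 /= exprfctE.
  rewrite /GRing.scale/= exprfctE.
  move: (expR _) => E; rewrite !exprVn.
  case: n {H} => [|n].
    by rewrite !mul0r mulr0 addr0 oppr0 mul0r add0r expr0 invr1 mul1r mulrC.
  have xn : x ^+ n != 0 by rewrite expf_neq0.
  rewrite /= !exprS -mulNrn -mulr_natl; move: (x ^+ n) xn => z z0.
  by rewrite expr0; field; rewrite xn0 z0.
- rewrite {2 3}/flat ltxx mulr0 addr0.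
  apply: (@is_derive_quadratic _ (n.+2)`!%:R); first by rewrite /flat ltxx.
  exact: flat_le.
Unshelve. all: by end_near. Qed.

Lemma Ck_flat n m : Ck n (flat m).
Proof.
elim: n m => [|n IH] m.
  split => // x; apply/derivable1_diffP.
  by have [] := is_derive_flat m x.
apply: Ck_real_step (is_derive_flat m) _.
by apply: CkD => //; apply: CkM => //; exact: Ck_cst.
Qed.

(** Meant for squared arguments, [t ^+ 2 / n ^+ 2] or [sqdist P x / rho ^+ 2]: the thresholds 1 and
    4 are then the radii 1 and 2, and no absolute value or square root spoils smoothness. *)
Definition cutoff (s : R) : R :=
  flat 0 (4 - s) / (flat 0 (4 - s) + flat 0 (s - 1)).

Lemma flat0_gt0 x : 0 < x -> 0 < flat 0 x.
Proof. by move=> x0; rewrite /flat x0 expr0 mul1r expR_gt0. Qed.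

Lemma flat0_le0 x : x <= 0 -> flat 0 x = 0.
Proof. by move=> x0; rewrite /flat ltNge x0. Qed.

Lemma cutoff_den_gt0 s : 0 < flat 0 (4 - s) + flat 0 (s - 1).
Proof.
have [s4|s4] := ltP s 4.
  by rewrite ltr_pwDl ?flat_ge0// flat0_gt0// subr_gt0.
by rewrite ltr_wpDl ?flat_ge0// flat0_gt0//; lra.
Qed.

Lemma cutoff_ge0 s : 0 <= cutoff s.
Proof. by rewrite divr_ge0 ?flat_ge0// ltW// cutoff_den_gt0. Qed.

Lemma cutoff_le1 s : cutoff s <= 1.
Proof. by rewrite ler_pdivrMr ?cutoff_den_gt0// mul1r lerDl flat_ge0. Qed.

Lemma cutoff1 s : s <= 1 -> cutoff s = 1.
Proof.
move=> s1; rewrite /cutoff (@flat0_le0 (s - 1)) ?subr_le0// addr0 divff// gt_eqF//.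
by rewrite flat0_gt0//; lra.
Qed.

Lemma cutoff0 s : 4 <= s -> cutoff s = 0.
Proof. by move=> s4; rewrite /cutoff (@flat0_le0 (4 - s)) ?subr_le0// mul0r. Qed.

Lemma Ck_id n : Ck n (fun x : R => x).
Proof. by apply: Ck_linear => [x|v x]; rewrite ?derive_id. Qed.

Lemma smooth_cutoff n : Ck n cutoff.
Proof.
have Cc (c : R) : Ck n (fun=> c) by exact: Ck_cst.
have C4 : Ck n (fun s => flat 0 (4 - s)).
  apply: (@Ck_comp _ n R (fun s : R => 4 - s)); first exact: Ck_flat.
  by apply: CkD => //; apply: CkN; exact: Ck_id.
have C1 : Ck n (fun s => flat 0 (s - 1)).
  apply: (@Ck_comp _ n R (fun s : R => s - 1)); first exact: Ck_flat.
  by apply: CkD => //; exact: Ck_id.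
apply: CkM => //; apply: CkV; last exact: CkD.
by move=> s; rewrite gt_eqF// cutoff_den_gt0.
Qed.

Definition cutoff' s : R := 'D_(1 : R) cutoff s.
Definition cutoff'' s : R := 'D_(1 : R) cutoff' s.

Lemma Ck_cutoff' n : Ck n cutoff'.
Proof. exact: (smooth_cutoff n.+1).2. Qed.

Lemma Ck_cutoff'' n : Ck n cutoff''.
Proof. exact: (Ck_cutoff' n.+1).2. Qed.

Lemma is_derive_cutoff s : is_derive (s : R) (1 : R) cutoff (cutoff' s).
Proof. by apply: DeriveDef => //; exact: diff_derivable (Ck_diff s (smooth_cutoff 0)). Qed.

Lemma is_derive_cutoff' s : is_derive (s : R) (1 : R) cutoff' (cutoff'' s).
Proof. by apply: DeriveDef => //; exact: diff_derivable (Ck_diff s (Ck_cutoff' 0)). Qed.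

Lemma cutoff'_eq0 s : s < 1 \/ 4 < s -> cutoff' s = 0.
Proof.
case=> s1.
  rewrite /cutoff' (@near_eq_derive _ R R _ (fun=> 1)) ?derive_cst//.
  by near=> y; rewrite cutoff1//; apply: ltW; near: y; exact: near_lt.
rewrite /cutoff' (@near_eq_derive _ R R _ (fun=> 0)) ?derive_cst//.
near=> y; rewrite cutoff0//; apply/ltW; near: y; exact: near_gt.
Unshelve. all: by end_near. Qed.

Lemma cutoff''_eq0 s : s < 1 \/ 4 < s -> cutoff'' s = 0.
Proof.
move=> s14; rewrite /cutoff'' (@near_eq_derive _ R R _ (fun=> 0)) ?derive_cst//.
case: s14 => s1.
  by near=> y; apply/cutoff'_eq0; left; near: y; exact: near_lt.
near=> y; apply/cutoff'_eq0; right; near: y; exact: near_gt.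
Unshelve. all: by end_near. Qed.

Lemma cutoff_bound : exists2 C : R, 0 < C &
  forall s, `|cutoff' s| <= C /\ `|cutoff'' s| <= C.
Proof.
have bnd (g : R -> R) : continuous g -> (forall s, s < 1 \/ 4 < s -> g s = 0) ->
    exists2 C : R, 0 <= C & forall s, `|g s| <= C.
  move=> cg g0.
  have [|c _ cmax] := @EVT_max R (fun s => `|g s|) 1 4 (ler1n _ _).
    apply: continuous_subspaceT => x.
    by apply: continuous_comp; [exact: cg|exact: norm_continuous].
  exists `|g c| => // s; have [s14|] := boolP (s \in `[1, 4]); first exact: cmax.
  rewrite in_itv/= negb_and -!ltNge => /orP s14.
  by rewrite g0// normr0.
have [|C C0 HC] := bnd cutoff' _ cutoff'_eq0.
  by move=> x; exact: differentiable_continuous (Ck_diff x (Ck_cutoff' 0)).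
have [|D D0 HD] := bnd cutoff'' _ cutoff''_eq0.
  by move=> x; exact: differentiable_continuous (Ck_diff x (Ck_cutoff'' 0)).
exists (C + D + 1); first by lra.
move=> s; split; first by rewrite (le_trans (HC s))//; lra.
by rewrite (le_trans (HD s))//; lra.
Qed.

End cutoff_function.

(** * The Laplacian of radial functions and of functions of the height *)

Section calculus_on_E4.
Variable R : realType.

(** Linearity as seen by the differential alone; in this form it passes through the nested
    projections that define the coordinates of R^4. *)
Definition linear_like (V : normedModType R) (g : V -> R) :=
  (forall x, differentiable g x) /\ (forall x v, 'd g x v = g v).

Lemma linear_like_id : linear_like (fun x : R => x).
Proof.
split=> [x|x v]; first exact: (@ex_diff _ _ _ _ _ id id).
by rewrite (@diff_val _ _ _ _ _ id id).
Qed.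

Lemma linear_like_fst (U V : normedModType R) (g : U -> R) :
  linear_like g -> linear_like (fun p : (U * V)%type => g p.1).
Proof.
move=> [dg gE].
have df x : differentiable (@fst U V) x.
  by apply: linear_differentiable; move=> ?; exact: cvg_fst.
split=> [x|x v]; first exact: (differentiable_comp (df x) (dg _)).
rewrite (diff_comp (df x) (dg _)) /= gE.
by congr g; rewrite (@diff_lin _ _ _ (@fst U V))//; move=> ?; exact: cvg_fst.
Qed.

Lemma linear_like_snd (U V : normedModType R) (g : V -> R) :
  linear_like g -> linear_like (fun p : (U * V)%type => g p.2).
Proof.
move=> [dg gE].
have df x : differentiable (@snd U V) x.
  by apply: linear_differentiable; move=> ?; exact: cvg_snd.
split=> [x|x v]; first exact: (differentiable_comp (df x) (dg _)).
rewrite (diff_comp (df x) (dg _)) /= gE.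
by congr g; rewrite (@diff_lin _ _ _ (@snd U V))//; move=> ?; exact: cvg_snd.
Qed.

Lemma linear_like_derive (V : normedModType R) (g : V -> R) x v :
  linear_like g -> 'D_v g x = g v.
Proof. by move=> [dg gE]; rewrite deriveE// gE. Qed.

Lemma linear_like_Ck (V : normedModType R) (g : V -> R) n :
  linear_like g -> differentiable_upto n g.
Proof. by move=> gl; apply: Ck_linear => [|v x]; [exact: gl.1|exact: linear_like_derive]. Qed.

Lemma derive_comp_real (V : normedModType R) (F : V -> R) (w : R -> R) d x v :
  differentiable F x -> is_derive (F x) (1 : R) w d ->
  'D_v (fun y => w (F y)) x = d * 'D_v F x.
Proof.
move=> dF dw; have dw' : differentiable w (F x) by apply/derivable1_diffP.
rewrite deriveE; last exact: differentiable_comp.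
rewrite diff_comp//= (_ : 'd F x v = 'd F x v *: 1); last exact/esym/mulr1.
rewrite linearZ/= -!deriveE// mulrC; congr (_ * _).
exact: derive_val.
Qed.

Lemma linear_like_coords :
  [/\ linear_like (fun x : E4 R => x.1.1.1), linear_like (fun x : E4 R => x.1.1.2),
      linear_like (fun x : E4 R => x.1.2) & linear_like (fun x : E4 R => x.2)].
Proof.
have i := linear_like_id; split.
- exact: (@linear_like_fst (E3 R) R _ (@linear_like_fst (R * R)%type R _ (@linear_like_fst R R _ i))).
- exact: (@linear_like_fst (E3 R) R _ (@linear_like_fst (R * R)%type R _ (@linear_like_snd R R _ i))).
- exact: (@linear_like_fst (E3 R) R _ (@linear_like_snd (R * R)%type R _ i)).
- exact: (@linear_like_snd (E3 R) R _ i).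
Qed.

Definition sqdist (P x : E4 R) : R := dot4 (x - P) (x - P).

Lemma sqdistE P x : sqdist P x = (x.1.1.1 - P.1.1.1) ^+ 2 + (x.1.1.2 - P.1.1.2) ^+ 2 +
  (x.1.2 - P.1.2) ^+ 2 + (x.2 - P.2) ^+ 2.
Proof. by rewrite /sqdist /dot4 /= !expr2. Qed.

Lemma sqdist_ge0 P x : 0 <= sqdist P x.
Proof. by rewrite sqdistE !addr_ge0 ?sqr_ge0. Qed.

Lemma Ck_sqdist n P : differentiable_upto n (sqdist P).
Proof.
have [l0 l1 l2 l3] := linear_like_coords.
have sq (f : E4 R -> R) (c : R) : linear_like f -> differentiable_upto n (fun x => (f x - c) ^+ 2).
  move=> lf; have H : differentiable_upto n (fun x => f x - c).
    by apply: CkD; [exact: linear_like_Ck|exact: Ck_cst].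
  rewrite (_ : (fun x => _) = fun x => (f x - c) * (f x - c)); first exact: CkM.
  by apply/funext => x; rewrite expr2.
rewrite (_ : sqdist P = fun x => (x.1.1.1 - P.1.1.1) ^+ 2 + (x.1.1.2 - P.1.1.2) ^+ 2 +
  (x.1.2 - P.1.2) ^+ 2 + (x.2 - P.2) ^+ 2).
  by apply: CkD; [apply: CkD; [apply: CkD|]|]; exact: sq.
by apply/funext => x; rewrite sqdistE.
Qed.

Lemma derive_sqdist P v x : 'D_v (sqdist P) x = 2 * dot4 v (x - P).
Proof.
have [l0 l1 l2 l3] := linear_like_coords.
have sq (f : E4 R -> R) (c : R) : linear_like f -> is_derive x v (fun x => (f x - c) ^+ 2) (2 * f v * (f x - c)).
  move=> lf; have dfx : differentiable f x by exact: lf.1.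
  have df : is_derive x v (fun x => f x - c) (f v).
    have H : is_derive x v f (f v) by apply: DeriveDef; [exact: diff_derivable|exact: linear_like_derive].
    have := is_deriveB H (is_derive_cst c x v); by rewrite subr0.
  have := is_deriveX 2 df; by rewrite /GRing.scale/= expr1 mulrAC.
rewrite (_ : sqdist P = fun x => (x.1.1.1 - P.1.1.1) ^+ 2 + (x.1.1.2 - P.1.1.2) ^+ 2 +
  (x.1.2 - P.1.2) ^+ 2 + (x.2 - P.2) ^+ 2); last by apply/funext => y; rewrite sqdistE.
have H := is_deriveD (is_deriveD (is_deriveD (sq _ P.1.1.1 l0) (sq _ P.1.1.2 l1)) (sq _ P.1.2 l2))
  (sq _ P.2 l3).
rewrite (@derive_val _ _ _ _ _ _ _ H) /dot4 /=; ring.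
Qed.

Definition lap (F : E4 R -> R) (x : E4 R) : R :=
  \sum_(i < 4) 'D_(std4 i) (fun y => 'D_(std4 i) F y) x.

(** Chain rule: the gradient of |x - P|^2 has squared length 4 |x - P|^2, and its second derivatives
    add up to 2 * 4 = 8 in dimension 4. Derivatives are required only beyond [- e] because the
    kernel (s + eps^2)^-1 has a pole at -eps^2. *)
Lemma lap_radial (w w1 w2 : R -> R) (e : R) (P x : E4 R) : 0 < e ->
  (forall s, - e < s -> is_derive (s : R) (1 : R) w (w1 s)) ->
  (forall s, - e < s -> is_derive (s : R) (1 : R) w1 (w2 s)) ->
  lap (fun y => w (sqdist P y)) x = 4 * sqdist P x * w2 (sqdist P x) + 8 * w1 (sqdist P x).
Proof.
move=> e0 dw dw1.
have Se y : - e < sqdist P y by rewrite (lt_le_trans _ (sqdist_ge0 P y))// oppr_lt0.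
have dS y : differentiable (sqdist P) y by exact: (Ck_diff y (Ck_sqdist 0 P)).
have D1 v y : 'D_v (fun y => w (sqdist P y)) y = w1 (sqdist P y) * (2 * dot4 v (y - P)).
  by rewrite (derive_comp_real _ (dS y) (dw _ (Se y))) derive_sqdist.
have D2 v : 'D_v (fun y => 'D_v (fun y => w (sqdist P y)) y) x =
    w2 (sqdist P x) * (4 * dot4 v (x - P) ^+ 2) + w1 (sqdist P x) * (2 * dot4 v v).
  rewrite (_ : (fun y => _) = fun y => w1 (sqdist P y) * 'D_v (sqdist P) y); last first.
    by apply/funext => y; rewrite D1 derive_sqdist.
  rewrite deriveM; last 2 first.
  - apply: diff_derivable; apply: (differentiable_comp (dS x)).
    by apply/derivable1_diffP; have [] := dw1 _ (Se x).
  - apply: diff_derivable; have [_ C1] := Ck_sqdist 1 P.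
    have H : differentiable_upto 0 (fun y => 'D_v (sqdist P) y) := C1 v.
    exact: H.1.
  rewrite (derive_comp_real _ (dS x) (dw1 _ (Se x))) derive_sqdist /GRing.scale/=.
  have -> : 'D_v (fun y => 'D_v (sqdist P) y) x = 2 * dot4 v v.
    rewrite (_ : (fun y => _) = fun y => 2 * dot4 v (y - P)); last first.
      by apply/funext => y; rewrite derive_sqdist.
    have [l0 l1 l2 l3] := linear_like_coords.
    have ld (f : E4 R -> R) : linear_like f -> is_derive x v f (f v).
      move=> lf; apply: DeriveDef; last exact: linear_like_derive.
      by apply: diff_derivable; exact: lf.1.
    rewrite (_ : (fun y => _) = (fun y => (2 * v.1.1.1) * y.1.1.1 + (2 * v.1.1.2) * y.1.1.2 +
      (2 * v.1.2) * y.1.2 + (2 * v.2) * y.2 + - (2 * dot4 v P))); last first.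
      by apply/funext => y; rewrite /dot4/=; ring.
    have H := is_deriveD (is_deriveD (is_deriveD (is_deriveD
      (is_deriveZ (2 * v.1.1.1) (ld _ l0)) (is_deriveZ (2 * v.1.1.2) (ld _ l1)))
      (is_deriveZ (2 * v.1.2) (ld _ l2))) (is_deriveZ (2 * v.2) (ld _ l3)))
      (is_derive_cst (- (2 * dot4 v P)) x v).
    rewrite (@derive_val _ _ _ _ _ _ _ H) /dot4 /GRing.scale /=; ring.
  by move: (w1 _) (w2 _) (dot4 v (x - P)) (dot4 v v) => a b c d; ring.
rewrite /lap; under eq_bigr do rewrite D2.
rewrite !big_ord_recl big_ord0 /= /std4 /= sqdistE.
by move: (w1 _) (w2 _) => a b; rewrite /dot4 /=; ring.
Qed.

Lemma lap_height (u u1 u2 : R -> R) (x : E4 R) :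
  (forall s, is_derive (s : R) (1 : R) u (u1 s)) ->
  (forall s, is_derive (s : R) (1 : R) u1 (u2 s)) ->
  lap (fun y => u y.2) x = u2 x.2.
Proof.
move=> du du1; have [_ _ _ l] := linear_like_coords.
have D (w w' : R -> R) v y : (forall s, is_derive (s : R) (1 : R) w (w' s)) ->
    'D_v (fun y : E4 R => w y.2) y = w' y.2 * v.2.
  move=> dw; rewrite (@derive_comp_real _ (fun y : E4 R => y.2) _ _ _ v (l.1 y) (dw _)).
  by rewrite linear_like_derive.
have D2 v : 'D_v (fun y => 'D_v (fun y : E4 R => u y.2) y) x = u2 x.2 * v.2 * v.2.
  rewrite (_ : (fun y => 'D_v _ y) = fun y : E4 R => (v.2 \*: u1) y.2); last first.
    by apply/funext => y; rewrite (D u u1)// mulrC.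
  rewrite (D (v.2 \*: u1) (v.2 \*: u2)).
  by rewrite -[(_ \*: _) _]/(v.2 * u2 x.2) [v.2 * _]mulrC.
rewrite /lap; under eq_bigr do rewrite D2.
by rewrite !big_ord_recl big_ord0 /= /std4 /=; ring.
Qed.

Lemma Ck_height n (u : R -> R) : differentiable_upto n u ->
  differentiable_upto n (fun y : E4 R => u y.2).
Proof.
move=> Cu; have [_ _ _ l] := linear_like_coords.
by apply: (@Ck_comp _ n _ (fun y : E4 R => y.2)) => //; exact: linear_like_Ck.
Qed.

End calculus_on_E4.

(** * Lebesgue measure on R^4 *)

Notation mE4 R := (mE3 R * measurableTypeR R)%type.

Section product_invariance.
Local Open Scope ereal_scope.
Context d1 d2 (T1 : measurableType d1) (T2 : measurableType d2) (R : realType).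
Variable m1 : {sigma_finite_measure set T1 -> \bar R}.
Variable m2 : {sigma_finite_measure set T2 -> \bar R}.

(* The canonical structure found by inference for a product measure is the one
   of subprobabilities; the sigma-finite one has to be given by name. *)
Definition sigma_finite_product : {sigma_finite_measure set (T1 * T2)%type -> \bar R} :=
  HB.pack (m1 \x m2)
    (lebesgue_integral_fubini.measure_function_Measure_isSigmaFinite__to__measure_function_isSigmaFinite m1 m2)
    (lebesgue_integral_fubini.measure_function_Measure_isSigmaFinite__to__measure_function_isSFinite m1 m2).

(** By uniqueness of the product measure it is enough to compare on rectangles. Iterated, this
    carries translation invariance from the line to R^4. *)
Lemma product_measure_preimage (f : T1 -> T1) (g : T2 -> T2) :
  measurable_fun [set: T1] f -> measurable_fun [set: T2] g ->
  (forall A, measurable A -> m1 (f @^-1` A) = m1 A) ->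
  (forall A, measurable A -> m2 (g @^-1` A) = m2 A) ->
  forall X, measurable X -> sigma_finite_product ((fun p => (f p.1, g p.2)) @^-1` X) = sigma_finite_product X.
Proof.
move=> mf mg fE gE X mX.
have mh : measurable_fun [set: T1 * T2] (fun p : T1 * T2 => (f p.1, g p.2)).
  apply/measurable_fun_pair => /=.
    exact: measurableT_comp mf measurable_fst.
  exact: measurableT_comp mg measurable_snd.
apply/esym.
pose mfun := @isMeasurableFun.Build _ _ _ _ _ mh.
pose h : {mfun (T1 * T2)%type >-> (T1 * T2)%type} := HB.pack (fun p : T1 * T2 => (f p.1, g p.2)) mfun.
apply: (@product_measure_unique _ _ _ _ _ m1 m2 (pushforward (m1 \x m2) h)) => //.
move=> A B mA mB; transitivity ((m1 \x m2) ((f @^-1` A) `*` (g @^-1` B))); first by [].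
have mA' : measurable (f @^-1` A) by rewrite -[f @^-1` A]setTI; exact: mf.
have mB' : measurable (g @^-1` B) by rewrite -[g @^-1` B]setTI; exact: mg.
by rewrite product_measure1E//= fE// gE.
Qed.

End product_invariance.

Lemma product_sigma_algebra_min d1 d2 (T1 : measurableType d1) (T2 : measurableType d2)
    (S : set (set (T1 * T2))) :
  sigma_algebra [set: T1 * T2] S ->
  (forall A, measurable A -> S (fst @^-1` A)) ->
  (forall B, measurable B -> S (snd @^-1` B)) ->
  forall X, measurable X -> S X.
Proof.
move=> sS S1 S2; apply: smallest_sub => //.
rewrite subUset; split => _ [X mX <-]; rewrite setTI; [exact: S1|exact: S2].
Qed.

Lemma sigma_algebra_pull (T1 T2 : Type) (f : T1 -> T2) (S : set (set T1)) :
  sigma_algebra [set: T1] S -> sigma_algebra [set: T2] [set A | S (f @^-1` A)].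
Proof.
move=> [S0 SC SU]; split => /=.
- by rewrite preimage_set0.
- by move=> A SA; rewrite setTD preimage_setC -setTD; exact: SC.
- by move=> F SF; rewrite preimage_bigcup; exact: SU.
Qed.

Lemma real_sigma_algebra_min (R : realType) (S : set (set (measurableTypeR R))) :
  sigma_algebra [set: measurableTypeR R] S ->
  (forall a : R, S `]-oo, a[%classic) -> forall B, measurable B -> S B.
Proof.
move=> sS Sa B mB.
have : (@RGenInftyO.G R).-sigma.-measurable B by rewrite -RGenInftyO.measurableE.
by move: B {mB}; apply: smallest_sub => // _ [a ->]; exact: Sa.
Qed.

Section euclidean_volume.
Variable R : realType.
Local Notation mR := (measurableTypeR R).
Local Notation leb := (@lebesgue_measure R).

Definition vol3 : {sigma_finite_measure set (mE3 R) -> \bar R} :=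
  sigma_finite_product (sigma_finite_product leb leb) leb.
Definition vol4 : {sigma_finite_measure set (mE4 R) -> \bar R} :=
  sigma_finite_product vol3 leb.

Definition shift1 (a : R) (x : mR) : mR := (x : R) + a.
Definition shift3 (a : E3 R) (x : mE3 R) : mE3 R := (x : E3 R) + a.
Definition shift4 (a : E4 R) (x : mE4 R) : mE4 R := (x : E4 R) + a.

Lemma measurable_shift1 a : measurable_fun [set: mR] (shift1 a).
Proof. by apply: measurable_funD. Qed.

Lemma lebesgue_measure_shift a (A : set mR) : measurable A ->
  leb (shift1 a @^-1` A) = leb A.
Proof.
move=> mA; pose mfun := @isMeasurableFun.Build _ _ _ _ _ (measurable_shift1 a).
pose h : {mfun mR >-> mR} := HB.pack (shift1 a) mfun.
apply/esym; rewrite (@lebesgue_measure_unique _ (pushforward leb h))// => _ [[b c] _ <-].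
transitivity (leb `](b - a), (c - a)]%classic); last first.
  rewrite -[RHS]/(leb (shift1 a @^-1` `]b, c]%classic)); congr (leb _).
  by apply/seteqP; split => x /=; rewrite !in_itv /= /shift1 ltrBlDr lerBrDr.
rewrite !lebesgue_measure_itv /= !lte_fin ltrD2r; case: ifP => // _.
by rewrite -!EFinB; congr EFin; ring.
Qed.

Lemma measurable_shift3 a : measurable_fun [set: mE3 R] (shift3 a).
Proof.
apply/measurable_fun_pair => /=; first apply/measurable_fun_pair => /=.
- exact: (measurableT_comp (measurable_shift1 a.1.1) (measurableT_comp measurable_fst measurable_fst)).
- exact: (measurableT_comp (measurable_shift1 a.1.2) (measurableT_comp measurable_snd measurable_fst)).
- exact: (measurableT_comp (measurable_shift1 a.2) measurable_snd).
Qed.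

Lemma vol3_shift a (A : set (mE3 R)) : measurable A -> vol3 (shift3 a @^-1` A) = vol3 A.
Proof.
move=> mA.
have H2 := product_measure_preimage (measurable_shift1 a.1.1) (measurable_shift1 a.1.2)
  (@lebesgue_measure_shift a.1.1) (@lebesgue_measure_shift a.1.2).
have m2 : measurable_fun [set: mR * mR] (fun p : mR * mR => (shift1 a.1.1 p.1, shift1 a.1.2 p.2)).
  apply/measurable_fun_pair => /=.
    exact: (measurableT_comp (measurable_shift1 a.1.1) measurable_fst).
  exact: (measurableT_comp (measurable_shift1 a.1.2) measurable_snd).
exact: (product_measure_preimage m2 (measurable_shift1 a.2) H2 (@lebesgue_measure_shift a.2)).
Qed.

Lemma measurable_shift4 a : measurable_fun [set: mE4 R] (shift4 a).
Proof.
apply/measurable_fun_pair => /=.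
- exact: (measurableT_comp (measurable_shift3 a.1) measurable_fst).
- exact: (measurableT_comp (measurable_shift1 a.2) measurable_snd).
Qed.

Lemma vol4_shift a (A : set (mE4 R)) : measurable A -> vol4 (shift4 a @^-1` A) = vol4 A.
Proof.
exact: (product_measure_preimage (measurable_shift3 a.1) (measurable_shift1 a.2)
  (@vol3_shift a.1) (@lebesgue_measure_shift a.2)).
Qed.

Definition coords (x : mE4 R) : seq R := [:: x.1.1.1; x.1.1.2; x.1.2; x.2].

Lemma measurable_coord (i : nat) : measurable_fun [set: mE4 R] (fun x : mE4 R => (coords x)`_i).
Proof.
case: i => [|[|[|[|i]]]] /=.
- exact: (measurableT_comp measurable_fst (measurableT_comp measurable_fst measurable_fst)).
- exact: (measurableT_comp measurable_snd (measurableT_comp measurable_fst measurable_fst)).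
- exact: (measurableT_comp measurable_snd measurable_fst).
- exact: measurable_snd.
- rewrite (_ : (fun _ => _) = fun=> 0); first exact: measurable_cst.
  by apply/funext => x; rewrite nth_nil.
Qed.

(** An induction principle for measurable sets: a property of coordinate half-spaces that is stable
    under complements and countable unions holds for all of them. *)
Lemma E4_sigma_algebra_min (S : set (set (mE4 R))) :
  sigma_algebra [set: mE4 R] S ->
  (forall i a, (i < 4)%N -> S [set x | (coords x)`_i < a]) ->
  forall X, measurable X -> S X.
Proof.
move=> sS Sa.
have half (c : mE4 R -> mR) : (forall a, S (c @^-1` `]-oo, a[%classic)) ->
    forall B, measurable B -> S (c @^-1` B).
  move=> Sc B mB.
  by apply: (@real_sigma_algebra_min R [set A | S (c @^-1` A)]) => //; exact: sigma_algebra_pull.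
have rayE (c : mE4 R -> mR) a : c @^-1` `]-oo, a[%classic = [set x | (c x : R) < a].
  by apply/seteqP; split => x /=; rewrite in_itv.
apply: product_sigma_algebra_min => // [A mA|B mB]; last first.
  by apply: (half snd) => // a; rewrite rayE; exact: (Sa 3%N).
apply: (@product_sigma_algebra_min _ _ _ _ [set A | S (fst @^-1` A)]) => // [|A' mA'|B mB].
- exact: sigma_algebra_pull.
- apply: (@product_sigma_algebra_min _ _ _ _ [set A | S ((fst \o fst) @^-1` A)]) => // [|B mB|B mB].
  + exact: sigma_algebra_pull.
  + by apply: (half (fun x => x.1.1.1)) => // a; rewrite rayE; exact: (Sa 0%N).
  + by apply: (half (fun x => x.1.1.2)) => // a; rewrite rayE; exact: (Sa 1%N).
- by apply: (half (fun x => x.1.2)) => // a; rewrite rayE; exact: (Sa 2%N).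
Qed.

Definition cube (x : mE4 R) (e : R) : set (mE4 R) :=
  [set y | forall i, (i < 4)%N -> `|(coords y)`_i - (coords x)`_i| < e].

Lemma cubeP x e y : cube x e y <->
  [/\ `|y.1.1.1 - x.1.1.1| < e, `|y.1.1.2 - x.1.1.2| < e, `|y.1.2 - x.1.2| < e & `|y.2 - x.2| < e].
Proof.
split=> [H|[H0 H1 H2 H3]].
  by split; [exact: (H 0%N)|exact: (H 1%N)|exact: (H 2%N)|exact: (H 3%N)].
by move=> [|[|[|[|i]]]].
Qed.

Lemma cube_sym x y e : cube x e y -> cube y e x.
Proof. by move=> H i i4; rewrite distrC; exact: H. Qed.

Lemma cubeE x e : cube x e = (`](x.1.1.1 - e), (x.1.1.1 + e)[%classic `*`
  `](x.1.1.2 - e), (x.1.1.2 + e)[%classic `*`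
  `](x.1.2 - e), (x.1.2 + e)[%classic `*`
  `](x.2 - e), (x.2 + e)[%classic) :> set (mE4 R).
Proof.
apply/seteqP; split => y.
  by move=> /cubeP[]; rewrite !ltr_distl /= !in_itv.
by move=> /= [[[]]]; rewrite !in_itv => *; apply/cubeP; rewrite !ltr_distl.
Qed.

Lemma measurable_cube x e : measurable (cube x e).
Proof.
rewrite cubeE; apply: measurableX; last exact: measurable_itv.
by apply: measurableX; [apply: measurableX|]; exact: measurable_itv.
Qed.

Lemma vol4_cube x e : 0 < e -> vol4 (cube x e) = ((2 * e) ^+ 4)%:E.
Proof.
move=> e0; have itvE (a : R) : leb `]a - e, a + e[%classic = (2 * e)%:E.
  rewrite lebesgue_measure_itv/= lte_fin ifT; last lra.
  by rewrite -EFinB; congr EFin; ring.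
rewrite cubeE /vol4 /= /vol3.
rewrite product_measure1E//=; last first.
  by apply: measurableX; [apply: measurableX|]; exact: measurable_itv.
rewrite product_measure1E//=; last by apply: measurableX; exact: measurable_itv.
rewrite product_measure1E//= !itvE -!EFinM; congr EFin.
by ring.
Qed.

End euclidean_volume.

(** * A weak density theorem *)

Section lebesgue_density.
Variable R : realType.
Local Notation T := (mE4 R).
Variable mu : {sigma_finite_measure set T -> \bar R}.
Hypothesis vol4_cube : forall x e, 0 < e -> mu (cube x e) = ((2 * e) ^+ 4)%:E.
Local Notation mu2 := (sigma_finite_product mu mu).

Definition close (e : R) : set (T * T) := [set p | cube p.1 e p.2].

Lemma measurable_close e : measurable (close e).
Proof.
have mc i : measurable [set p : T * T | `|(coords p.2)`_i - (coords p.1)`_i| < e].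
  rewrite (_ : [set p | _] = (fun p : T * T => `|(coords p.2)`_i - (coords p.1)`_i|) @^-1` `]-oo, e[%classic).
    rewrite -[X in measurable X]setTI; apply: (_ : measurable_fun _ _) => //.
    apply: measurableT_comp => //; apply: measurable_funB.
      exact: measurableT_comp (measurable_coord i) measurable_snd.
    exact: measurableT_comp (measurable_coord i) measurable_fst.
  by apply/seteqP; split => p /=; rewrite in_itv.
rewrite (_ : close e = \bigcap_(i in [set i | (i < 4)%N])
    [set p : T * T | `|(coords p.2)`_i - (coords p.1)`_i| < e]).
  by apply: fin_bigcap_measurable => //; exact: finite_II.
by apply/seteqP; split.
Qed.

Lemma product_volE S : mu2 S = (\int[mu]_x mu (xsection S x))%E.
Proof. by []. Qed.

Lemma vol_close_fst e A : 0 < e -> measurable A ->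
  mu2 (close e `&` fst @^-1` A) = (((2 * e) ^+ 4)%:E * mu A)%E.
Proof.
move=> e0 mA; rewrite product_volE.
rewrite (eq_integral (fun x => ((2 * e) ^+ 4)%:E * (\1_A x)%:E)%E); last first.
  move=> x _; rewrite indicE; have [xA|xA] := boolP (x \in A).
    rewrite mule1 -(vol4_cube x e0); congr (mu _); apply/seteqP; split => y /=.
      by rewrite /xsection/= inE => -[].
    by rewrite /xsection/= => xy; rewrite inE; split => //=; exact: set_mem.
  rewrite mule0 (_ : xsection _ _ = set0) ?measure0//.
  apply/seteqP; split => // y /=; rewrite /xsection/= inE => -[_ /= /mem_set].
  by rewrite (negbTE xA).
rewrite ge0_integralZl//; last by rewrite lee_fin exprn_ge0// mulr_ge0// ltW.
  by rewrite integral_indic// setIT.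
by apply/measurable_EFinP; exact: measurable_indic.
Qed.

Lemma vol_close_snd e A : 0 < e -> measurable A ->
  mu2 (close e `&` snd @^-1` A) = (((2 * e) ^+ 4)%:E * mu A)%E.
Proof.
move=> e0 mA.
have mS : measurable (close e `&` snd @^-1` A).
  apply: measurableI; first exact: measurable_close.
  by rewrite -[snd @^-1` A]setTI; exact: measurable_snd.
rewrite -(vol_close_fst e0 mA).
(* Slice along the second variable instead; since closeness is symmetric, the slices are those of
   the previous lemma. *)
transitivity ((mu \x^ mu)%E (close e `&` snd @^-1` A)).
  apply: product_measure_unique => // B C mB mC; exact: product_measure2E.
apply: eq_integral => x _; congr (mu _).
apply/seteqP; split => y; rewrite /xsection /ysection /= !inE.
  by move=> [/cube_sym ? ?].
by move=> [/cube_sym ? ?].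
Qed.

Variable N : R.
Local Notation D := (cube (0 : E4 R) N).
Local Notation D' := (cube (0 : E4 R) (N + 1)).

(* The pairs of close points separated by A. A set A failing the conclusion of
   [density] would lose a fixed fraction of its pairs of close points, whereas
   the measure of the leak is o(e^4); the latter property holds for half-spaces
   and is stable under complements and countable unions. *)
Definition leak e (A : set T) : set (T * T) :=
  close e `&` fst @^-1` D `&`
    ((fst @^-1` A `&` snd @^-1` (~` A)) `|` (fst @^-1` (~` A) `&` snd @^-1` A)).

Definition leak_small (A : set T) := measurable A /\
  forall eta, 0 < eta -> exists2 e0, 0 < e0 &
    forall e, 0 < e < e0 -> (mu2 (leak e A) <= (eta * e ^+ 4)%:E)%E.

Let mfst A : measurable A -> measurable (fst @^-1` A : set (T * T)).
Proof. by move=> mA; rewrite -[fst @^-1` A]setTI; exact: measurable_fst. Qed.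

Let msnd A : measurable A -> measurable (snd @^-1` A : set (T * T)).
Proof. by move=> mA; rewrite -[snd @^-1` A]setTI; exact: measurable_snd. Qed.

Lemma measurable_leak e A : measurable A -> measurable (leak e A).
Proof.
move=> mA; apply: measurableI.
  by apply: measurableI; [exact: measurable_close|apply: mfst; exact: measurable_cube].
have mC : measurable (~` A) by exact: measurableC.
by apply: measurableU; apply: measurableI; [exact: (mfst mA)|exact: (msnd mC)|exact: (mfst mC)|exact: (msnd mA)].
Qed.

Lemma leakC e A : leak e (~` A) = leak e A.
Proof. by rewrite /leak setCK setUC. Qed.

Lemma leakU e A B : leak e (A `|` B) `<=` leak e A `|` leak e B.
Proof.
move=> [x y] [/= cD] [[/= [Ax|Bx] /not_orP[nA nB]]|[/= /not_orP[nA nB] [Ay|By]]].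
- by left; split => //; left.
- by right; split => //; left.
- by left; split => //; right.
- by right; split => //; right.
Qed.

Lemma leak_smallC A : leak_small A -> leak_small (~` A).
Proof.
move=> [mA HA]; split; first exact: measurableC.
by move=> eta /HA[e0 e00 H]; exists e0 => // e; rewrite leakC; exact: H.
Qed.

Lemma leak_smallU A B : leak_small A -> leak_small B -> leak_small (A `|` B).
Proof.
move=> [mA HA] [mB HB]; split; first exact: measurableU.
move=> eta eta0; have eta2 : 0 < eta / 2 by rewrite divr_gt0.
have [e1 e10 H1] := HA _ eta2; have [e2 e20 H2] := HB _ eta2.
exists (Num.min e1 e2); first by rewrite lt_min e10.
move=> e /andP[e0]; rewrite lt_min => /andP[ee1 ee2].
have := H1 e; rewrite e0 ee1 => /(_ isT) {}H1.
have := H2 e; rewrite e0 ee2 => /(_ isT) {}H2.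
have mlA := measurable_leak e mA; have mlB := measurable_leak e mB.
apply: (@le_trans _ _ (mu2 (leak e A `|` leak e B))).
  apply: le_measure; rewrite ?inE; [|exact: measurableU|exact: leakU].
  by apply: measurable_leak; exact: measurableU.
apply: le_trans (measureU2 _ _ _) _ => //.
apply: le_trans (leeD H1 H2) _; rewrite -EFinD lee_fin; lra.
Qed.

(** The error made when a set is replaced by an approximation: [W] is the discrepancy, and a pair of
    close points can be affected only if one of them lies in it. *)
Definition tail e (W : set T) : set (T * T) :=
  close e `&` fst @^-1` D `&` (fst @^-1` W `|` snd @^-1` W).

Lemma measurable_tail e W : measurable W -> measurable (tail e W).
Proof.
move=> mW; apply: measurableI; last by apply: measurableU; [exact: mfst|exact: msnd].
by apply: measurableI; [exact: measurable_close|apply: mfst; exact: measurable_cube].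
Qed.

Lemma tail_small (W : (set T)^nat) : (forall k, measurable (W k)) ->
  nonincreasing_seq W -> \bigcap_k W k = set0 ->
  forall eta, 0 < eta -> exists k, forall e, 0 < e <= 1 ->
    (mu2 (tail e (W k)) <= (eta * e ^+ 4)%:E)%E.
Proof.
move=> mW nW W0 eta eta0.
have mD' : measurable D' by exact: measurable_cube.
have fD' : (mu D' < +oo)%E.
  have [N0|N0] := ltP 0 (N + 1); first by rewrite vol4_cube// ltry.
  rewrite (_ : D' = set0) ?measure0//; apply/seteqP; split => // x /(_ 0%N isT).
  by move=> /(le_lt_trans (normr_ge0 _)); rewrite ltNge N0.
have cW : mu (D' `&` W n) @[n --> \oo] --> 0%E.
  rewrite (_ : 0%E = mu (\bigcap_n (D' `&` W n))); last first.
    by rewrite bigcapIr// W0 setI0 measure0.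
  apply: (@nonincreasing_cvg_mu _ _ _ mu (fun n => D' `&` W n)).
  - apply: le_lt_trans fD'; apply: le_measure; rewrite ?inE//.
    by apply: measurableI.
  - by move=> i; exact: measurableI.
  - by apply: bigcapT_measurable => i; exact: measurableI.
  - by move=> m n mn; apply/subsetPset; apply: setIS; apply/subsetPset/nW.
(* For [e <= 1] the larger cube [D'] also contains the partners of the points of [D]. Each half of
   the tail has measure at most [(2 * e) ^+ 4] times that of [D'] intersected with [W k], and 2 * 16
   = 32. *)
have [k Hk] : exists k, (mu (D' `&` W k) <= (eta / 32)%:E)%E.
  have e32 : (0 < (eta / 32)%:E :> \bar R)%E by rewrite lte_fin divr_gt0.
  have [k _ Hk] := cW _ (open_ereal_lt' e32).
  by exists k; apply/ltW/Hk => /=.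
exists k => e /andP[e0 e1].
have mDW : measurable (D' `&` W k) by exact: measurableI.
apply: (@le_trans _ _ (mu2 ((close e `&` fst @^-1` (D' `&` W k)) `|`
                           (close e `&` snd @^-1` (D' `&` W k))))).
  apply: le_measure; rewrite ?inE.
  - exact: measurable_tail.
  - by apply: measurableU; (apply: measurableI; first exact: measurable_close);
      [exact: mfst|exact: msnd].
  - move=> [x y] [[/= cxy Dx] [/= Wx|/= Wy]]; [left|right]; split => //=; split => //.
      by move=> i i4; rewrite (lt_trans (Dx i i4))// ltrDl.
    move=> i i4; have := Dx i i4; have := cxy i i4; rewrite /= !ltr_norml => /andP[? ?] /andP[? ?].
    apply/andP; split; lra.
apply: le_trans (measureU2 _ _ _) _.
- by apply: measurableI; [exact: measurable_close|exact: mfst].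
- by apply: measurableI; [exact: measurable_close|exact: msnd].
rewrite [X in (X + _)%E]vol_close_fst// [X in (_ + X)%E]vol_close_snd//.
have e4 : 0 <= (2 * e) ^+ 4 by rewrite exprn_ge0// mulr_ge0// ltW.
apply: (@le_trans _ _ (((2 * e) ^+ 4)%:E * (eta / 32)%:E + ((2 * e) ^+ 4)%:E * (eta / 32)%:E)%E).
  by apply: leeD; apply: lee_wpmul2l; rewrite ?lee_fin.
rewrite -!EFinM -EFinD lee_fin exprMn; move: (e ^+ 4) => z; lra.
Qed.

(** Finite unions [V k] are already covered. A pair separated by the whole union but not by [V k]
    has a member in the difference [W k], and the sets [W k] decrease to the empty set. *)
Lemma leak_small_bigcup (F : (set T)^nat) : (forall n, leak_small (F n)) ->
  leak_small (\bigcup_n F n).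
Proof.
move=> HF; have mF n : measurable (F n) by have [] := HF n.
split; first exact: bigcupT_measurable.
pose V k := \big[setU/set0]_(i < k) F i.
have HV k : leak_small (V k).
  rewrite /V; elim: k => [|k IH].
    rewrite big_ord0; split => // eta eta0; exists 1 => // e /andP[e0 _].
    rewrite (_ : leak e set0 = set0).
      by rewrite measure0 lee_fin mulr_ge0 ?exprn_ge0 ?ltW.
    by apply/seteqP; split => // -[x y] [_ [[]|[]]].
  by rewrite big_ord_recr/=; exact: leak_smallU.
have mV k : measurable (V k) by have [] := HV k.
have mU : measurable (\bigcup_n F n) by exact: bigcupT_measurable.
move=> eta eta0; have eta2 : 0 < eta / 2 by rewrite divr_gt0.
have VF k x : V k x -> (\bigcup_n F n) x.
  by rewrite /V -bigcup_mkord => -[i _ Fx]; exists i.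
have Vmono : nondecreasing_seq V.
  by move=> m n mn; apply/subsetPset; exact: subset_bigsetU.
pose W k := \bigcup_n F n `\` V k.
have mW k : measurable (W k) by exact: measurableD.
have nW : nonincreasing_seq W.
  move=> m n mn; apply/subsetPset => x [Ux nV]; split => // Vx; apply: nV.
  by move/subsetPset : (Vmono _ _ mn); exact.
have W0 : \bigcap_k W k = set0.
  apply/seteqP; split => // x H; have [[i _ Fx] _] := H 0%N I.
  by have [_] := H i.+1 I; apply; rewrite /V -bigcup_mkord; exists i => //=.
have [k Hk] := tail_small mW nW W0 eta2.
have [e1 e10 H1] := (HV k).2 _ eta2.
exists (Num.min e1 1); first by rewrite lt_min e10 ltr01.
move=> e /andP[e0]; rewrite lt_min => /andP[ee1 ee2].
have := H1 e; rewrite e0 ee1 => /(_ isT) {}H1.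
have := Hk e; rewrite e0 (ltW ee2) => /(_ isT) {}Hk.
apply: (@le_trans _ _ (mu2 (leak e (V k) `|` tail e (W k)))).
  apply: le_measure; rewrite ?inE; first exact: measurable_leak.
    by apply: measurableU; [exact: measurable_leak|exact: measurable_tail].
  move=> [x y] [/= cD] [[/= Ux nUy]|[/= nUx Uy]].
    have [Vx|nVx] := pselect (V k x).
      by left; split => //; left; split => // Vy; apply: nUy; exact: VF Vy.
    by right; split => //; left.
  have [Vy|nVy] := pselect (V k y).
    by left; split => //; right; split => // Vx; apply: nUx; exact: VF Vx.
  by right; split => //; right.
apply: le_trans (measureU2 _ _ _) _.
- exact: measurable_leak.
- exact: measurable_tail.
by apply: le_trans (leeD H1 Hk) _; rewrite -EFinD lee_fin; lra.
Qed.

(** When [e < k.+1%:R^-1], the member of a separated pair that lies in the half-space is within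
    [k.+1%:R^-1] of its boundary. These strips decrease to the empty set because the half-space is
    open. *)
Lemma leak_small_halfspace i a : (i < 4)%N -> leak_small [set x | (coords x)`_i < a].
Proof.
move=> i4.
have mlt b : measurable [set x : T | (coords x)`_i < b].
  rewrite (_ : [set x | _] = (fun x : T => (coords x)`_i) @^-1` `]-oo, b[%classic).
    by rewrite -[X in measurable X]setTI; exact: measurable_coord.
  by apply/seteqP; split => p /=; rewrite in_itv.
split => // eta eta0.
pose W k := [set x : T | (coords x)`_i < a] `\` [set x | (coords x)`_i < a - k.+1%:R^-1].
have mW k : measurable (W k) by exact: measurableD.
have nW : nonincreasing_seq W.
  move=> m n mn; apply/subsetPset => x [/= xa xn]; split => //=.
  move=> xm; apply: xn; apply: lt_le_trans xm _.
  by rewrite lerB// lef_pV2 ?posrE ?ltr0n// ler_nat.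
have W0 : \bigcap_k W k = set0.
  apply/seteqP; split => // x H; have [/= xa _] := H 0%N I.
  have d0 : 0 < a - (coords x)`_i by rewrite subr_gt0.
  have [k _ Hk] := near_infty_natSinv_lt (PosNum d0).
  by have [_ /=] := H k I; apply; rewrite ltrBrDl -ltrBrDr; exact: (Hk k (leqnn _)).
have [k Hk] := tail_small mW nW W0 eta0.
exists k.+1%:R^-1 => // e /andP[e0 ek].
have e1 : e <= 1 by rewrite (le_trans (ltW ek))// invf_le1// ler1n.
have := Hk e; rewrite e0 e1 => /(_ isT); apply: le_trans.
apply: le_measure; rewrite ?inE.
- by apply: measurable_leak.
- exact: measurable_tail.
move=> [x y] [/= [cxy Dx] H]; split => //.
have := cxy i i4; rewrite /= ltr_norml => /andP[h1 h2].
case: H => -[/= /= xa ya].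
  by left; split => //=; move/negP: ya; rewrite -leNgt => ya; apply/negP; rewrite -leNgt; move: h1 h2 ek xa ya => /=; move: (k.+1%:R^-1) ((coords x)`_i) ((coords y)`_i) => z p q; lra.
by right; split => //=; move/negP: xa; rewrite -leNgt => xa; apply/negP; rewrite -leNgt; move: h1 h2 ek xa ya => /=; move: (k.+1%:R^-1) ((coords x)`_i) ((coords y)`_i) => z p q; lra.
Qed.

Lemma measurable_leak_small A : measurable A -> leak_small A.
Proof.
move: A; apply: E4_sigma_algebra_min; last by move=> i a i4; exact: leak_small_halfspace.
split.
- rewrite -setCT; apply: leak_smallC.
  rewrite -[setT](_ : [set x : T | (coords x)`_0 < 0] `|` ~` [set x : T | (coords x)`_0 < 0] = _).
    apply: leak_smallU; first exact: leak_small_halfspace.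
    by apply: leak_smallC; exact: leak_small_halfspace.
  exact: setUv.
- by move=> A HA; rewrite setTD; exact: leak_smallC.
- exact: leak_small_bigcup.
Qed.

Lemma density A e1 : measurable A -> (0 < mu (A `&` D))%E -> 0 < e1 ->
  exists2 x, D x & exists e, [/\ 0 < e, e < e1 &
    ((8 * e ^+ 4)%:E <= mu (A `&` cube x e))%E].
Proof.
move=> mA A0 e10; apply: contrapT => /forall2NP H.
have mD : measurable D by exact: measurable_cube.
have mAD : measurable (A `&` D) by exact: measurableI.
have N0 : 0 < N.
  rewrite ltNge; apply/negP => N0; move: A0.
  rewrite (_ : D = set0) ?setI0 ?measure0 ?ltxx//; apply/seteqP; split => // x /(_ 0%N isT).
  by move=> /(le_lt_trans (normr_ge0 _)); rewrite ltNge N0.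
have fD : (mu D < +oo)%E by rewrite vol4_cube// ltry.
have fAD : mu (A `&` D) \is a fin_num.
  by rewrite ge0_fin_numE//; apply: le_lt_trans fD; apply: le_measure; rewrite ?inE//.
pose m := fine (mu (A `&` D)).
have m0 : 0 < m by rewrite fine_gt0// A0 -ge0_fin_numE.
(* If the conclusion fails at scale [e], each point of [A] in [D] loses more than half of its cube,
   of volume 16 e^4. The leak is then at least [8 * m * e ^+ 4], twice what is allowed here. *)
have [_ /(_ (4 * m))] := measurable_leak_small mA.
case; first by rewrite mulr_gt0.
move=> e0 e00 He; pose e := Num.min e0 e1 / 2.
have e_gt0 : 0 < e by rewrite divr_gt0// lt_min e00.
have ee : e < Num.min e0 e1 by rewrite ltr_pdivrMr// ltr_pMr ?ltr1n// lt_min e00.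
move: ee; rewrite lt_min => /andP[ee0 ee1].
have := He e; rewrite e_gt0 ee0 => /(_ isT).
apply/negP; rewrite -ltNge.
apply: (@lt_le_trans _ _ ((8 * e ^+ 4)%:E * mu (A `&` D))%E).
  rewrite -(fineK fAD) -EFinM lte_fin -/m; have := mulr_gt0 m0 (exprn_gt0 4 e_gt0).
  move: (e ^+ 4) => z; lra.
rewrite product_volE.
have -> : ((8 * e ^+ 4)%:E * mu (A `&` D) = \int[mu]_x ((8 * e ^+ 4)%:E * (\1_(A `&` D) x)%:E))%E.
  rewrite ge0_integralZl//; last by rewrite lee_fin mulr_ge0// exprn_ge0// ltW.
    by rewrite integral_indic// setIT.
  by apply/measurable_EFinP; exact: measurable_indic.
apply: ge0_le_integral => //.
- by move=> x _; rewrite mule_ge0 ?lee_fin// mulr_ge0// exprn_ge0// ltW.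
- by apply: measurable_funeM; apply/measurable_EFinP; exact: measurable_indic.
- by apply: measurable_fun_xsection; exact: measurable_leak.
move=> x _; rewrite indicE; have [xAD|xAD] := boolP (x \in A `&` D); last by rewrite mule0.
have [Ax Dx] := set_mem xAD.
rewrite mule1.
have [//|/forallNP/(_ e) nH] := H x.
have mc : measurable (cube x e) by exact: measurable_cube.
have {}nH : (mu (A `&` cube x e) < (8 * e ^+ 4)%:E)%E.
  by rewrite ltNge; apply/negP => h; apply: nH.
have : (mu (cube x e `\` A) <= mu (xsection (leak e A) x))%E.
  apply: le_measure; rewrite ?inE.
  - exact: measurableD.
  - by apply: measurable_xsection; exact: measurable_leak.
  - by move=> y [xy nAy]; rewrite /xsection/= inE; split => //=; left.
apply: le_trans.
have E : mu (cube x e) = (mu (cube x e `\` A) + mu (cube x e `&` A))%E := measureDI mu mc mA.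
rewrite vol4_cube// in E.
have fI : mu (cube x e `&` A) \is a fin_num.
  by rewrite ge0_fin_numE// setIC (lt_trans nH)// ltry.
rewrite -(@leeD2rE _ (mu (cube x e `&` A)))// -E.
rewrite -(fineK fI) -EFinD lee_fin.
have : fine (mu (cube x e `&` A)) < 8 * e ^+ 4 by rewrite -lte_fin fineK// setIC.
move=> /ltW; rewrite (_ : (2 * e) ^+ 4 = 8 * e ^+ 4 + 8 * e ^+ 4) ?lerD2l//; ring.
Qed.

End lebesgue_density.

(** * The lattice and the volume of the cylinder *)

Section lattice_geometry.
Variables (R : realType) (G : lattice3 R).

Definition lvec (n : {ffun 'I_3 -> int}) : E3 R := \sum_i (n i)%:~R *: G i.

Lemma in_latticeP x : in_lattice G x <-> exists n, x = lvec n.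
Proof.
split=> [[n ->]|[n ->]]; last by exists n.
by exists [ffun i => n i]; apply: eq_bigr => i _; rewrite ffunE.
Qed.

Lemma lvecD n m : lvec (n + m) = lvec n + lvec m.
Proof. by rewrite -big_split; apply: eq_bigr => i _; rewrite ffunE rmorphD scalerDl. Qed.

Lemma lvecN n : lvec (- n) = - lvec n.
Proof. by rewrite -sumrN; apply: eq_bigr => i _; rewrite ffunE rmorphN scaleNr. Qed.

Lemma lvec0 : lvec 0 = 0.
Proof. by rewrite /lvec big1// => i _; rewrite ffunE scale0r. Qed.

Lemma torus_proj_eqP x y : torus_proj G x = torus_proj G y <-> exists n, x = y + lvec n.
Proof.
have E : torus_proj G x = torus_proj G y <-> in_lattice G (x - y).
  split=> [/eqquotP/asboolP//|H]; by apply/eqquotP/asboolP.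
rewrite E in_latticeP; split=> -[n xyE]; exists n; last by rewrite xyE addrC addKr.
by rewrite -xyE addrC subrK.
Qed.

Lemma torus_proj_lvec x n : torus_proj G (x + lvec n) = torus_proj G x.
Proof. by apply/torus_proj_eqP; exists n. Qed.

Lemma torus_proj_repr t : torus_proj G (repr t) = t.
Proof. exact: reprK. Qed.

Definition lcoord (x : E3 R) (i : 'I_3) : R :=
  \sum_j coord3 x j * invmx (\matrix_(i, j) coord3 (G i) j) j i.

Lemma lcoordE x : x = \sum_i lcoord x i *: G i.
Proof.
apply: coord3_inj => j; rewrite coord3_comb.
have : (\row_j coord3 x j) = (\row_i lcoord x i) *m (\matrix_(i, j) coord3 (G i) j).
  rewrite (_ : \row_i lcoord x i = (\row_j coord3 x j) *m invmx (\matrix_(i, j) coord3 (G i) j)).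
    by rewrite mulmxKV// lat_basis_unitmx.
  by apply/rowP => i; rewrite !mxE; apply: eq_bigr => k _; rewrite mxE.
move=> /(congr1 (fun A : 'rV_3 => A 0 j)); rewrite !mxE => ->.
by apply: eq_bigr => i _; rewrite !mxE.
Qed.

Lemma lcoord_unique (s : 'I_3 -> R) i : lcoord (\sum_i s i *: G i) i = s i.
Proof.
apply/eqP; rewrite -subr_eq0; apply/eqP; move: i.
apply: (@lat_free R G); under eq_bigr do rewrite scalerBl.
by rewrite sumrB -lcoordE subrr.
Qed.

Lemma lcoord_lvec n i : lcoord (lvec n) i = (n i)%:~R.
Proof. exact: lcoord_unique. Qed.

(** The integer coefficients of a lattice vector are obtained from its coordinates by the inverse of
    the basis matrix, so for a short vector they have absolute value less than 1. This gives the
    scale below which the torus looks like R^3. *)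
Lemma short_lattice_vector : exists2 r : R, 0 < r &
  forall n, (forall j, `|coord3 (lvec n) j| < r) -> lvec n = 0.
Proof.
pose M := \sum_(j < 3) \sum_(i < 3) `|invmx (\matrix_(i, j) coord3 (G i) j) j i|.
have M0 : 0 <= M by apply: sumr_ge0 => j _; apply: sumr_ge0.
have M1 : 0 < M + 1 by rewrite ltr_wpDl.
exists (M + 1)^-1; first by rewrite invr_gt0.
move=> n Hn; suff n0 i : n i = 0.
  by rewrite /lvec big1// => i _; rewrite n0 scale0r.
have : `|lcoord (lvec n) i| < 1.
  apply: (@le_lt_trans _ _ ((M + 1)^-1 * M)); last first.
    by rewrite mulrC ltr_pdivrMr// mul1r ltrDl.
  apply: le_trans (ler_norm_sum _ _ _) _.
  rewrite mulr_sumr; apply: ler_sum => j _; rewrite normrM.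
  apply: ler_pM => //; first exact: ltW.
  by rewrite (bigD1 i)//= lerDl; apply: sumr_ge0.
rewrite lcoord_lvec -intr_norm -[1]/(1%:~R) ltr_int => h.
have : (`|n i|%N < 1)%N by rewrite -ltz_nat abszE.
by rewrite ltnS leqn0 absz_eq0 => /eqP.
Qed.

Definition fd_shift (x : E3 R) : {ffun 'I_3 -> int} := [ffun i => - Num.floor (lcoord x i)].

Lemma fd_shiftP x : fundamental_domain G (x + lvec (fd_shift x)).
Proof.
exists (fun i => lcoord x i - (Num.floor (lcoord x i))%:~R).
  move=> i; have := @real_floor_itv R (lcoord x i) (num_real _).
  by rewrite subr_ge0 ltrBlDl rmorphD.
rewrite {1}(lcoordE x) -big_split; apply: eq_bigr => i _.
by rewrite /= ffunE rmorphN -scalerDl.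
Qed.

Lemma fd_unique x n : fundamental_domain G x -> fundamental_domain G (x + lvec n) ->
  lvec n = 0.
Proof.
move=> [s s01 xE] [s' s01' xE'].
have E i : s' i = s i + (n i)%:~R.
  rewrite -(lcoord_unique s') -(lcoord_unique (fun i => s i + (n i)%:~R)); congr lcoord.
  rewrite -xE' xE /lvec -big_split; apply: eq_bigr => j _; exact/esym/scalerDl.
rewrite /lvec big1// => i _; suff -> : n i = 0 by rewrite scale0r.
have /andP[s0 s1] := s01 i; have /andP[s0' s1'] := s01' i.
have h1 : ((n i)%:~R : R) < 1 by rewrite E in s1'; lra.
have h2 : (-1 : R) < (n i)%:~R by rewrite E in s0'; lra.
move: h1 h2; rewrite -[1]/(1%:~R) -rmorphN !ltr_int => h1 h2.
apply/eqP; rewrite eq_le; apply/andP; split; first by rewrite -ltzD1.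
by move: h2; rewrite -lezD1.
Qed.

End lattice_geometry.

Section restricted_measure.
Local Open Scope ereal_scope.
Context d (T : measurableType d) (R : realType).
Variables (mu : {measure set T -> \bar R}) (W : set T) (mW : measurable W).

Lemma ge0_integral_mrestr (D : set T) (f : T -> \bar R) :
  measurable D -> measurable_fun D f -> (forall x, D x -> 0 <= f x) ->
  \int[mrestr mu mW]_(x in D) f x = \int[mu]_(x in D `&` W) f x.
Proof.
move=> mD mf f0.
rewrite (@ge0_negligible_integral _ _ _ (mrestr mu mW) D (~` W))//; last 2 first.
- exact: measurableC.
- by rewrite /= /mrestr setICl measure0.
rewrite setDE setCK; apply: eq_measure_integral => A mA AD.
by rewrite /= /mrestr; congr (mu _); apply/setIidPl => x /AD[].
Qed.

End restricted_measure.

Lemma measure_countable_bigcup d (T : measurableType d) (R : realType) (I : countType)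
    (mu : {measure set T -> \bar R}) (A B : I -> set T) :
  (forall i, measurable (A i)) -> (forall i, measurable (B i)) ->
  trivIset setT A -> trivIset setT B -> (forall i, mu (A i) = mu (B i)) ->
  mu (\bigcup_i A i) = mu (\bigcup_i B i).
Proof.
move=> mA mB tA tB AB.
pose f (A : I -> set T) (k : nat) := if pickle_inv k is Some i then A i else set0.
have fE (C : I -> set T) : (forall i, measurable (C i)) -> trivIset setT C ->
    mu (\bigcup_i C i) = (\sum_(k <oo) mu (f C k))%E.
  move=> mC tC; rewrite (_ : \bigcup_i C i = \bigcup_k f C k); last first.
    apply/seteqP; split => x [i _]; first by exists (pickle i) => //; rewrite /f pickleK_inv.
    by rewrite /f; case: pickle_inv => // j Cx; exists j.
  have mf k : measurable (f C k) by rewrite /f; case: pickle_inv.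
  apply: measure_semi_bigcup => //; last exact: bigcupT_measurable.
  apply/trivIsetP => i j _ _ ij; rewrite /f.
  case iE : (pickle_inv i) => [i'|]; last by rewrite set0I.
  case jE : (pickle_inv j) => [j'|]; last by rewrite setI0.
  move/trivIsetP : tC; apply => //; apply: contra_neq ij => ij'.
  have := @pickle_invK I i; have := @pickle_invK I j; rewrite /ocancel iE jE /= => <- <-.
  by rewrite ij'.
rewrite !fE//; apply: eq_eseriesr => k _; rewrite /f.
by case: pickle_inv => [i|]; rewrite ?AB// !measure0.
Qed.

(** * Measure and measurability on the cylinder *)

Section cylinder_measure.
Variables (R : realType) (G : lattice3 R).
Local Notation X := (cylinder G).

Definition proj4 (x : mE4 R) : X := (torus_proj G x.1, x.2).

Definition fd4 : set (mE4 R) := fundamental_domain G `*` setT.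

Lemma measurable_proj4 : measurable_fun [set: mE4 R] proj4.
Proof.
apply/measurable_fun_pair => /=; last exact: measurable_snd.
exact: measurableT_comp (@measurable_torus_proj R G) measurable_fst.
Qed.

Lemma measurable_fd4 : measurable fd4.
Proof. by apply: measurableX => //; exact: measurable_fundamental_domain. Qed.

Lemma measurable_proj4_preimage (A : set X) : measurable A -> measurable (proj4 @^-1` A).
Proof. by move=> mA; rewrite -[proj4 @^-1` A]setTI; exact: measurable_proj4. Qed.

Lemma vol4E (S : set (mE4 R)) :
  (vol4 R S = \int[vol3 R]_x (@lebesgue_measure R) (xsection S x))%E.
Proof. by []. Qed.

Lemma dvolE (A : set X) : measurable A -> dvol G A = vol4 R (fd4 `&` proj4 @^-1` A).
Proof.
move=> mA; pose F := fun t : torus G => (@lebesgue_measure R) (xsection A t).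
have mF : measurable_fun [set: torus G] F by exact: measurable_fun_xsection.
have mFD : measurable (fundamental_domain G : set (mE3 R)).
  exact: measurable_fundamental_domain.
transitivity (\int[pushforward (mrestr (lebesgue3 R) (measurable_fundamental_domain G))
    (torus_proj G : mE3 R -> torus G)]_t F t)%E; first by [].
have F0 : {in [set: torus G], forall y, (0 <= F y)%E} by move=> y _; exact: measure_ge0.
rewrite (@ge0_integral_pushforward _ _ _ _ _ _ (@measurable_torus_proj R G)
  (mrestr (lebesgue3 R) (measurable_fundamental_domain G)) setT F measurableT mF F0).
rewrite preimage_setT (@ge0_integral_mrestr _ _ _ (vol3 R) _ (measurable_fundamental_domain G)
  setT (F \o torus_proj G) measurableT
  (measurableT_comp mF (@measurable_torus_proj R G)) (fun x _ => F0 (torus_proj G x) (in_setT _))).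
rewrite setTI vol4E integral_mkcond.
apply: eq_integral => x _; rewrite patchE.
case: ifPn => xD.
  congr (lebesgue_measure _); apply/seteqP; split => t; rewrite /xsection /= !inE.
    by move=> At; split => //; split => //; exact: set_mem.
  by move=> [].
rewrite (_ : xsection _ x = set0) ?measure0//.
apply/seteqP; split => // t; rewrite /xsection /= inE => -[[/mem_set]].
by rewrite (negbTE xD).
Qed.

Definition lshift (n : {ffun 'I_3 -> int}) : mE4 R -> mE4 R := shift4 (lvec G n, 0).

Lemma lshiftE n x : lshift n x = ((x.1 : E3 R) + lvec G n, x.2).
Proof. by rewrite /lshift /shift4; congr pair; rewrite /= addr0. Qed.

Lemma lshiftD n m x : lshift n (lshift m x) = lshift (n + m) x.
Proof. by rewrite !lshiftE /= lvecD -addrA [lvec G m + _]addrC. Qed.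

Lemma lshift0 x : lshift 0 x = x.
Proof. by rewrite lshiftE lvec0 addr0; case: x. Qed.

Lemma lshiftK n : cancel (lshift n) (lshift (- n)).
Proof. by move=> x; rewrite lshiftD addNr lshift0. Qed.

Lemma proj4_eqP x y : proj4 x = proj4 y <-> exists n, x = lshift n y.
Proof.
split=> [[/torus_proj_eqP[n xyE] xy2]|[n ->]].
  by exists n; rewrite lshiftE -xyE -xy2; case: x {xyE xy2}.
by rewrite lshiftE /proj4 /= torus_proj_lvec.
Qed.

Lemma proj4_lshift n x : proj4 (lshift n x) = proj4 x.
Proof. by apply/proj4_eqP; exists n. Qed.

Lemma measurable_lshift_preimage n (A : set (mE4 R)) : measurable A -> measurable (lshift n @^-1` A).
Proof. by move=> mA; rewrite -[lshift n @^-1` A]setTI; exact: measurable_shift4. Qed.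

Lemma vol4_lshift n (A : set (mE4 R)) : measurable A -> vol4 R (lshift n @^-1` A) = vol4 R A.
Proof. exact: vol4_shift. Qed.

Lemma fd4_shift x : exists n, fd4 (lshift n x).
Proof. by exists (fd_shift G x.1); rewrite lshiftE; split => //=; exact: fd_shiftP. Qed.

Lemma fd4_unique n m x : fd4 (lshift n x) -> fd4 (lshift m x) -> lshift n x = lshift m x.
Proof.
rewrite !lshiftE => -[/= Dn _] [/= Dm _].
have e : (x.1 : E3 R) + lvec G m = (x.1 : E3 R) + lvec G n + lvec G (m - n).
  by rewrite -addrA -lvecD [n + _]addrC subrK.
by rewrite e in Dm *; rewrite (fd_unique Dn Dm) addr0.
Qed.

Lemma countable_shifts : countable [set: {ffun 'I_3 -> int}].
Proof. exact: countableP. Qed.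

Definition fd_rep (p : X) : mE4 R :=
  lshift (fd_shift G (repr p.1)) (repr p.1, p.2).

Lemma fd_repP p : fd4 (fd_rep p) /\ proj4 (fd_rep p) = p.
Proof.
rewrite /fd_rep; split; first by rewrite lshiftE; split => //=; exact: fd_shiftP.
by rewrite proj4_lshift /proj4 torus_proj_repr; case: p.
Qed.

(** The representative [repr] is arbitrary, but its translate in the fundamental domain does not
    depend on it. This measurable section links the product sigma-algebra of the cylinder with that
    of R^4: measurability of a function can then be checked on its lift. *)
Lemma measurable_fd_rep : measurable_fun [set: X] (@fd_rep).
Proof.
have E x : fd_rep (proj4 x) = lshift (fd_shift G x.1) x.
  have [D P] := fd_repP (proj4 x); have [n Pn] := (proj4_eqP _ _).1 P.
  rewrite Pn; rewrite Pn in D; apply: fd4_unique D _.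
  by rewrite lshiftE; split => //=; exact: fd_shiftP.
apply/measurable_fun_pair => /=; last first.
  rewrite [X in measurable_fun _ X](_ : _ = snd); first exact: measurable_snd.
  by apply/funext => p; have [_ e] := fd_repP p; exact: (congr1 snd e).
pose g := (fun t : torus G => (fd_rep (t, 0)).1).
rewrite [X in measurable_fun _ X](_ : _ = g \o fst); last first.
  apply/funext => p; have [_ e] := fd_repP p.
  have e' : (p.1, 0) = proj4 ((fd_rep p).1, 0) by rewrite -{1}e.
  transitivity ((fd_rep (proj4 (fd_rep p))).1); first by rewrite e.
  by rewrite [RHS]/(g p.1) /g e' !E !lshiftE.
apply: measurableT_comp measurable_fst => _ B mB; rewrite setTI.
have mFD := measurable_fundamental_domain G.
have mBD : measurable (B `&` fundamental_domain G : set (mE3 R)) by exact: measurableI.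
rewrite [measurable _](_ : _ = measurable ((torus_proj G : mE3 R -> torus G) @^-1` (g @^-1` B)))//.
rewrite (_ : _ @^-1` _ = \bigcup_n (shift3 (lvec G n) @^-1` (B `&` fundamental_domain G))).
  apply: countable_bigcupT_measurable; first exact: countable_shifts.
  by move=> n; rewrite -[X in measurable X]setTI; exact: measurable_shift3.
apply/seteqP; split => x.
  rewrite /= /g => Bx; exists (fd_shift G x) => //.
  split; last exact: fd_shiftP.
  by move: Bx; rewrite -[(torus_proj G x, 0)]/(proj4 (x, 0)) E lshiftE.
move=> [n _ [Bx Dx]]; rewrite /= /g -[(torus_proj G x, 0)]/(proj4 (x, 0)) E.
by rewrite (@fd4_unique _ n (x, 0)) ?lshiftE//; split => //=; exact: fd_shiftP.
Qed.

Lemma measurable_proj4_iff (S : set X) : measurable (proj4 @^-1` S) -> measurable S.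
Proof.
move=> mS; have -> : S = fd_rep @^-1` (proj4 @^-1` S).
  by apply/seteqP; split => p /=; have [_ ->] := fd_repP p.
by rewrite -[X in measurable X]setTI; exact: measurable_fd_rep.
Qed.

Lemma measurable_fun_proj4 d (T : measurableType d) (u : X -> T) :
  measurable_fun [set: mE4 R] (u \o proj4) -> measurable_fun [set: X] u.
Proof.
move=> mu _ B mB; rewrite setTI; apply: measurable_proj4_iff.
by rewrite -[X in measurable X]setTI; exact: mu.
Qed.

(** Equivalently, [proj4] is injective on [W]. *)
Definition lattice_separated (W : set (mE4 R)) :=
  forall x n, W x -> W (lshift n x) -> lvec G n = 0.

Lemma proj4_imageE (W : set (mE4 R)) : proj4 @^-1` (proj4 @` W) = \bigcup_n (lshift n @^-1` W).
Proof.
apply/seteqP; split => x /=.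
  by move=> [y Wy /proj4_eqP[n yE]]; exists n => //=; rewrite -yE.
by move=> [n _ Wx]; exists (lshift n x) => //; exact: proj4_lshift.
Qed.

Lemma measurable_proj4_image (W : set (mE4 R)) : measurable W -> measurable (proj4 @` W).
Proof.
move=> mW; apply: measurable_proj4_iff; rewrite proj4_imageE.
apply: countable_bigcupT_measurable; first exact: countable_shifts.
by move=> n; exact: measurable_lshift_preimage.
Qed.

(** Cut [W] along the translates of the fundamental domain and move each piece back into it. The
    pieces [B n] stay disjoint because [W] is separated, and their volumes do not change. *)
Lemma dvol_image (W : set (mE4 R)) : measurable W -> lattice_separated W ->
  dvol G (proj4 @` W) = vol4 R W.
Proof.
move=> mW sW; rewrite dvolE; last exact: measurable_proj4_image.
have mFD := measurable_fd4.
pose A n := W `&` lshift n @^-1` fd4.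
pose B n := lshift (- n) @^-1` A n.
have mA n : measurable (A n).
  by apply: measurableI => //; exact: measurable_lshift_preimage.
have mB n : measurable (B n) by exact: measurable_lshift_preimage.
have BE n y : B n y <-> W (lshift (- n) y) /\ fd4 y.
  by rewrite /B /A /= lshiftD subrr lshift0.
have -> : W = \bigcup_n A n.
  apply/seteqP; split => [x Wx|x [n _ []]//].
  by have [n Dn] := fd4_shift x; exists n.
have -> : fd4 `&` proj4 @^-1` (proj4 @` \bigcup_n A n) = \bigcup_n B n.
  apply/seteqP; split => [x [Dx /= [y [n _ [Wy Dy]] /esym/proj4_eqP[m xE]]]|x [n _ /BE[Wx Dx]]].
    by exists m => //; apply/BE; rewrite xE lshiftK -xE.
  split => //=; exists (lshift (- n) x); last exact: proj4_lshift.
  by exists n => //; split => //=; rewrite lshiftD subrr lshift0.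
have inj n m : lvec G (n - m) = 0 -> n = m.
  move=> nm0; apply/ffunP => i; apply/eqP; rewrite -subr_eq0 -(eqr_int R).
  have := lcoord_lvec G (n - m) i; rewrite nm0 -(lvec0 G) lcoord_lvec !ffunE => <-.
  by rewrite mulr0z.
apply/esym; apply: (measure_countable_bigcup mA mB).
- apply/trivIsetP => n m _ _ /eqP nm; apply/seteqP; split => // x [[Wx Dn] [_ Dm]].
  apply: nm; apply: inj; have := fd4_unique Dn Dm; rewrite !lshiftE => /(congr1 fst)/addrI e.
  by rewrite lvecD lvecN e subrr.
- apply/trivIsetP => n m _ _ /eqP nm; apply/seteqP; split => // x [/BE[Wn _] /BE[Wm _]].
  apply: nm; apply: inj; apply: (sW (lshift (- n) x)) => //.
  by rewrite lshiftD addrAC subrr add0r.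
- by move=> n; apply/esym/vol4_lshift.
Qed.

(** By [dvol_image], applied to all measurable parts of [W], the volume on the image of [W] is the
    push-forward of the volume of R^4 restricted to [W]. *)
Lemma ge0_integral_unfold (W : set (mE4 R)) (u : X -> \bar R) :
  measurable W -> lattice_separated W ->
  measurable_fun [set: X] u -> (forall p, (0 <= u p)%E) ->
  (\int[dvol G]_(p in proj4 @` W) u p = \int[vol4 R]_(x in W) u (proj4 x))%E.
Proof.
move=> mW sW mu u0.
have mPW := measurable_proj4_image mW.
pose mfun := @isMeasurableFun.Build _ _ _ _ _ measurable_proj4.
pose h : {mfun mE4 R >-> X} := HB.pack proj4 mfun.
transitivity (\int[pushforward (mrestr (vol4 R) mW) h]_(p in proj4 @` W) u p)%E.
  apply: eq_measure_integral => A mA AW.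
  have mWA : measurable (W `&` proj4 @^-1` A).
    by apply: measurableI => //; exact: measurable_proj4_preimage.
  have AE : A = proj4 @` (W `&` proj4 @^-1` A).
    apply/seteqP; split => [p Ap|p [x [_ Ax] <-]//].
    by have [x Wx xp] := AW p Ap; exists x => //; split => //=; rewrite xp.
  rewrite {1}AE dvol_image//; first by rewrite setIC.
  by move=> x n [Wx _] [Wn _]; exact: sW Wn.
have mu' : measurable_fun (proj4 @` W) u by exact: measurable_funS mu.
have u0' : {in proj4 @` W, forall p, (0 <= u p)%E} by [].
transitivity (\int[mrestr (vol4 R) mW]_(x in proj4 @^-1` (proj4 @` W)) (u \o proj4) x)%E.
  exact: (@ge0_integral_pushforward _ _ _ _ _ _ measurable_proj4
    (mrestr (vol4 R) mW) _ u mPW mu' u0').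
rewrite (@ge0_integral_mrestr _ _ _ (vol4 R)) //.
- by congr (integral _ _ _); apply/setIidPr => x Wx; exists x.
- exact: measurable_proj4_preimage.
- by apply: measurable_funTS; exact: measurableT_comp mu measurable_proj4.
- by move=> x _; exact: u0.
Qed.

End cylinder_measure.

Lemma integral_exp_abs_lty (R : realType) (c : R) : 0 < c ->
  (\int[@lebesgue_measure R]_x (expR (- (c * `|x|)))%:E < +oo)%E.
Proof.
move=> c0.
have cf : continuous (fun x : R => expR (- (c * `|x|))).
  move=> x; apply: continuous_comp; last exact: continuous_expR.
  apply: continuousN; apply: continuousM; first exact: cst_continuous.
  exact: norm_continuous.
rewrite ge0_symfun_integralT//; last by move=> x /=; rewrite normrN.
have mP : measurable [set x : R | 0 <= x].
  rewrite (_ : [set x | _] = `[0, +oo[%classic); first exact: measurable_itv.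
  by apply/seteqP; split => x /=; rewrite in_itv/= andbT.
have mpdf : measurable_fun [set: R] (EFin \o exponential_pdf c).
  by apply/measurable_EFinP; exact: measurable_exponential_pdf.
have : (\int[@lebesgue_measure R]_(x in [set x : R | (0 <= x)%R]) (exponential_pdf c x)%:E <= 1)%E.
  rewrite -(integral_exponential_pdf c0); apply: ge0_subset_integral => //.
  by move=> x _; rewrite lee_fin exponential_pdf_ge0// ltW.
have -> : (\int[@lebesgue_measure R]_(x in [set x : R | (0 <= x)%R]) (exponential_pdf c x)%:E =
    \int[@lebesgue_measure R]_(x in [set x : R | (0 <= x)%R]) (c%:E * (expR (- (c * `|x|)))%:E))%E.
  apply: eq_integral => x /set_mem/= x0; rewrite exponential_pdfE// -EFinM mulNr ger0_norm//.
have mexp : measurable_fun ([set x : R | 0 <= x] : set (measurableTypeR R))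
    (fun x : R => (expR (- (c * `|x|)))%:E).
  apply/measurable_EFinP; apply: measurable_funTS; exact: continuous_measurable_fun.
rewrite ge0_integralZl//; last by rewrite lee_fin ltW.
rewrite -lee_pdivlMl// mule1 => H.
by apply: (@le_lt_trans _ _ (2%:E * (c^-1)%:E)%E); [rewrite lee_pmul2l//|rewrite -EFinM ltry].
Qed.

Section cylinder_integrals.
Variables (R : realType) (G : lattice3 R).
Local Notation X := (cylinder G).
Local Notation leb := (@lebesgue_measure R).

Lemma dvol_torus_lty : (dvol_torus [set: torus G] < +oo)%E.
Proof.
pose M := 1 + \sum_(i < 3) \sum_(j < 3) `|coord3 (G i) j|.
have M0 : 0 <= \sum_(i < 3) \sum_(j < 3) `|coord3 (G i) j|.
  by apply: sumr_ge0 => i _; apply: sumr_ge0.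
pose I : set (measurableTypeR R) := `[- M, M]%classic.
have mI : measurable I by exact: measurable_itv.
pose Box : set (mE3 R) := I `*` I `*` I.
have mBox : measurable Box.
  by apply: measurableX; [apply: measurableX|].
have FB : fundamental_domain G `<=` Box.
  move=> x [s s01 xE].
  have B j : coord3 x j \in `[- M, M].
    rewrite in_itv/= -ler_norml xE coord3_comb.
    apply: le_trans (ler_norm_sum _ _ _) _.
    apply: (@le_trans _ _ (\sum_(i < 3) \sum_(j < 3) `|coord3 (G i) j|)); last by rewrite lerDr.
    apply: ler_sum => i _; rewrite normrM.
    have /andP[s0 s1] := s01 i; rewrite (ger0_norm s0).
    apply: (@le_trans _ _ `|coord3 (G i) j|); first by rewrite ler_piMl// ltW.
    by rewrite (bigD1 j)//= lerDl; apply: sumr_ge0.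
  by split; [split; [exact: (B 0)|exact: (B 1)]|exact: (B 2%:R)].
have mFD := measurable_fundamental_domain G.
apply: (@le_lt_trans _ _ (vol3 R Box)).
  apply: (@le_trans _ _ (vol3 R (fundamental_domain G))).
    by rewrite /dvol_torus /pushforward /mrestr preimage_setT setTI.
  by apply: le_measure; rewrite ?inE.
have fI : (leb I < +oo)%E.
  by rewrite /I lebesgue_measure_itv/=; case: ifP; rewrite // -?EFinB ltry.
have -> : vol3 R Box = (leb I * leb I * leb I)%E.
  rewrite -(product_measure1E leb leb mI mI).
  exact: (product_measure1E (sigma_finite_product leb leb) leb (measurableX mI mI) mI).
by rewrite !lte_mul_pinfty ?measure_ge0 ?mule_ge0 ?measure_ge0// ?ge0_fin_numE ?lte_mul_pinfty ?measure_ge0 ?mule_ge0 ?measure_ge0// ?ge0_fin_numE ?measure_ge0.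
Qed.

Definition torus_volume : R := fine (dvol_torus [set: torus G]).

Lemma torus_volume_ge0 : 0 <= torus_volume.
Proof. by rewrite fine_ge0. Qed.

Lemma torus_volumeE : dvol_torus [set: torus G] = torus_volume%:E.
Proof. by rewrite fineK// ge0_fin_numE// dvol_torus_lty. Qed.

Lemma ge0_integral_height (u : R -> \bar R) :
  measurable_fun [set: measurableTypeR R] u -> (forall t, (0 <= u t)%E) ->
  (\int[dvol G]_p u p.2 = torus_volume%:E * \int[leb]_t u t)%E.
Proof.
move=> mu u0.
have u0' : {in [set: measurableTypeR R], forall t, (0 <= u t)%E} by [].
transitivity (\int[pushforward (dvol G) (@snd (torus G) (measurableTypeR R))]_t u t)%E.
  by rewrite (@ge0_integral_pushforward _ _ _ _ _ _ (@measurable_snd _ _ (torus G) (measurableTypeR R)) (dvol G) setT u measurableT mu u0').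
pose k := NngNum torus_volume_ge0.
rewrite (eq_measure_integral (mscale k leb)); last first.
  move=> A mA _; transitivity (dvol G ([set: torus G] `*` A)).
    by congr (dvol G _); apply/seteqP; split => [p /=|p []].
  by rewrite [LHS]product_measure1E//= torus_volumeE.
by rewrite ge0_integral_mscale.
Qed.

Definition slab (a b : R) : set X := [set p | a <= p.2 <= b].

Lemma measurable_slab a b : measurable (slab a b).
Proof.
rewrite (_ : slab a b = setT `*` `[a, b]%classic).
  by apply: measurableX => //; exact: measurable_itv.
by apply/seteqP; split => p; rewrite /slab /= in_itv/= => // -[].
Qed.

Lemma dvol_slab a b : a <= b -> dvol G (slab a b) = (torus_volume * (b - a))%:E.
Proof.
move=> ab; rewrite (_ : slab a b = setT `*` `[a, b]%classic).
  rewrite [LHS]product_measure1E//= torus_volumeE lebesgue_measure_itv/= lte_fin.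
  have [ba|] := ltP a b; first by rewrite -EFinB EFinM.
  by move=> ba; rewrite mule0 (@le_anti _ _ a b) ?ab// subrr mulr0.
by apply/seteqP; split => p; rewrite /slab /= in_itv/= => // -[].
Qed.

End cylinder_integrals.

(** * Testing the differential inequality *)

Section testing.
Variables (R : realType) (G : lattice3 R) (L : complex_iso R).
Hypothesis isoL : cstruct_isometry L.
Local Notation X := (cylinder G).

Lemma laplacianX_lap (chi : X -> R) p : smooth (Defs.lift chi) ->
  laplacianX L chi p = - 2^-1 * lap (Defs.lift chi) (repr p.1, p.2).
Proof. by move=> schi; rewrite /laplacianX laplacianE. Qed.

Lemma lap_near (F H : E4 R -> R) x : (\forall y \near x, F y = H y) -> lap F x = lap H x.
Proof.
move=> FH; apply: eq_bigr => i _; apply: near_eq_derive.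
by have := near_join FH; apply: filterS => y; exact: near_eq_derive.
Qed.

Lemma torus_compact_cover : exists2 K : set (E3 R), compact K &
  torus_proj G @` K = [set: torus G].
Proof.
pose M := \sum_(i < 3) \sum_(j < 3) `|coord3 (G i) j|.
pose K : set (E3 R) := `[- M, M]%classic `*` `[- M, M]%classic `*` `[- M, M]%classic.
exists K; first by apply: compact_setX; [apply: compact_setX|]; exact: segment_compact.
apply/seteqP; split => // t _.
exists (repr t + lvec G (fd_shift G (repr t))); last first.
  by rewrite torus_proj_lvec torus_proj_repr.
have [s s01 xE] := fd_shiftP G (repr t).
have B j : coord3 (repr t + lvec G (fd_shift G (repr t))) j \in `[- M, M].
  rewrite in_itv/= -ler_norml xE coord3_comb.
  apply: le_trans (ler_norm_sum _ _ _) _.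
  apply: ler_sum => i _; rewrite normrM.
  have /andP[s0 s1] := s01 i; rewrite (ger0_norm s0).
  apply: (@le_trans _ _ `|coord3 (G i) j|); first by rewrite ler_piMl// ltW.
  by rewrite (bigD1 j)//= lerDl; apply: sumr_ge0.
by split; [split; [exact: (B 0)|exact: (B 1)]|exact: (B 2%:R)].
Qed.

Lemma torus_compact : compact [set: torus G].
Proof.
have [K cK <-] := torus_compact_cover.
apply: continuous_compact => //; apply: continuous_subspaceT.
exact: pi_continuous.
Qed.

Lemma test_function_of_support (chi : X -> R) n : smooth (Defs.lift chi) ->
  (forall p, n < `|p.2| -> chi p = 0) -> test_function chi.
Proof.
move=> schi chi0; split => //.
pose K : set X := [set: torus G] `*` (`[- n, n]%classic : set R).
have cK : compact K by apply: compact_setX; [exact: torus_compact|exact: segment_compact].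
apply: (subclosed_compact _ cK); first exact: closed_closure.
have clK : closed K.
  rewrite (_ : K = snd @^-1` (`[- n, n]%classic : set R)).
    apply: closed_comp; last exact: itv_closed.
    by move=> p _; exact: cvg_snd.
  by apply/seteqP; split => [p []|p].
rewrite ((closure_id K).1 clK); apply: closureS => p /= chip; split => //=.
rewrite in_itv/= -ler_norml leNgt; apply: contra chip => np.
by rewrite chi0.
Qed.

Lemma laplacianX_height (u u1 u2 : R -> R) p : smooth u ->
  (forall s, is_derive (s : R) (1 : R) u (u1 s)) ->
  (forall s, is_derive (s : R) (1 : R) u1 (u2 s)) ->
  laplacianX L (fun q : X => u q.2) p = - 2^-1 * u2 p.2.
Proof.
move=> su du du1; rewrite laplacianX_lap; first by rewrite (lap_height _ du du1).
apply/smoothP => n; apply: Ck_height; move: n; exact/smoothP.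
Qed.

Lemma smooth_height (u : R -> R) : smooth u -> smooth (Defs.lift (fun q : X => u q.2)).
Proof.
move=> /smoothP su; apply/smoothP => n; exact: Ck_height.
Qed.

Lemma dvol_slab_lty (a b : R) : (dvol G (slab a b) < +oo)%E.
Proof.
have [ab|ba] := leP a b; first by rewrite dvol_slab// ltry.
rewrite (_ : slab a b = set0) ?measure0//; apply/seteqP; split => // p /= /andP[h1 h2].
by have := le_trans h1 h2; rewrite leNgt ba.
Qed.

Lemma integral_slab_le (f g : X -> R) (M K n : R) :
  measurable_fun [set: X] f -> measurable_fun [set: X] g ->
  (forall p, `|f p| <= M) -> (forall p, `|g p| <= K) -> (forall p, n < `|p.2| -> g p = 0) ->
  (\int[dvol G]_p `|(f p * g p)%:E| <= (M * K)%:E * dvol G (slab (- n) n))%E.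
Proof.
move=> mf mg fM gK g0.
pose S : set X := slab (- n) n.
have mS : measurable S by exact: measurable_slab.
have M0 : 0 <= M by exact: le_trans (fM point).
have K0 : 0 <= K by exact: le_trans (gK point).
apply: (@le_trans _ _ (\int[dvol G]_p ((M * K)%:E * (\1_S p)%:E))%E).
  apply: ge0_le_integral => //.
  - by apply: measurableT_comp => //; apply/measurable_EFinP; exact: measurable_funM.
  - by apply: measurable_funeM; apply/measurable_EFinP; exact: measurable_indic.
  move=> p _; rewrite abse_EFin indicE.
  have [pS|pS] := boolP (p \in S); first by rewrite mule1 lee_fin normrM ler_pM.
  rewrite mule0 g0 ?mulr0 ?normr0//.
  rewrite ltNge ler_norml; apply: contra pS => h1; exact/mem_set.
rewrite ge0_integralZl//; last 2 first.
- by apply/measurable_EFinP; exact: measurable_indic.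
- by rewrite lee_fin mulr_ge0.
by rewrite integral_indic// setIT.
Qed.

Lemma integrable_slab (f g : X -> R) (M K n : R) :
  measurable_fun [set: X] f -> measurable_fun [set: X] g ->
  (forall p, `|f p| <= M) -> (forall p, `|g p| <= K) -> (forall p, n < `|p.2| -> g p = 0) ->
  (dvol G).-integrable setT (fun p => (f p * g p)%:E).
Proof.
move=> mf mg fM gK g0; apply/integrableP; split.
  by apply/measurable_EFinP; exact: measurable_funM.
apply: le_lt_trans (integral_slab_le mf mg fM gK g0) _.
have M0 : 0 <= M by exact: le_trans (fM point).
have K0 : 0 <= K by exact: le_trans (gK point).
by rewrite lte_mul_pinfty ?lee_fin ?mulr_ge0// dvol_slab_lty.
Qed.

(** [A] is the quantity to estimate, and [E] absorbs the places where the Laplacian of [chi] is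
    negative. If [f * E] has infinite integral there is nothing to prove; otherwise the integral of
    the sum may be split. *)
Lemma test_inequality (f chi A E h : X -> R) (M K n : R) :
  measurable_fun [set: X] f -> (forall p, 0 <= f p <= M) ->
  test_function chi -> (forall p, 0 <= chi p) ->
  measurable_fun [set: X] (laplacianX L chi) ->
  (forall p, `|laplacianX L chi p| <= K) ->
  (forall p, n < `|p.2| -> laplacianX L chi p = 0) ->
  measurable_fun [set: X] A -> measurable_fun [set: X] E ->
  (forall p, 0 <= h p) -> (forall p, 0 <= A p) -> (forall p, 0 <= E p) ->
  (forall p, A p <= laplacianX L chi p + E p) ->
  dist_laplacian_le L f h ->
  (\int[dvol G]_p (f p * A p)%:E <=
   \int[dvol G]_p (h p * chi p)%:E + \int[dvol G]_p (f p * E p)%:E)%E.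
Proof.
move=> mf fM tchi chi0 mlap lapK lapn mA mE h0 A0 E0 AE dle.
have f0 p : 0 <= f p by have /andP[] := fM p.
have mfE : measurable_fun [set: X] (fun p => (f p * E p)%:E).
  by apply/measurable_EFinP; exact: measurable_funM.
have [fEoo|fEfin] := eqVneq (\int[dvol G]_p (f p * E p)%:E)%E +oo%E.
  rewrite fEoo addey ?leey// gt_eqF// (@lt_le_trans _ _ 0%E)// ?ltNy0//.
  by apply: integral_ge0 => p _; rewrite lee_fin mulr_ge0.
have ifE : (dvol G).-integrable setT (fun p => (f p * E p)%:E).
  apply/integrableP; split => //.
  rewrite (eq_integral (fun p => (f p * E p)%:E)).
    by rewrite ltey.
  by move=> p _; rewrite gee0_abs// lee_fin mulr_ge0.
have iflap : (dvol G).-integrable setT (fun p => (f p * laplacianX L chi p)%:E).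
  apply: (@integrable_slab _ _ M K n) => // p.
  by rewrite ger0_norm//; have /andP[] := fM p.
apply: (@le_trans _ _ (\int[dvol G]_p ((f p * laplacianX L chi p)%:E + (f p * E p)%:E))%E).
  apply: ge0_le_integral => //.
  - by move=> p _; rewrite lee_fin mulr_ge0.
  - by apply/measurable_EFinP; exact: measurable_funM.
  - apply: emeasurable_funD => //; exact: measurable_int iflap.
  - by move=> p _; rewrite -EFinD lee_fin -mulrDr ler_wpM2l.
rewrite integralD//; apply: leeD => //; exact: dle.
Qed.

End testing.

(** * The mass of a slab *)

Section height_functions.
Variable R : realType.
Local Notation Ck := (@differentiable_upto R R).

Lemma Ck_expR n : Ck n (@expR R).
Proof.
elim: n => [|n IH]; last exact: Ck_real_step (@is_derive_expR R) IH.
by split => // x; apply/derivable1_diffP; exact: derivable_expR.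
Qed.

Lemma Ck_affine n (a b : R) : Ck n (fun t => a * t + b).
Proof.
apply: CkD; last exact: Ck_cst.
by apply: CkM; [exact: Ck_cst|exact: Ck_id].
Qed.

Lemma is_derive_affine (a b t : R) : is_derive t (1 : R) (fun t : R => a * t + b) a.
Proof.
have := is_deriveD (is_deriveZ a (is_derive_id t (1 : R))) (is_derive_cst b t (1 : R)).
by rewrite /GRing.scale/= mulr1 addr0.
Qed.

Lemma is_derive_comp_affine (g : R -> R) (d a b t : R) :
  is_derive (a * t + b) (1 : R) g d ->
  is_derive t (1 : R) (fun t : R => g (a * t + b)) (d * a).
Proof.
move=> dg; exact: (@is_derive1_comp _ g (fun t => a * t + b) t d a dg (is_derive_affine a b t)).
Qed.

(** Each derivative that falls on the cutoff costs a factor 1/n, and such terms live on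
    [n <= |t| <= 2 * n] only. The constant does not depend on [u], so the same lemma serves for the
    slab estimate and, with [u] constant, for the second assertion. *)
Lemma cutoff_height : exists2 C : R, 0 < C & forall (u u1 u2 : R -> R) (n : R),
  smooth u -> 0 < n ->
  (forall s, is_derive (s : R) (1 : R) u (u1 s)) ->
  (forall s, is_derive (s : R) (1 : R) u1 (u2 s)) ->
  exists chi1 chi2 : R -> R,
  [/\ smooth (fun t => u t * cutoff (t ^+ 2 / n ^+ 2)),
    (forall s, is_derive (s : R) (1 : R) (fun t => u t * cutoff (t ^+ 2 / n ^+ 2)) (chi1 s)),
    (forall s, is_derive (s : R) (1 : R) chi1 (chi2 s)),
    (forall t, n <= `|t| <= 2 * n ->
       `|chi2 t - u2 t * cutoff (t ^+ 2 / n ^+ 2)| <=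
          C * (`|u1 t| / n + `|u t| / n ^+ 2)) &
    (forall t, `|t| < n \/ 2 * n < `|t| -> chi2 t = u2 t * cutoff (t ^+ 2 / n ^+ 2))].
Proof.
have [C C0 HC] := @cutoff_bound R.
(* The inner derivative [2 * t / n ^+ 2] is at most 4 / n in absolute value, so the second
   derivative of the cutoff is at most (16 + 2) C / n^2. The cross term only requires 2 * 4 * C. *)
exists (18 * C); first by rewrite mulr_gt0.
move=> u u1 u2 n su n0 du du1.
pose v t : R := t ^+ 2 / n ^+ 2.
have n20 : 0 < n ^+ 2 by rewrite exprn_gt0.
have dv (t : R) : is_derive t (1 : R) v (2 * t / n ^+ 2).
  have H := is_deriveZ (n ^- 2) (is_deriveX 2 (is_derive_id t (1 : R))).
  have vE : v = n ^- 2 \*: (id ^+ 2) by apply/funext => s; rewrite /v mulrC.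
  rewrite vE; apply: is_derive_eq H _.
  by rewrite /GRing.scale/= expr1 mulr1 mulrC.
have dlin (t : R) : is_derive t (1 : R) (fun t : R => 2 * t / n ^+ 2) (2 / n ^+ 2).
  have := is_derive_affine (2 / n ^+ 2) 0 t.
  by rewrite (_ : (fun t : R => 2 / n ^+ 2 * t + 0) = (fun t : R => 2 * t / n ^+ 2))//;
    apply/funext => s; rewrite addr0 mulrAC.
pose k t := cutoff (v t); pose k1 t := cutoff' (v t) * (2 * t / n ^+ 2).
pose k2 t := cutoff'' (v t) * (2 * t / n ^+ 2) ^+ 2 + cutoff' (v t) * (2 / n ^+ 2).
have dk (t : R) : is_derive t (1 : R) k (k1 t).
  exact: (@is_derive1_comp _ (@cutoff R) v t _ _ (is_derive_cutoff _) (dv t)).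
have dk1 (t : R) : is_derive t (1 : R) k1 (k2 t).
  have H0 := @is_derive1_comp _ (@cutoff' R) v t _ _ (is_derive_cutoff' (v t)) (dv t).
  have H := is_deriveM H0 (dlin t). apply: is_derive_eq H _; rewrite /GRing.scale /k2 /=; ring.
exists (fun t => u t * k1 t + k t * u1 t).
exists (fun t => u t * k2 t + k1 t * u1 t + (k t * u2 t + u1 t * k1 t)).
split.
- apply/smoothP => m; apply: CkM; first by move: m; exact/smoothP.
  apply: (@Ck_comp _ m R v); first exact: smooth_cutoff.
  rewrite /v; apply: CkM; last exact: Ck_cst.
  rewrite (_ : (fun x => x ^+ 2) = fun x : R => x * x); last by apply/funext => x; rewrite expr2.
  by apply: CkM; exact: Ck_id.
- move=> s; exact: is_deriveM (du s) (dk s).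
- move=> s; exact: (is_deriveD (is_deriveM (du s) (dk1 s)) (is_deriveM (dk s) (du1 s))).
- move=> t /andP[tn t2n].
  have [c1 c2] := HC (v t).
  have T : `|2 * t / n ^+ 2| <= 2 * (2 * n) / n ^+ 2.
    rewrite normrM normfV (ger0_norm (ltW n20)) normrM (ger0_norm (ler0n _ 2)).
    apply: ler_wpM2r; first by rewrite invr_ge0 ltW.
    exact: ler_wpM2l.
  have T0 : 0 <= 2 * (2 * n) / n ^+ 2 by exact: le_trans T.
  have E1 : `|k1 t| <= 4 * C / n.
    rewrite /k1 normrM (_ : 4 * C / n = C * (2 * (2 * n) / n ^+ 2)); first exact: ler_pM.
    by field; rewrite gt_eqF.
  have E2 : `|k2 t| <= 18 * C / n ^+ 2.
    apply: le_trans (ler_normD _ _) _.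
    rewrite (_ : 18 * C / n ^+ 2 = C * (2 * (2 * n) / n ^+ 2) ^+ 2 + C * (2 / n ^+ 2)); last first.
      by field; rewrite gt_eqF.
    have N2 : 0 <= 2 / n ^+ 2 by rewrite divr_ge0// ltW.
    apply: lerD; rewrite normrM.
      apply: ler_pM => //; rewrite normrX; apply: lerXn2r => //.
    by rewrite (ger0_norm N2) ler_wpM2r.
  rewrite (_ : _ - _ = u t * k2 t + 2 * (k1 t * u1 t)); last by rewrite -/(v t) -/(k t); ring.
  apply: le_trans (ler_normD _ _) _.
  rewrite [`|u t * _|]normrM [`|2 * _|]normrM [`|k1 t * _|]normrM (ger0_norm (ler0n _ 2)).
  have H1 : `|u t| * `|k2 t| <= `|u t| * (18 * C / n ^+ 2) by rewrite ler_wpM2l.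
  have H2 : `|k1 t| * `|u1 t| <= 4 * C / n * `|u1 t| by rewrite ler_wpM2r.
  have H3 : 0 <= C / n * `|u1 t| by rewrite mulr_ge0// divr_ge0 ?ltW.
  rewrite (_ : 18 * C * _ = `|u t| * (18 * C / n ^+ 2) + 18 * (C / n * `|u1 t|)).
    rewrite (_ : 4 * C / n * `|u1 t| = 4 * (C / n * `|u1 t|)) in H2; last by rewrite !mulrA.
    apply: lerD => //; apply: (@le_trans _ _ (2 * (4 * (C / n * `|u1 t|)))).
      by apply: ler_wpM2l; [exact: ler0n|exact: H2].
    by rewrite mulrA ler_wpM2r// -natrM ler_nat.
  by field; rewrite gt_eqF.
- move=> t ht.
  have vt : v t < 1 \/ 4 < v t.
    rewrite /v; case: ht => ht; [left|right].
      rewrite ltr_pdivrMr// mul1r -(real_normK (num_real t)).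
      by rewrite ltr_pXn2r ?nnegrE// ltW.
    rewrite ltr_pdivlMr// -(real_normK (num_real t)) (_ : 4 * n ^+ 2 = (2 * n) ^+ 2); last by ring.
    by rewrite ltr_pXn2r ?nnegrE ?normr_ge0// mulr_ge0// ltW.
  rewrite /k1 /k2 (cutoff'_eq0 vt) (cutoff''_eq0 vt) -/(v t) -/(k t); ring.
Qed.

End height_functions.

(** * A smooth positive part with exponentially decaying second derivative *)

Section softplus.
Variables (R : realType) (d : R).
Hypothesis d0 : 0 < d.
Local Notation Ck := (@differentiable_upto R R).

(** [sigmoid] and [sigmoid'] are the first two derivatives of [softplus], a smooth version of max(t,
    0). With [d = delta] the bump [sigmoid'] decays at the same rate as the weight. The summand 0
    gives the arguments the affine shape of [is_derive_comp_affine]. *)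
Definition sigmoid (t : R) : R := (1 + expR (- d * t + 0))^-1.
Definition sigmoid' (t : R) : R := d * expR (- d * t + 0) * sigmoid t ^+ 2.
Definition softplus (t : R) : R := ln (1 + expR (d * t + 0)) / d.

Lemma sigmoid_den_gt0 t : 0 < 1 + expR (- d * t + 0).
Proof. by rewrite addr_gt0// expR_gt0. Qed.

Lemma sigmoid_ge0 t : 0 <= sigmoid t.
Proof. by rewrite invr_ge0 ltW// sigmoid_den_gt0. Qed.

Lemma sigmoid_le1 t : sigmoid t <= 1.
Proof. by rewrite invf_le1 ?sigmoid_den_gt0// lerDl expR_ge0. Qed.

Lemma sigmoid_mono s t : s <= t -> sigmoid s <= sigmoid t.
Proof.
move=> st; rewrite lef_pV2 ?posrE ?sigmoid_den_gt0// lerD2l ler_expR lerD2r.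
by rewrite !mulNr lerN2 ler_wpM2l// ltW.
Qed.

Lemma sigmoid_le t : sigmoid t <= expR (d * t).
Proof.
rewrite -[leRHS]invrK -expRN lef_pV2 ?posrE ?sigmoid_den_gt0 ?expR_gt0//.
by rewrite addr0 mulNr lerDr.
Qed.

Lemma sigmoid_ge t : 1 - sigmoid t <= expR (- (d * t)).
Proof.
have D := sigmoid_den_gt0 t.
rewrite (_ : 1 - sigmoid t = expR (- d * t + 0) * sigmoid t); last first.
  rewrite /sigmoid; move: (expR _) D => z D; field; exact: lt0r_neq0.
by rewrite addr0 mulNr ler_piMr ?expR_ge0// sigmoid_le1.
Qed.

Lemma sigmoid'_ge0 t : 0 <= sigmoid' t.
Proof. by rewrite /sigmoid' !mulr_ge0 ?expR_ge0 ?exprn_ge0 ?sigmoid_ge0// ltW. Qed.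

Lemma sigmoid'_le t : sigmoid' t <= d * expR (- (d * `|t|)).
Proof.
rewrite /sigmoid' -mulrA ler_wpM2l ?(ltW d0)// addr0 mulNr.
have [t0|t0] := leP 0 t.
  rewrite (ger0_norm t0); apply: ler_piMr; first exact: expR_ge0.
  by rewrite exprn_ile1 ?sigmoid_ge0 ?sigmoid_le1.
rewrite (ltr0_norm t0) mulrN opprK.
apply: (@le_trans _ _ (expR (- (d * t)) * expR (d * t) ^+ 2)).
  by apply: ler_wpM2l; [exact: expR_ge0|apply: lerXn2r; rewrite ?nnegrE ?sigmoid_ge0 ?expR_ge0 ?sigmoid_le].
by rewrite expRN expr2 mulKf// gt_eqF// expR_gt0.
Qed.

Lemma sigmoid'_ge t : `|t| <= 1 -> d * expR (- d) / (1 + expR d) ^+ 2 <= sigmoid' t.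
Proof.
rewrite ler_norml => /andP[t1 t2]; rewrite /sigmoid'.
have E0 : 0 < 1 + expR d by rewrite addr_gt0// expR_gt0.
have H1 : expR (- d) <= expR (- d * t + 0).
  rewrite ler_expR addr0 mulNr lerN2; apply: ler_piMr => //; exact: ltW.
have H2 : expR (- d * t + 0) <= expR d.
  rewrite ler_expR addr0 mulNr -mulrN; apply: ler_piMr; first exact: ltW.
  by rewrite lerNl.
apply: ler_pM; rewrite ?mulr_ge0 ?expR_ge0 ?(ltW d0) ?invr_ge0 ?exprn_ge0 ?(ltW E0)//.
  by rewrite ler_wpM2l// ltW.
rewrite -exprVn; apply: lerXn2r; rewrite ?nnegrE ?invr_ge0 ?(ltW E0) ?sigmoid_ge0//.
by rewrite /sigmoid lef_pV2 ?posrE ?sigmoid_den_gt0 ?lerD2l.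
Qed.

Lemma is_derive_exp_affine (a : R) t :
  is_derive t (1 : R) (fun t : R => 1 + expR (a * t + 0)) (a * expR (a * t + 0)).
Proof.
have H := is_deriveD (is_derive_cst (1 : R) t (1 : R))
  (@is_derive_comp_affine R (@expR R) (expR (a * t + 0)) a 0 t (is_derive_expR _)).
by apply: is_derive_eq H _; rewrite add0r mulrC.
Qed.

Lemma is_derive_sigmoid t : is_derive t (1 : R) sigmoid (sigmoid' t).
Proof.
have H := @is_deriveV R _ t _ 1 (lt0r_neq0 (sigmoid_den_gt0 t)) (is_derive_exp_affine (- d) t).
apply: is_derive_eq H _.
rewrite /GRing.scale/= /sigmoid' /sigmoid exprVn.
move: (sigmoid_den_gt0 t); move: (expR _) => e e0; field; exact: lt0r_neq0.
Qed.

Lemma is_derive_softplus t : is_derive t (1 : R) softplus (sigmoid t).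
Proof.
have E0 : 0 < 1 + expR (d * t + 0) by rewrite addr_gt0// expR_gt0.
have H0 := @is_derive1_comp R (@ln R) _ t _ _ (is_derive1_ln E0) (is_derive_exp_affine d t).
have H := is_deriveZ d^-1 H0.
rewrite (_ : softplus = d^-1 \*: (@ln R \o (fun t : R => 1 + expR (d * t + 0)))); last first.
  by apply/funext => s; rewrite /softplus mulrC.
apply: is_derive_eq H _.
rewrite /GRing.scale/= /sigmoid !addr0 mulNr expRN in E0 *.
have e0 := expR_gt0 (d * t); move: (expR _) e0 E0 => z z0 E0.
by field; rewrite [z + 1]addrC !lt0r_neq0.
Qed.

Lemma Ck_sigmoid n : Ck n sigmoid.
Proof.
apply: CkV => [s|]; first exact/lt0r_neq0/sigmoid_den_gt0.
apply: CkD; first exact: Ck_cst.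
by apply: (@Ck_comp _ n R (fun t => - d * t + 0)); [exact: Ck_expR|exact: Ck_affine].
Qed.

Lemma Ck_softplus n : Ck n softplus.
Proof.
case: n => [|n]; last exact: Ck_real_step is_derive_softplus (Ck_sigmoid n).
by split => // x; apply/derivable1_diffP; have [] := is_derive_softplus x.
Qed.

Lemma softplus_mono s t : s <= t -> softplus s <= softplus t.
Proof.
move=> st; rewrite /softplus ler_wpM2r ?invr_ge0 ?(ltW d0)//.
rewrite ler_ln ?posrE ?addr_gt0 ?expR_gt0// lerD2l ler_expR lerD2r ler_wpM2l//.
exact: ltW.
Qed.

Lemma softplus_ge0 t : 0 <= softplus t.
Proof.
by rewrite /softplus divr_ge0 ?(ltW d0)// ln_ge0// lerDl expR_ge0.
Qed.

Lemma softplus_shift_le s t : 0 <= s -> softplus t - softplus (t - s) <= s.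
Proof.
move=> s0; rewrite lerBlDl /softplus ler_pdivrMr// mulrDl mulfVK ?gt_eqF//.
have A0 : 0 < 1 + expR (d * (t - s) + 0) by rewrite addr_gt0// expR_gt0.
rewrite -[X in _ <= _ + X]expRK -lnM ?posrE ?expR_gt0//.
rewrite ler_ln ?posrE ?mulr_gt0 ?addr_gt0 ?expR_gt0//.
rewrite mulrDl mul1r -expRD !addr0 (_ : d * (t - s) + s * d = d * t); last by ring.
by rewrite lerD2r -[leLHS]expR0 ler_expR mulr_ge0// ltW.
Qed.

Lemma softplus_le t : softplus t <= `|t| + d^-1.
Proof.
have H : softplus `|t| <= `|t| + d^-1.
  rewrite /softplus ler_pdivrMr// mulrDl mulVf ?gt_eqF//.
  rewrite -[leRHS]expRK ler_ln ?posrE ?addr_gt0 ?expR_gt0// addr0 expRD [d * _]mulrC.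
  have e1 : 1 <= expR (`|t| * d) by rewrite -expR0 ler_expR mulr_ge0// ltW.
  have e2 : 2 <= expR (1 : R) by have := expR_ge1Dx (1 : R).
  apply: (@le_trans _ _ (expR (`|t| * d) * 2)); first by rewrite mulr_natr mulr2n lerD2r.
  by rewrite ler_wpM2l// expR_ge0.
exact: le_trans (softplus_mono (ler_norm t)) H.
Qed.

End softplus.

Section weight.
Variables (R : realType) (phi : R -> R) (delta : R).
Hypothesis sphi : smooth phi.
Hypothesis phi_gt0 : forall t, 0 < phi t.
Hypothesis delta0 : 0 < delta.
Hypothesis phiE : forall t, 1 < `|t| -> phi t = expR (- (delta * `|t|)).

Lemma smooth_continuous (g : R -> R) : smooth g -> continuous g.
Proof. by move=> sg x; apply: differentiable_continuous; exact: (sg [::] x). Qed.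

Lemma smooth_second_derivative (g g1 g2 : R -> R) : smooth g ->
  (forall s, is_derive (s : R) (1 : R) g (g1 s)) ->
  (forall s, is_derive (s : R) (1 : R) g1 (g2 s)) -> smooth g2.
Proof.
move=> sg dg dg1 vs x.
have -> : g2 = iter_derive [:: (1 : R); (1 : R)] g.
  apply/funext => s; rewrite /iter_derive /= -(@derive_val _ _ _ _ _ _ _ (dg1 s)).
  congr ('D_1 _ s); apply/funext => r; exact/esym/derive_val.
rewrite /iter_derive -foldr_cat; exact: sg.
Qed.

(** Compactness of [-1, 1] handles the range where [phi] is not explicit. The upper bound controls
    the integral of [phi] times a test function; the lower bound lets [phi] dominate the bump at
    height 0. *)
Lemma weight_bounds : exists c C : R, [/\ 0 < c, 0 < C &
  forall t, c * expR (- (delta * `|t|)) <= phi t <= C * expR (- (delta * `|t|))].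
Proof.
have cphi : {within `[-1, 1], continuous phi}.
  by apply: continuous_subspaceT; exact: smooth_continuous.
have N1 : (-1 : R) <= 1 by rewrite (@le_trans _ _ 0)// lerN10.
have [a _ Ha] := EVT_max N1 cphi.
have [b _ Hb] := EVT_min N1 cphi.
pose C := Num.max 1 (phi a * expR delta).
pose c := Num.min 1 (phi b).
exists c, C; split; [by rewrite lt_min ltr01 phi_gt0|by rewrite lt_max ltr01|].
move=> t; have e0 := expR_gt0 (- (delta * `|t|)).
have [t1|t1] := leP `|t| 1; last first.
  rewrite (phiE t1) -{2 3}[expR _]mul1r !ler_pM2r// /c /C.
  by rewrite ge_min lexx le_max lexx.
have tI : t \in `[-1, 1] by rewrite in_itv/= -ler_norml.
apply/andP; split.
  apply: (@le_trans _ _ (phi b)); last exact: Hb.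
  apply: (@le_trans _ _ (phi b * expR (- (delta * `|t|)))).
    by rewrite ler_pM2r// /c ge_min lexx orbT.
  apply: ler_piMr; first exact: ltW.
  by rewrite expR_le1 oppr_le0 mulr_ge0// ltW.
apply: le_trans (Ha _ tI) _.
apply: (@le_trans _ _ (phi a * expR delta * expR (- (delta * `|t|)))); last first.
  by rewrite ler_pM2r// /C le_max lexx orbT.
rewrite -mulrA -expRD; apply: ler_peMr; first exact: ltW.
by rewrite -[leLHS]expR0 ler_expR subr_ge0 ler_piMr// ltW.
Qed.

Lemma continuous_exp_abs (c : R) : continuous (fun t : R => expR (- (c * `|t|))).
Proof.
move=> x; apply: continuous_comp; last exact: continuous_expR.
apply: continuousN; apply: continuousM; first exact: cst_continuous.
exact: norm_continuous.
Qed.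

End weight.

Lemma exp_abs_integral_lty (R : realType) (G : lattice3 R) (c : R) : 0 < c ->
  (\int[dvol G]_p (expR (- (c * `|p.2|)))%:E < +oo)%E.
Proof.
move=> c0; rewrite (@ge0_integral_height R G (fun t : R => (expR (- (c * `|t|)))%:E)).
- by rewrite lte_mul_pinfty ?lee_fin ?torus_volume_ge0 ?integral_exp_abs_lty.
- by apply/measurable_EFinP; apply: continuous_measurable_fun; exact: continuous_exp_abs.
- by move=> t; rewrite lee_fin expR_ge0.
Qed.

Lemma ge0_integralZl_real d (T : measurableType d) (R : realType)
    (mu : {measure set T -> \bar R}) (k : R) (g : T -> R) :
  0 <= k -> measurable_fun [set: T] g -> (forall x, 0 <= g x) ->
  (\int[mu]_x (k * g x)%:E = k%:E * \int[mu]_x (g x)%:E)%E.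
Proof.
move=> k0 mg g0; have mg' : measurable_fun [set: T] (EFin \o g) by exact/measurable_EFinP.
by rewrite -ge0_integralZl// => x _; rewrite lee_fin.
Qed.

Section slab_estimate.
Variables (R : realType) (G : lattice3 R) (L : complex_iso R).
Variables (phi : R -> R) (delta : R).
Hypothesis isoL : cstruct_isometry L.
Hypothesis sphi : smooth phi.
Hypothesis phi_gt0 : forall t, 0 < phi t.
Hypothesis delta0 : 0 < delta.
Hypothesis phiE : forall t, 1 < `|t| -> phi t = expR (- (delta * `|t|)).
Local Notation X := (cylinder G).

Lemma measurable_height (u : R -> R) : continuous u -> measurable_fun [set: X] (fun p : X => u p.2).
Proof.
move=> cu; apply: (@measurableT_comp _ _ _ _ _ _ (u : measurableTypeR R -> R)) measurable_snd.
exact: continuous_measurable_fun.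
Qed.

Lemma slab_estimate : exists2 K : R, 0 < K & forall (B M I s : R) (f : X -> R),
  0 < B -> measurable_fun [set: X] f -> (forall p, 0 <= f p <= M) ->
  dist_laplacian_le L f (fun p => B * phi p.2) ->
  (\int[dvol G]_p (f p * phi p.2)%:E = I%:E)%E ->
  (\int[dvol G]_p (f p * \1_(slab (s - 1) (s + 1)) p)%:E <= (K * (B + I))%:E)%E.
Proof.
have [c [C1 [c0 C10 phib]]] := weight_bounds sphi phi_gt0 delta0 phiE.
have [C C0 HC] := @cutoff_height R.
(* Half of the decay of [phi] pays for the linear growth of [u], see [ule] below; what remains is
   integrable, with an integral that does not depend on [s]. *)
pose J := fine (\int[dvol G]_p (expR (- (delta / 2 * `|p.2|)))%:E)%E.
have JE : (\int[dvol G]_p (expR (- (delta / 2 * `|p.2|)))%:E = J%:E)%E.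
  rewrite fineK// ge0_fin_numE ?exp_abs_integral_lty ?divr_gt0//.
  by apply: integral_ge0 => p _; rewrite lee_fin expR_ge0.
have J0 : 0 <= J by rewrite fine_ge0// integral_ge0// => p _; rewrite lee_fin expR_ge0.
pose m0 := delta * expR (- delta) / (1 + expR delta) ^+ 2.
have E0 : 0 < 1 + expR delta by rewrite addr_gt0// expR_gt0.
have m00 : 0 < m0 by rewrite divr_gt0 ?mulr_gt0 ?expR_gt0 ?exprn_gt0.
have a0 : 0 <= C1 * (3 / delta) * J.
  apply: mulr_ge0 => //; apply: mulr_ge0; first exact: ltW.
  by rewrite divr_ge0// ltW.
have a1 : 0 <= delta / (2 * c).
  by apply: divr_ge0; [exact: ltW|apply: mulr_ge0 => //; exact: ltW].
(* The coefficients of [B] and [I] in [key] below, divided by [m0 / 2]; the added 1 makes [K]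
   positive. *)
pose K := 2 / m0 * (C1 * (3 / delta) * J + delta / (2 * c) + 1).
have K0 : 0 < K.
  apply: mulr_gt0; first by rewrite divr_gt0.
  by apply: ltr_wpDl => //; apply: addr_ge0.
exists K => // B M I s f B0 mf fM dle IE.
have f0 p : 0 <= f p by have /andP[] := fM p.
have M0 : 0 <= M by have /andP[h1 h2] := fM point; exact: le_trans h2.
(* Reflecting the height according to the sign of [s] lets one formula for [u] treat both ends of
   the cylinder: the bump at height [s] becomes a bump at [tau >= 0]. *)
pose sg : R := if 0 <= s then 1 else -1.
have sg2 : sg * sg = 1 by rewrite /sg; case: ifP => _; rewrite ?mulr1 ?mulrNN ?mulr1.
have sgn t : `|sg * t| = `|t| by rewrite /sg; case: ifP => _; rewrite ?mul1r ?mulN1r ?normrN.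
have sgs : sg * s = `|s|.
  by rewrite /sg; case: ifPn; rewrite -?ltNge => s0; [rewrite mul1r ger0_norm|rewrite mulN1r ltr0_norm].
pose tau := `|s|; have tau0 : 0 <= tau by exact: normr_ge0.
pose u t := softplus delta (sg * t + 0) - softplus delta (sg * t + - tau).
pose u1 t := (sigmoid delta (sg * t + 0) - sigmoid delta (sg * t + - tau)) * sg.
pose u2 t := sigmoid' delta (sg * t + 0) - sigmoid' delta (sg * t + - tau).
have du (t : R) : is_derive t (1 : R) u (u1 t).
  have H := is_deriveB
    (@is_derive_comp_affine R (softplus delta) _ sg 0 t (is_derive_softplus delta0 _))
    (@is_derive_comp_affine R (softplus delta) _ sg (- tau) t (is_derive_softplus delta0 _)).
  by apply: is_derive_eq H _; rewrite -mulrBl.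
have du1 (t : R) : is_derive t (1 : R) u1 (u2 t).
  have H := is_deriveZ sg (is_deriveB
    (@is_derive_comp_affine R (sigmoid delta) _ sg 0 t (is_derive_sigmoid delta _))
    (@is_derive_comp_affine R (sigmoid delta) _ sg (- tau) t (is_derive_sigmoid delta _))).
  rewrite (_ : u1 = sg \*: (fun t => sigmoid delta (sg * t + 0) - sigmoid delta (sg * t + - tau))); last first.
    by apply/funext => r; rewrite /u1 mulrC.
  apply: is_derive_eq H _; rewrite /GRing.scale/= -mulrBl mulrCA sg2 mulr1 //.
have su : smooth u.
  apply/smoothP => n; apply: CkD; last apply: CkN.
    by apply: (@Ck_comp _ n R (fun t => sg * t + 0)); [exact: Ck_softplus|exact: Ck_affine].
  by apply: (@Ck_comp _ n R (fun t => sg * t + - tau)); [exact: Ck_softplus|exact: Ck_affine].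
have u0 t : 0 <= u t.
  by rewrite subr_ge0; apply: softplus_mono => //; rewrite lerD2l oppr_le0.
(* Two bounds with different roles: this one is constant in [t] and enters the cutoff error, where
   dependence on [s] is harmless; the next one grows with [t] but is uniform in [s], as the integral
   against [phi] requires. *)
have utau t : u t <= tau.
  by have := softplus_shift_le delta0 (sg * t) tau0; rewrite /u addr0.
have ule t : u t <= 3 / delta * expR (delta / 2 * `|t|).
  apply: (@le_trans _ _ (`|t| + delta^-1)).
    rewrite -(sgn t); apply: le_trans (softplus_le delta0 (sg * t)).
    by rewrite /u !addr0 gerBl softplus_ge0.
  have := expR_ge1Dx (delta / 2 * `|t|); have := expR_gt0 (delta / 2 * `|t|).
  move: (expR _) => y y0 Hy.
  rewrite (_ : `|t| = 2 / delta * (delta / 2 * `|t|)); last by field; rewrite gt_eqF.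
  move: (delta / 2 * `|t|) Hy => z Hy.
  rewrite (_ : 2 / delta * z + delta^-1 = (2 * z + 1) / delta); last by ring.
  rewrite (_ : 3 / delta * y = (3 * y) / delta); last by ring.
  rewrite ler_wpM2r ?invr_ge0 ?(ltW delta0)//; lra.
(* The slope is exponentially small beyond [tau]; e^x >= x reduces this to 1/n. The cutoff error is
   then O(n^-2) on a slab of height 4n, hence negligible. *)
have u1le n t : 0 < n -> n <= `|t| -> `|u1 t| <= expR (delta * tau) / delta / n.
  move=> n0 nt.
  have sg1 : `|sg| = 1 by have := sgn 1; rewrite mulr1 normr1.
  have D0 : 0 <= sigmoid delta (sg * t + 0) - sigmoid delta (sg * t + - tau).
    by rewrite subr_ge0; apply: sigmoid_mono => //; rewrite lerD2l oppr_le0.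
  rewrite /u1 normrM sg1 mulr1 (ger0_norm D0).
  apply: (@le_trans _ _ (expR (delta * tau) * expR (- (delta * `|t|)))).
    rewrite -(sgn t) addr0; move: (sg * t) => x.
    have [x0|x0] := leP 0 x.
      apply: (@le_trans _ _ (1 - sigmoid delta (x + - tau))).
        by rewrite lerD2r sigmoid_le1.
      apply: le_trans (sigmoid_ge _ _) _ => //.
      by rewrite -expRD ler_expR (ger0_norm x0) mulrBr opprB.
    apply: (@le_trans _ _ (sigmoid delta x)).
      by rewrite gerBl sigmoid_ge0.
    apply: le_trans (sigmoid_le delta x) _.
    by rewrite (ltr0_norm x0) mulrN opprK ler_peMl ?expR_ge0// -[leLHS]expR0 ler_expR mulr_ge0// ltW.
  rewrite -!mulrA ler_wpM2l ?expR_ge0// -invfM expRN lef_pV2 ?posrE ?expR_gt0 ?mulr_gt0//.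
  have := expR_ge1Dx (delta * `|t|); apply: le_trans.
  by apply: (@le_trans _ _ (delta * `|t|)); [rewrite ler_wpM2l// ltW|rewrite lerDr].
(* The estimate with cutoff at height [n]. The last term carries all the dependence on [s] and [M]
   and vanishes in the limit. The condition on [n] makes the cutoff equal to 1 on the slab around
   [s]. *)
have key (n : nat) : tau + 1 < n%:R ->
  ((m0 / 2)%:E * \int[dvol G]_p (f p * \1_(slab (s - 1) (s + 1)) p)%:E <=
   (B * C1 * (3 / delta) * J + delta / (2 * c) * I +
     4 * C * (expR (delta * tau) / delta + tau) * M * torus_volume G / n%:R)%:E)%E.
  move=> tn; pose nn : R := n%:R.
  have n0 : 0 < nn by apply: lt_trans tn; rewrite ltr_wpDl.
  have [chi1 [chi2 [schi dchi dchi1 err_in err_out]]] := HC u u1 u2 nn su n0 du du1.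
  pose k t : R := cutoff (t ^+ 2 / nn ^+ 2).
  pose kappa := C * (expR (delta * tau) / delta + tau).
  have kappa0 : 0 <= kappa.
    apply: mulr_ge0; first exact: ltW.
    by apply: addr_ge0 => //; apply: divr_ge0; [exact: expR_ge0|exact: ltW].
  have nn2 : 0 < nn ^+ 2 by rewrite exprn_gt0.
  have nn0 : 0 <= 2 * nn by apply: mulr_ge0 => //; exact: ltW.
  have kn0 : 0 <= kappa / nn ^+ 2 by apply: divr_ge0 => //; exact: ltW.
  have err t : `|chi2 t - u2 t * k t| <= kappa / nn ^+ 2.
    have [tI|] := boolP (nn <= `|t| <= 2 * nn).
      apply: le_trans (err_in t tI) _; rewrite /kappa -mulrA.
      apply: ler_wpM2l; first exact: ltW.
      rewrite mulrDl; apply: lerD.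
        rewrite expr2 invfM mulrA; apply: ler_wpM2r; first by rewrite invr_ge0 ltW.
        by apply: u1le => //; have /andP[] := tI.
      apply: ler_wpM2r; first by rewrite invr_ge0 ltW.
      by rewrite (ger0_norm (u0 t)); exact: utau.
    rewrite negb_and -!ltNge => /orP/err_out ->.
    by rewrite subrr normr0.
  have err0 t : 2 * nn < `|t| -> chi2 t = 0.
    move=> t2n; rewrite (err_out t (or_intror t2n)) cutoff0 ?mulr0//.
    rewrite ler_pdivlMr// -(real_normK (num_real t)) (_ : 4 * nn ^+ 2 = (2 * nn) ^+ 2); last by ring.
    by apply: lerXn2r; rewrite ?nnegrE//; exact: ltW.
  pose chi (p : X) := u p.2 * cutoff (p.2 ^+ 2 / nn ^+ 2).
  have lapE (p : X) : laplacianX L chi p = - 2^-1 * chi2 p.2.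
    exact: (laplacianX_height isoL p schi dchi dchi1).
  have k0 t : 0 <= k t by exact: cutoff_ge0.
  have k1 t : k t <= 1 by exact: cutoff_le1.
  have chi_ge0 (p : X) : 0 <= chi p by apply: mulr_ge0; [exact: u0|exact: k0].
  have tchi : test_function chi.
    apply: (@test_function_of_support R G chi (2 * nn)).
      exact: (smooth_height G schi).
    move=> p p2; rewrite /chi cutoff0 ?mulr0//.
    rewrite ler_pdivlMr// -(real_normK (num_real p.2)) (_ : 4 * nn ^+ 2 = (2 * nn) ^+ 2); last by ring.
    by apply: lerXn2r; rewrite ?nnegrE//; exact: ltW.
  have mchi2 : measurable_fun [set: X] (fun p : X => chi2 p.2).
    apply: measurable_height; apply: smooth_continuous.
    exact: smooth_second_derivative schi dchi dchi1.
  have mlap : measurable_fun [set: X] (laplacianX L chi).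
    rewrite (_ : laplacianX L chi = fun p => - 2^-1 * chi2 p.2); last exact/funext.
    by apply: measurable_funM.
  have s_le x : sigmoid' delta x <= delta.
    apply: le_trans (sigmoid'_le delta0 x) _; apply: ler_piMr; first exact: ltW.
    by rewrite expR_le1 oppr_le0; apply: mulr_ge0 => //; exact: ltW.
  have s_ge x := sigmoid'_ge0 delta0 x.
  have lapK (p : X) : `|laplacianX L chi p| <= delta + kappa / nn ^+ 2.
    rewrite lapE normrM (_ : `|- 2^-1| = 2^-1 :> R); last by rewrite normrN ger0_norm.
    apply: (@le_trans _ _ (2^-1 * (2 * delta + kappa / nn ^+ 2))); last by lra.
    apply: ler_wpM2l; first by rewrite invr_ge0.
    rewrite -[chi2 _](subrK (u2 p.2 * k p.2)) addrC.
    apply: le_trans (ler_normD _ _) _; apply: lerD; last exact: err.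
    rewrite normrM (ger0_norm (k0 _)); apply: (@le_trans _ _ `|u2 p.2|).
      by apply: ler_piMr.
    rewrite /u2 ler_norml.
    have := s_ge (sg * p.2 + 0); have := s_ge (sg * p.2 + - tau).
    have := s_le (sg * p.2 + 0); have := s_le (sg * p.2 + - tau).
    move: (sigmoid' _ _) (sigmoid' _ _) => x y *; apply/andP; split; lra.
  pose Sl : set X := slab (- (2 * nn)) (2 * nn).
  have mSl : measurable_fun [set: X] (\1_Sl : X -> R).
    by apply: measurable_indic; exact: measurable_slab.
  have mS : measurable_fun [set: X] (\1_(slab (s - 1) (s + 1)) : X -> R).
    by apply: measurable_indic; exact: measurable_slab.
  pose e1 (p : X) : R := sigmoid' delta (sg * p.2 + 0).
  have me1 : measurable_fun [set: X] e1.
    apply: (@measurable_height (fun t : R => sigmoid' delta (sg * t + 0))).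
    have ss : smooth (sigmoid' delta).
      apply: (@smooth_second_derivative _ (softplus delta) (sigmoid delta)).
      - by apply/smoothP => m; exact: Ck_softplus.
      - exact: is_derive_softplus.
      - exact: is_derive_sigmoid.
    apply: smooth_continuous; apply/smoothP => m.
    apply: (@Ck_comp _ m R (fun t => sg * t + 0)); last exact: Ck_affine.
    by move: m; exact/smoothP.
  (* The Laplacian is [- 2^-1 * chi2], and [u2] is the bump at 0 minus the bump at [tau]. The first
     bump and the cutoff error go into [E]; the second, at least [m0] on the slab by [sigmoid'_ge],
     yields [A]. *)
  pose E (p : X) : R := 2^-1 * e1 p + kappa / nn ^+ 2 * \1_Sl p.
  pose A (p : X) : R := m0 / 2 * \1_(slab (s - 1) (s + 1)) p.
  have mE : measurable_fun [set: X] E.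
    by apply: measurable_funD; apply: measurable_funM.
  have mA : measurable_fun [set: X] A by apply: measurable_funM.
  have E_ge0 p : 0 <= E p.
    apply: addr_ge0; apply: mulr_ge0 => //; rewrite ?invr_ge0// ?indicE ?ler0n//.
    exact: s_ge.
  have A_ge0 p : 0 <= A p.
    by apply: mulr_ge0; [apply: divr_ge0 => //; exact: ltW|rewrite indicE ler0n].
  have AE p : A p <= laplacianX L chi p + E p.
    rewrite lapE /A /E /e1.
    have errp : chi2 p.2 - u2 p.2 * k p.2 <= kappa / nn ^+ 2 * \1_Sl p.
      rewrite indicE; have [pS|pS] := boolP (p \in Sl).
        by rewrite mulr1; apply: le_trans (ler_norm _) (err _).
      have p2 : 2 * nn < `|p.2|.
        rewrite ltNge; apply: contra pS; rewrite ler_norml => h; exact/mem_set.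
      rewrite mulr0 (err0 _ p2) /k cutoff0 ?mulr0 ?subrr//.
      rewrite ler_pdivlMr// -(real_normK (num_real p.2)) (_ : 4 * nn ^+ 2 = (2 * nn) ^+ 2); last by ring.
      by apply: lerXn2r; rewrite ?nnegrE//; exact: ltW.
    have kn : 0 <= kappa / nn ^+ 2 * \1_Sl p by apply: mulr_ge0 => //; rewrite indicE ler0n.
    have s1 := s_ge (sg * p.2 + 0).
    have s2 := s_ge (sg * p.2 + - tau).
    have h1 := mulr_ge0 s2 (k0 p.2).
    have h2 : sigmoid' delta (sg * p.2 + 0) * k p.2 <= sigmoid' delta (sg * p.2 + 0).
      by apply: ler_piMr.
    have h3 : m0 / 2 * \1_(slab (s - 1) (s + 1)) p <= 2^-1 * (sigmoid' delta (sg * p.2 + - tau) * k p.2).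
      rewrite indicE; have [pS|pS] := boolP (p \in slab (s - 1) (s + 1)); last first.
        by rewrite mulr0; apply: mulr_ge0; rewrite ?invr_ge0.
      have /set_mem/= ps : p \in slab (s - 1) (s + 1) by [].
      have ps1 : `|p.2 - s| <= 1 by rewrite ler_distl.
      have kp1 : k p.2 = 1.
        rewrite /k cutoff1// ler_pdivrMr// mul1r -(real_normK (num_real p.2)).
        apply: lerXn2r; rewrite ?nnegrE ?normr_ge0 ?(ltW n0)//.
        apply: le_trans (ltW tn); rewrite -[p.2](subrK s).
        by apply: le_trans (ler_normD _ _) _; rewrite addrC lerD2l.
      rewrite kp1 !mulr1 [2^-1 * _]mulrC; apply: ler_wpM2r; first by rewrite invr_ge0.
      apply: sigmoid'_ge => //.
      by rewrite /tau -sgs -mulrBr sgn.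
    have aux (i a b x z r : R) : z - (a - b) <= r -> i <= 2^-1 * b -> a <= x -> 0 <= r ->
        i <= - 2^-1 * z + (2^-1 * x + r) by lra.
    apply: aux h3 h2 kn; by rewrite -mulrBl.
  have lap0 (p : X) : 2 * nn < `|p.2| -> laplacianX L chi p = 0.
    by move=> p2; rewrite lapE err0// mulr0.
  have h_ge0 (p : X) : 0 <= B * phi p.2 by apply: mulr_ge0; exact: ltW.
  have T := @test_inequality R G L f chi A E (fun p => B * phi p.2) M _ (2 * nn)
    mf fM tchi chi_ge0 mlap lapK lap0 mA mE h_ge0 A_ge0 E_ge0 AE dle.
  have TA : (\int[dvol G]_p (f p * A p)%:E =
      (m0 / 2)%:E * \int[dvol G]_p (f p * \1_(slab (s - 1) (s + 1)) p)%:E)%E.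
    rewrite -ge0_integralZl_real.
    - by apply: eq_integral => p _; congr EFin; rewrite /A mulrCA.
    - by apply: divr_ge0 => //; exact: ltW.
    - exact: measurable_funM.
    - by move=> p; apply: mulr_ge0; rewrite ?f0// indicE ler0n.
  pose w (p : X) : R := expR (- (delta / 2 * `|p.2|)).
  have w_ge0 p : 0 <= w p by exact: expR_ge0.
  have mw : measurable_fun [set: X] w.
    by apply: (@measurable_height (fun t : R => expR (- (delta / 2 * `|t|)))); exact: continuous_exp_abs.
  rewrite -TA; apply: le_trans T _; rewrite -[X in (_ <= X%:E)%E]addrA EFinD; apply: leeD.
  - rewrite EFinM -JE -(@ge0_integralZl_real _ _ _ (dvol G) _ w) => //.
    + apply: ge0_le_integral => //.
      * by move=> p _; rewrite lee_fin; apply: mulr_ge0; [exact: h_ge0|exact: chi_ge0].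
      * apply/measurable_EFinP; apply: measurable_funM.
          by apply: measurable_funM => //; apply: measurable_height; exact: smooth_continuous.
        apply: (@measurable_height (fun t : R => u t * cutoff (t ^+ 2 / nn ^+ 2))).
        exact: smooth_continuous.
      * by apply/measurable_EFinP; exact: measurable_funM.
      move=> p _; rewrite lee_fin /w.
      apply: (@le_trans _ _ ((B * (C1 * expR (- (delta * `|p.2|)))) * (3 / delta * expR (delta / 2 * `|p.2|)))).
        apply: ler_pM; [exact: h_ge0|exact: chi_ge0| |].
          by apply: ler_wpM2l; [exact: ltW|have /andP[] := phib p.2].
        apply: (@le_trans _ _ (u p.2)); last exact: ule.
        by apply: ler_piMr; [exact: u0|exact: cutoff_le1].
      rewrite (_ : - (delta / 2 * `|p.2|) = - (delta * `|p.2|) + delta / 2 * `|p.2|); last by field.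
      by rewrite expRD le_eqVlt; apply/orP; left; apply/eqP; ring.
    + apply: mulr_ge0; first by apply: mulr_ge0; exact: ltW.
      by apply: divr_ge0 => //; exact: ltW.
  - have mphi : measurable_fun [set: X] (fun p : X => phi p.2).
      by apply: measurable_height; exact: smooth_continuous.
    have mfphi : measurable_fun [set: X] (fun p => f p * phi p.2) by exact: measurable_funM.
    pose c2 := delta / (2 * c).
    pose k3 := kappa / nn ^+ 2 * M.
    have k30 : 0 <= k3 by apply: mulr_ge0.
    apply: (@le_trans _ _ (\int[dvol G]_p ((c2 * (f p * phi p.2))%:E + (k3 * \1_Sl p)%:E))%E).
      apply: ge0_le_integral => //.
      * by move=> p _; rewrite lee_fin; apply: mulr_ge0; [exact: f0|exact: E_ge0].
      * by apply/measurable_EFinP; exact: measurable_funM.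
      * by apply: emeasurable_funD; apply/measurable_EFinP; exact: measurable_funM.
      move=> p _; rewrite -EFinD lee_fin /E mulrDr; apply: lerD.
        rewrite [c2 * _]mulrCA; apply: ler_wpM2l; first exact: f0.
        apply: (@le_trans _ _ (2^-1 * (delta * expR (- (delta * `|p.2|))))).
          apply: ler_wpM2l; first by rewrite invr_ge0.
          by rewrite /e1 addr0 -[in leRHS](sgn p.2); exact: sigmoid'_le.
        rewrite (_ : 2^-1 * _ = c2 * (c * expR (- (delta * `|p.2|)))); last first.
          by rewrite /c2; field; rewrite gt_eqF.
        by apply: ler_wpM2l => //; have /andP[] := phib p.2.
      rewrite mulrCA /k3 -mulrA; apply: ler_wpM2l => //.
      by apply: ler_wpM2r; [rewrite indicE ler0n|have /andP[] := fM p].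
    rewrite ge0_integralD//; last 4 first.
    * by move=> p _; rewrite lee_fin; apply: mulr_ge0 => //; apply: mulr_ge0; [exact: f0|exact: ltW].
    * by apply/measurable_EFinP; exact: measurable_funM.
    * by move=> p _; rewrite lee_fin; apply: mulr_ge0 => //; rewrite indicE ler0n.
    * by apply/measurable_EFinP; exact: measurable_funM.
    rewrite !ge0_integralZl_real//; last by move=> p; apply: mulr_ge0; [exact: f0|exact: ltW].
    rewrite IE EFinD EFinM leeD2lE// integral_indic//; last exact: measurable_slab.
    rewrite setIT dvol_slab; last by lra.
    rewrite -EFinM lee_fin le_eqVlt; apply/orP; left; apply/eqP.
    by rewrite /k3 /kappa -/nn; field; rewrite !gt_eqF.
have S0 : (0 <= \int[dvol G]_p (f p * \1_(slab (s - 1) (s + 1)) p)%:E)%E.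
  by apply: integral_ge0 => p _; rewrite lee_fin; apply: mulr_ge0; rewrite ?f0// indicE ler0n.
have mS : measurable_fun [set: X] (fun p : X => \1_(slab (s - 1) (s + 1)) p : R).
  by apply: measurable_indic; exact: measurable_slab.
have {}key : ((m0 / 2)%:E * \int[dvol G]_p (f p * \1_(slab (s - 1) (s + 1)) p)%:E <=
   (B * C1 * (3 / delta) * J + delta / (2 * c) * I)%:E)%E.
  apply/lee_addgt0Pr => e e0.
  set b := 4 * C * (expR (delta * tau) / delta + tau) * M * torus_volume G in key.
  have b0 : 0 <= b.
    apply: mulr_ge0; last exact: torus_volume_ge0.
    apply: mulr_ge0 => //; apply: mulr_ge0; first by apply: mulr_ge0 => //; exact: ltW.
    by apply: addr_ge0 => //; apply: divr_ge0; [exact: expR_ge0|exact: ltW].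
  pose n := (Num.truncn (tau + 1 + b / e)).+1.
  have nB : tau + 1 + b / e < n%:R by exact: truncnS_gt.
  have be0 : 0 <= b / e by rewrite divr_ge0// ltW.
  have nt : tau + 1 < n%:R by rewrite (le_lt_trans _ nB)// lerDl.
  have n0 : 0 < n%:R :> R by rewrite ltr0n.
  apply: le_trans (key n nt) _; rewrite -EFinD lee_fin lerD2l.
  rewrite ler_pdivrMr// mulrC -ler_pdivrMr//.
  by apply: le_trans (ltW nB); rewrite lerDr addr_ge0.
have I0 : 0 <= I.
  by rewrite -lee_fin -IE; apply: integral_ge0 => p _; rewrite lee_fin; apply: mulr_ge0 => //; exact: ltW.
move: key; rewrite -lee_pdivlMl; last exact: divr_gt0.
move=> key; apply: le_trans key _.
rewrite -EFinM lee_fin (_ : (m0 / 2)^-1 = 2 / m0); last by rewrite invf_div.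
rewrite /K -[leRHS]mulrA; apply: ler_wpM2l; first by apply: divr_ge0 => //; exact: ltW.
rewrite (_ : B * C1 * (3 / delta) * J = B * (C1 * (3 / delta) * J)); last by rewrite !mulrA.
move: (C1 * _ * _) (delta / _) a0 a1 => a a' a0 a1.
have := mulr_ge0 a0 I0; have := mulr_ge0 a1 (ltW B0).
by rewrite !mulrDl !mulrDr mul1r [B * a]mulrC; lra.
Qed.

End slab_estimate.

(** * The mass of a small cube *)

Section newton_kernel.
Variable R : realType.
Local Notation mu := (@vol4 R).

Lemma sqdist_cube_le (P y : E4 R) r : cube P r y -> sqdist P y <= 4 * r ^+ 2.
Proof.
move=> /cubeP[h0 h1 h2 h3]; rewrite sqdistE.
have sq (z : R) : `|z| < r -> z ^+ 2 <= r ^+ 2.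
  move=> zr; rewrite -(real_normK (num_real z)); apply: lerXn2r; rewrite ?nnegrE//.
  - exact: le_trans (ltW zr).
  - exact: ltW.
by move: (sq _ h0) (sq _ h1) (sq _ h2) (sq _ h3); lra.
Qed.

Lemma sqdist_notin_cube (P y : E4 R) r : 0 <= r -> ~ cube P r y -> r ^+ 2 <= sqdist P y.
Proof.
move=> r0 nc; rewrite leNgt; apply/negP => sr; apply: nc; apply/cubeP.
have sq (z : R) : z ^+ 2 <= sqdist P y -> `|z| < r.
  move=> zr; rewrite ltNge; apply/negP => rz.
  have : r ^+ 2 <= z ^+ 2.
    by rewrite -(real_normK (num_real z)); apply: lerXn2r; rewrite ?nnegrE.
  by move=> rz2; have := lt_le_trans sr (le_trans rz2 zr); rewrite ltxx.
have := sqr_ge0 (y.1.1.1 - P.1.1.1); have := sqr_ge0 (y.1.1.2 - P.1.1.2).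
have := sqr_ge0 (y.1.2 - P.1.2); have := sqr_ge0 (y.2 - P.2).
by move=> a b c d; split; apply: sq; rewrite sqdistE; lra.
Qed.

Lemma measurable_sqdist P : measurable_fun [set: mE4 R] (fun x : mE4 R => sqdist P x).
Proof.
rewrite (_ : (fun x : mE4 R => sqdist P x) = fun x => ((coords x)`_0 - P.1.1.1) ^+ 2 +
  ((coords x)`_1 - P.1.1.2) ^+ 2 + ((coords x)`_2 - P.1.2) ^+ 2 + ((coords x)`_3 - P.2) ^+ 2); last first.
  by apply/funext => x; rewrite sqdistE.
have m i c : measurable_fun [set: mE4 R] (fun x : mE4 R => ((coords x)`_i - c) ^+ 2).
  by apply: measurable_funX; apply: measurable_funB => //; exact: measurable_coord.
by apply: measurable_funD => //; apply: measurable_funD => //; exact: measurable_funD.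
Qed.

Lemma measurable_invD_sq (e : R) : 0 < e ->
  measurable_fun [set: R] (fun s : R => (`|s| + e ^+ 2)^-1).
Proof.
move=> e0; apply: continuous_measurable_fun => x.
apply: cvgV; first by rewrite gt_eqF// ltr_wpDl// exprn_gt0.
by apply: continuousD; [exact: norm_continuous|exact: cst_continuous].
Qed.

Definition dyadic_radius (j : nat) : R := 2^-1 ^+ j.

Lemma dyadic_radius_gt0 j : 0 < dyadic_radius j.
Proof. by rewrite exprn_gt0. Qed.

Lemma dyadic_radiusS j : dyadic_radius j.+1 = 2^-1 * dyadic_radius j.
Proof. by rewrite /dyadic_radius exprS. Qed.

(** These layers replace polar coordinates: a point of the cube of radius r = 2^-j outside the cube
    of radius r/2 has squared distance at least r^2/4 from [P], so the kernel is at most 4/r^2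
    there. *)
Definition dyadic_layer (P : E4 R) j (y : mE4 R) : R :=
  4 / dyadic_radius j ^+ 2 * \1_(cube P (dyadic_radius j)) y.

Lemma dyadic_layer_ge0 P j y : 0 <= dyadic_layer P j y.
Proof.
apply: mulr_ge0; last by rewrite indicE ler0n.
by apply: divr_ge0 => //; apply: exprn_ge0; exact/ltW/dyadic_radius_gt0.
Qed.

Lemma newton_kernel_dyadic (P y : E4 R) (e : R) n : 0 < e -> cube P 1 y ->
  cube P (dyadic_radius n) y \/
  (sqdist P y + e ^+ 2)^-1 <= \sum_(j < n) dyadic_layer P j y.
Proof.
move=> e0 y1; elim: n => [|n [IH|IH]]; first by left; rewrite /dyadic_radius expr0.
- have [yc|yc] := pselect (cube P (dyadic_radius n.+1) y); first by left.
  right; rewrite big_ord_recr/=.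
  have r0 := dyadic_radius_gt0 n.+1.
  have Sr := sqdist_notin_cube (ltW r0) yc.
  apply: (@le_trans _ _ (dyadic_layer P n y)); last first.
    by rewrite lerDr; apply: sumr_ge0 => i _; exact: dyadic_layer_ge0.
  rewrite /dyadic_layer indicE mem_set// mulr1.
  have -> : 4 / dyadic_radius n ^+ 2 = (dyadic_radius n.+1 ^+ 2)^-1.
    by rewrite dyadic_radiusS; field; rewrite gt_eqF// dyadic_radius_gt0.
  have r20 : 0 < dyadic_radius n.+1 ^+ 2 by rewrite exprn_gt0.
  have e20 : 0 < e ^+ 2 by rewrite exprn_gt0.
  rewrite lef_pV2 ?posrE//; first by apply: le_trans Sr _; rewrite lerDl ltW.
  by rewrite ltr_wpDl// sqdist_ge0.
- by right; rewrite big_ord_recr/=; apply: le_trans IH _; rewrite lerDl dyadic_layer_ge0.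
Qed.

(** Layer [j] has integral (4/r^2)(2r)^4 = 64 r^2 = 64 * 4^-j, so the total stays below 256/3. The
    larger constant 128 gives a closed form that goes through the induction. *)
Lemma integral_dyadic_layers P n :
  (\int[mu]_y (\sum_(j < n) dyadic_layer P j y)%:E <= (128 * (1 - 4^-1 ^+ n))%:E)%E.
Proof.
have ml j : measurable_fun [set: mE4 R] (dyadic_layer P j).
  by apply: measurable_funM => //; apply: measurable_indic; exact: measurable_cube.
elim: n => [|n IH].
  under eq_integral do rewrite big_ord0.
  by rewrite integral0 expr0 subrr mulr0.
under eq_integral do rewrite big_ord_recr/= EFinD.
rewrite ge0_integralD//; last 4 first.
- by move=> y _; rewrite lee_fin; apply: sumr_ge0 => i _; exact: dyadic_layer_ge0.
- by apply/measurable_EFinP; apply: measurable_sum => j; exact: ml.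
- by move=> y _; rewrite lee_fin dyadic_layer_ge0.
- by apply/measurable_EFinP; exact: ml.
apply: (@le_trans _ _ ((128 * (1 - 4^-1 ^+ n))%:E + (64 * 4^-1 ^+ n)%:E)%E).
  apply: leeD => //; rewrite /dyadic_layer.
  have r0 := dyadic_radius_gt0 n.
  rewrite (ge0_integralZl_real mu (g := \1_(cube P (dyadic_radius n)))); last 3 first.
  - by apply: divr_ge0 => //; apply: exprn_ge0; exact: ltW.
  - by apply: measurable_indic; exact: measurable_cube.
  - by move=> y; rewrite indicE ler0n.
  rewrite integral_indic//; last exact: measurable_cube.
  rewrite setIT [X in (_ * X <= _)%E](vol4_cube P r0) -EFinM lee_fin le_eqVlt; apply/orP; left; apply/eqP.
  have -> : (4^-1 : R) ^+ n = dyadic_radius n ^+ 2.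
    rewrite /dyadic_radius -exprM mulnC exprM; congr (_ ^+ n).
    by rewrite expr2 -invfM -natrM.
  by field; rewrite gt_eqF.
rewrite -EFinD lee_fin exprS; have : 0 <= (4^-1 : R) ^+ n by rewrite exprn_ge0// invr_ge0.
by move: (_ ^+ n) => z; lra.
Qed.

Lemma newton_kernel_integral (P : E4 R) (e : R) : 0 < e ->
  (\int[mu]_(y in cube P 1) ((sqdist P y + e ^+ 2)^-1)%:E <= 128%:E)%E.
Proof.
move=> e0; have e20 : 0 < e ^+ 2 by rewrite exprn_gt0.
(* The layers need not go below scale [e]: in the cube of radius 2^-J <= e the kernel is at most
   e^-2, which the single layer [J] dominates. The bound 128 holds for every number of layers, so it
   is independent of [e]. *)
have [J HJ] : exists J, dyadic_radius J <= e.
  exists (Num.truncn e^-1).+1; rewrite /dyadic_radius exprVn -[leRHS]invrK.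
  rewrite lef_pV2 ?posrE ?invr_gt0 ?exprn_gt0//.
  apply: ltW; apply: lt_trans (truncnS_gt _) _.
  by rewrite -natrX ltr_nat ltn_expl.
have ms : measurable_fun [set: mE4 R] (fun y : mE4 R => (sqdist P y + e ^+ 2)^-1).
  rewrite (_ : (fun y : mE4 R => _) = (fun s : R => (`|s| + e ^+ 2)^-1) \o (fun y : mE4 R => sqdist P y)).
    by apply: measurableT_comp; [exact: measurable_invD_sq|exact: measurable_sqdist].
  by apply/funext => y /=; rewrite ger0_norm// sqdist_ge0.
have mS : measurable_fun [set: mE4 R] (fun y : mE4 R => \sum_(j < J.+1) dyadic_layer P j y).
  apply: measurable_sum => j.
  by apply: measurable_funM => //; apply: measurable_indic; exact: measurable_cube.
have S0 y : 0 <= \sum_(j < J.+1) dyadic_layer P j y.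
  by apply: sumr_ge0 => i _; exact: dyadic_layer_ge0.
apply: (@le_trans _ _ (\int[mu]_(y in cube P 1) (\sum_(j < J.+1) dyadic_layer P j y)%:E)%E).
  apply: ge0_le_integral => //.
  - exact: measurable_cube.
  - by move=> y _; rewrite lee_fin invr_ge0 addr_ge0 ?sqdist_ge0// ltW.
  - by apply/measurable_EFinP; exact: measurable_funTS.
  - by apply/measurable_EFinP; exact: measurable_funTS.
  move=> y y1; rewrite lee_fin.
  have [yJ|H] := newton_kernel_dyadic J e0 y1; last first.
    by apply: le_trans H _; rewrite big_ord_recr/= lerDl dyadic_layer_ge0.
  rewrite big_ord_recr/=; apply: (@le_trans _ _ (dyadic_layer P J y)); last first.
    by rewrite lerDr; apply: sumr_ge0 => i _; exact: dyadic_layer_ge0.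
  rewrite /dyadic_layer indicE mem_set// mulr1.
  have r0 := dyadic_radius_gt0 J; have r20 : 0 < dyadic_radius J ^+ 2 by rewrite exprn_gt0.
  apply: (@le_trans _ _ (dyadic_radius J ^+ 2)^-1); last first.
    by rewrite ler_peMl ?ler1n// invr_ge0 ltW.
  rewrite lef_pV2 ?posrE//; last by rewrite ltr_wpDl// sqdist_ge0.
  apply: (@le_trans _ _ (e ^+ 2)); last by rewrite lerDr sqdist_ge0.
  by apply: lerXn2r; rewrite ?nnegrE// ltW.
apply: (@le_trans _ _ (\int[mu]_y (\sum_(j < J.+1) dyadic_layer P j y)%:E)%E).
  apply: ge0_subset_integral => //.
  - exact: measurable_cube.
  - by apply/measurable_EFinP.
  - by move=> y _; rewrite lee_fin.
apply: le_trans (integral_dyadic_layers P J.+1) _; rewrite lee_fin.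
have : 0 <= (4^-1 : R) ^+ J.+1 by rewrite exprn_ge0// invr_ge0.
by move: (_ ^+ _) => z; lra.
Qed.

End newton_kernel.

(** * The regularised and truncated Newton kernel *)

Section cut_kernel.
Variables (R : realType) (rho eps : R).
Hypothesis rho0 : 0 < rho.
Hypothesis eps0 : 0 < eps.

(** A function of the squared distance; without cutoff and with [eps = 0] it would be |x|^-2, a
    multiple of the fundamental solution in dimension 4. *)
Definition cut_kernel (s : R) : R := cutoff (s / rho ^+ 2) * (s + eps ^+ 2)^-1.

Definition cut_kernel' (s : R) : R :=
  cutoff' (s / rho ^+ 2) / rho ^+ 2 * (s + eps ^+ 2)^-1 -
  cutoff (s / rho ^+ 2) * (s + eps ^+ 2)^-1 ^+ 2.

Definition cut_kernel'' (s : R) : R :=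
  cutoff'' (s / rho ^+ 2) / rho ^+ 2 / rho ^+ 2 * (s + eps ^+ 2)^-1 -
  2 * (cutoff' (s / rho ^+ 2) / rho ^+ 2) * (s + eps ^+ 2)^-1 ^+ 2 +
  2 * cutoff (s / rho ^+ 2) * (s + eps ^+ 2)^-1 ^+ 3.

Definition cut_laplacian (s : R) : R :=
  - 2^-1 * (4 * s * cut_kernel'' s + 8 * cut_kernel' s).

Let rho2 : 0 < rho ^+ 2. Proof. by rewrite exprn_gt0. Qed.
Let eps2 : 0 < eps ^+ 2. Proof. by rewrite exprn_gt0. Qed.

Lemma is_derive_scaled (g : R -> R) (d s : R) : is_derive (s / rho ^+ 2) (1 : R) g d ->
  is_derive s (1 : R) (fun s : R => g (s / rho ^+ 2)) (d / rho ^+ 2).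
Proof.
move=> dg; have e (t : R) : t / rho ^+ 2 = rho ^- 2 * t + 0 by rewrite addr0 mulrC.
rewrite e in dg; have := is_derive_comp_affine dg.
by rewrite (_ : (fun t : R => _) = (fun t : R => g (t / rho ^+ 2)))//; apply/funext => t; rewrite e.
Qed.

Lemma is_derive_inv_shift (s : R) : - eps ^+ 2 < s ->
  is_derive s (1 : R) (fun s : R => (s + eps ^+ 2)^-1) (- (s + eps ^+ 2)^-1 ^+ 2).
Proof.
move=> s0; have sn0 : s + eps ^+ 2 != 0 by rewrite gt_eqF// -ltrBlDr sub0r.
have d1 : is_derive s (1 : R) (fun s : R => s + eps ^+ 2) 1.
  have := is_deriveD (is_derive_id s (1 : R)) (is_derive_cst (eps ^+ 2) s (1 : R)).
  by rewrite addr0.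
have H := @is_deriveV R _ s 1 1 sn0 d1.
by apply: is_derive_eq H _; rewrite /GRing.scale/= mulr1 exprVn.
Qed.

Lemma is_derive_cut_kernel (s : R) : - eps ^+ 2 < s ->
  is_derive s (1 : R) cut_kernel (cut_kernel' s).
Proof.
move=> s0; have H := is_deriveM (is_derive_scaled (is_derive_cutoff (s / rho ^+ 2))) (is_derive_inv_shift s0).
apply: is_derive_eq H _; rewrite /GRing.scale/= /cut_kernel'.
move: (cutoff (s / rho ^+ 2)) (cutoff' (s / rho ^+ 2)) => a b.
by move: (rho ^- 2) ((s + eps ^+ 2)^-1) => c e; ring.
Qed.

Lemma is_derive_cut_kernel' (s : R) : - eps ^+ 2 < s ->
  is_derive s (1 : R) cut_kernel' (cut_kernel'' s).
Proof.
move=> s0.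
have Hi := is_derive_inv_shift s0.
have H1 := is_deriveM (is_deriveZ (rho ^- 2) (is_derive_scaled (is_derive_cutoff' (s / rho ^+ 2)))) Hi.
have H2 := is_deriveM (is_derive_scaled (is_derive_cutoff (s / rho ^+ 2))) (is_deriveX 2 Hi).
have H := is_deriveB H1 H2.
rewrite (_ : cut_kernel' = (((rho ^- 2 \*: (fun s : R => cutoff' (s / rho ^+ 2))) *
  (fun s : R => (s + eps ^+ 2)^-1)) - ((fun s : R => cutoff (s / rho ^+ 2)) *
  ((fun s : R => (s + eps ^+ 2)^-1) ^+ 2)))); last first.
  apply/funext => t; rewrite /cut_kernel' -[RHS]/(rho ^- 2 * cutoff' (t / rho ^+ 2) *
    (t + eps ^+ 2)^-1 - cutoff (t / rho ^+ 2) * (t + eps ^+ 2)^-1 ^+ 2).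
  by rewrite [rho ^- 2 * _]mulrC.
apply: is_derive_eq H _; rewrite exprfctE /GRing.scale/= /cut_kernel''.
move: (cutoff (s / rho ^+ 2)) (cutoff' (s / rho ^+ 2)) (cutoff'' (s / rho ^+ 2)) => a b c.
by move: (rho ^- 2) ((s + eps ^+ 2)^-1) => e f; rewrite -[e *: b]/(e * b); ring.
Qed.

Lemma cut_kernel_eq0 s : 4 * rho ^+ 2 <= s -> cut_kernel s = 0.
Proof. by move=> s4; rewrite /cut_kernel cutoff0 ?mul0r// ler_pdivlMr. Qed.

(** Separates the Laplacian of the regularised kernel, which is nonnegative, from the terms with
    derivatives of the cutoff, which live at distance of order [rho] and so stay bounded as [eps]
    tends to 0. *)
Lemma cut_laplacianE s : cut_laplacian s =
  cutoff (s / rho ^+ 2) * (4 * (s + eps ^+ 2)^-1 ^+ 2 - 4 * s * (s + eps ^+ 2)^-1 ^+ 3) -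
  (2 * s * (s + eps ^+ 2)^-1 * (cutoff'' (s / rho ^+ 2) / rho ^+ 2 / rho ^+ 2) +
   4 * (cutoff' (s / rho ^+ 2) / rho ^+ 2) * ((s + eps ^+ 2)^-1 - s * (s + eps ^+ 2)^-1 ^+ 2)).
Proof.
rewrite /cut_laplacian /cut_kernel' /cut_kernel''.
move: (cutoff (s / rho ^+ 2)) (cutoff' (s / rho ^+ 2)) (cutoff'' (s / rho ^+ 2)) => a b c.
by move: (rho ^- 2) ((s + eps ^+ 2)^-1) => e f; field.
Qed.

Lemma cut_main_term s : 0 <= s ->
  4 * (s + eps ^+ 2)^-1 ^+ 2 - 4 * s * (s + eps ^+ 2)^-1 ^+ 3 =
  4 * eps ^+ 2 * (s + eps ^+ 2)^-1 ^+ 3.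
Proof.
move=> s0; have h : s + eps ^+ 2 != 0 by rewrite gt_eqF// ltr_wpDl.
by rewrite !exprVn; move: (eps ^+ 2) h => e h; field.
Qed.

Lemma cut_laplacian_inner s : 0 <= s -> s < rho ^+ 2 ->
  cut_laplacian s = 4 * eps ^+ 2 * (s + eps ^+ 2)^-1 ^+ 3.
Proof.
move=> s0 s1; have v1 : s / rho ^+ 2 < 1 by rewrite ltr_pdivrMr// mul1r.
rewrite cut_laplacianE cutoff1 ?ltW// (cutoff'_eq0 (or_introl v1)) (cutoff''_eq0 (or_introl v1)).
by rewrite cut_main_term// !mul0r !mulr0 mul0r addr0 subr0 mul1r.
Qed.

Lemma cut_laplacian_outer s : 4 * rho ^+ 2 < s -> cut_laplacian s = 0.
Proof.
move=> s1; have v1 : 4 < s / rho ^+ 2 by rewrite ltr_pdivlMr.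
rewrite cut_laplacianE cutoff0 ?ltW// (cutoff'_eq0 (or_intror v1)) (cutoff''_eq0 (or_intror v1)).
by rewrite !mul0r !mulr0 mul0r addr0 subr0.
Qed.

(* With [n = 1/(s + eps^2)] one has [s n <= 1] for [s >= 0], and [rho^2 <= s]
   wherever the derivatives of the cutoff do not vanish. *)
Lemma cut_laplacian_bounds (C : R) : 0 < C ->
  (forall s, `|cutoff' s| <= C /\ `|cutoff'' s| <= C) ->
  forall s, 0 <= s ->
   - (6 * C / rho ^+ 2 / rho ^+ 2) <= cut_laplacian s <=
     4 * (eps ^+ 2)^-1 ^+ 2 + 6 * C / rho ^+ 2 / rho ^+ 2.
Proof.
move=> C0 HC s s0.
have h0 : 0 < s + eps ^+ 2 by rewrite ltr_wpDl.
pose n := (s + eps ^+ 2)^-1.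
have n0 : 0 <= n by rewrite invr_ge0 ltW.
have sn0 : 0 <= s * n by apply: mulr_ge0.
have sn1 : s * n <= 1 by rewrite ler_pdivrMr// mul1r lerDl ltW.
have main0 : 0 <= 4 * eps ^+ 2 * n ^+ 3.
  by apply: mulr_ge0; [apply: mulr_ge0 => //; exact: ltW|exact: exprn_ge0].
have main1 : 4 * eps ^+ 2 * n ^+ 3 <= 4 * (eps ^+ 2)^-1 ^+ 2.
  have ne : n <= (eps ^+ 2)^-1 by rewrite lef_pV2 ?posrE// lerDr.
  have en : eps ^+ 2 * n <= 1 by rewrite ler_pdivrMr// mul1r lerDr.
  rewrite (_ : 4 * eps ^+ 2 * n ^+ 3 = 4 * (eps ^+ 2 * n * n ^+ 2)); last by ring.
  apply: ler_wpM2l => //; apply: (@le_trans _ _ (1 * n ^+ 2)).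
    by apply: ler_wpM2r => //; exact: exprn_ge0.
  by rewrite mul1r; apply: lerXn2r; rewrite ?nnegrE// invr_ge0 ltW.
have k0 := cutoff_ge0 (s / rho ^+ 2); have k1 := cutoff_le1 (s / rho ^+ 2).
pose err := 2 * s * n * (cutoff'' (s / rho ^+ 2) / rho ^+ 2 / rho ^+ 2) +
   4 * (cutoff' (s / rho ^+ 2) / rho ^+ 2) * (n - s * n ^+ 2).
have errB : `|err| <= 6 * C / rho ^+ 2 / rho ^+ 2.
  have B0 : 0 <= C / rho ^+ 2 / rho ^+ 2 by apply: divr_ge0; [apply: divr_ge0|]; exact: ltW.
  have [c1 c2] := HC (s / rho ^+ 2).
  have [sr|sr] := ltP s (rho ^+ 2).
    have v1 : s / rho ^+ 2 < 1 by rewrite ltr_pdivrMr// mul1r.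
    rewrite /err (cutoff'_eq0 (or_introl v1)) (cutoff''_eq0 (or_introl v1)).
    rewrite !mul0r !mulr0 mul0r addr0 normr0 -!mulrA; apply: mulr_ge0 => //.
    by rewrite !mulrA.
  have nr : n <= (rho ^+ 2)^-1.
    by rewrite lef_pV2 ?posrE//; apply: le_trans sr _; rewrite lerDl ltW.
  have nsn : `|n - s * n ^+ 2| <= (rho ^+ 2)^-1.
    rewrite (_ : n - s * n ^+ 2 = n * (1 - s * n)); last by ring.
    rewrite normrM (ger0_norm n0) ger0_norm ?subr_ge0//.
    by apply: le_trans nr; rewrite ler_piMr// lerBlDr lerDl.
  have r0 : 0 <= (rho ^+ 2)^-1 by rewrite invr_ge0 ltW.
  apply: le_trans (ler_normD _ _) _.
  rewrite (_ : 6 * C / rho ^+ 2 / rho ^+ 2 =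
    2 * (C / rho ^+ 2 / rho ^+ 2) + 4 * (C / rho ^+ 2) * (rho ^+ 2)^-1); last by field; rewrite gt_eqF.
  apply: lerD.
    rewrite -[2 * s * n]mulrA -mulrA normrM (ger0_norm (ler0n _ 2)); apply: ler_wpM2l => //.
    rewrite normrM (ger0_norm sn0) !normrM (ger0_norm r0).
    apply: (@le_trans _ _ (1 * (`|cutoff'' (s / rho ^+ 2)| / rho ^+ 2 / rho ^+ 2))).
      by apply: ler_wpM2r => //; apply: mulr_ge0 => //; apply: mulr_ge0.
    by rewrite mul1r; apply: ler_wpM2r => //; apply: ler_wpM2r.
  rewrite normrM; apply: ler_pM => //.
  rewrite normrM (ger0_norm (ler0n _ 4)) normrM (ger0_norm r0).
  by apply: ler_wpM2l => //; apply: ler_wpM2r.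
have E : cut_laplacian s = cutoff (s / rho ^+ 2) * (4 * eps ^+ 2 * n ^+ 3) - err.
  by rewrite cut_laplacianE cut_main_term.
move: errB; rewrite ler_norml => /andP[e1 e2].
have m0 : 0 <= cutoff (s / rho ^+ 2) * (4 * eps ^+ 2 * n ^+ 3) by apply: mulr_ge0.
have m1 : cutoff (s / rho ^+ 2) * (4 * eps ^+ 2 * n ^+ 3) <= 4 * (eps ^+ 2)^-1 ^+ 2.
  by apply: le_trans main1; rewrite ler_piMl.
rewrite E; apply/andP; split.
  by rewrite -[leLHS]add0r; apply: lerD => //; rewrite lerN2.
by apply: lerD => //; rewrite lerNl.
Qed.

End cut_kernel.

(** * The kernel on the cylinder *)

Section periodized_kernel.
Variables (R : realType) (G : lattice3 R) (L : complex_iso R).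
Hypothesis isoL : cstruct_isometry L.
Variables (rho eps : R) (P : E4 R).
Hypothesis rho0 : 0 < rho.
Hypothesis eps0 : 0 < eps.
Hypothesis short : forall n, (forall j, `|coord3 (lvec G n) j| < 6 * rho) -> lvec G n = 0.
Local Notation X := (cylinder G).
Local Notation W := (cube P (3 * rho)).

(** Two points of the cube differ by less than [6 * rho] in each coordinate. The radius [3 * rho]
    leaves a margin [rho] around the cube of radius [2 * rho] that carries the kernel; the margin
    makes the kernel vanish near every point without a lift in [W]. *)
Lemma separated_cube : lattice_separated G W.
Proof.
move=> x n /cubeP[h0 h1 h2 _] /cubeP[]; rewrite lshiftE /= => k0 k1 k2 _.
have tri (a b c : R) : `|a - c| < 3 * rho -> `|a + b - c| < 3 * rho -> `|b| < 6 * rho.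
  move=> ac abc; rewrite (_ : b = (a + b - c) - (a - c)); last by ring.
  by apply: le_lt_trans (ler_normB _ _) _; lra.
by apply: short => -[[|[|[|//]]] j3] /=; [exact: tri h0 k0|exact: tri h1 k1|exact: tri h2 k2].
Qed.

Definition rep4 (p : X) : mE4 R := (repr p.1, p.2).

Lemma proj4_rep4 p : proj4 G (rep4 p) = p.
Proof. by rewrite /proj4 torus_proj_repr; case: p. Qed.

(* The lift of [p] to the cube of radius [3 rho], or an arbitrary lift if there
   is none; in the latter case it is at distance at least [3 rho] from [P]. *)
Definition nearest (p : X) : mE4 R :=
  lshift G (xget 0 [set n | W (lshift G n (rep4 p))]) (rep4 p).

Lemma proj4_nearest p : proj4 G (nearest p) = p.
Proof. by rewrite proj4_lshift proj4_rep4. Qed.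

Lemma nearest_proj4 y : W y -> nearest (proj4 G y) = y.
Proof.
move=> Wy; have /proj4_eqP[m e] : proj4 G y = proj4 G (rep4 (proj4 G y)) by rewrite proj4_rep4.
have Wn : W (nearest (proj4 G y)).
  apply: (@xgetPex _ 0 [set n | W (lshift G n (rep4 (proj4 G y)))]).
  by exists m; rewrite /= -e.
have /proj4_eqP[k k_eq] := proj4_nearest (proj4 G y).
rewrite k_eq in Wn *; by rewrite lshiftE (separated_cube Wy Wn) addr0; case: (y).
Qed.

Lemma sqdist_nearest p : sqdist P (nearest p) < 9 * rho ^+ 2 ->
  exists2 y, W y & p = proj4 G y.
Proof.
move=> h; exists (nearest p); last by rewrite proj4_nearest.
have r0 : 0 <= 3 * rho by apply: mulr_ge0 => //; exact: ltW.
apply: contrapT => /(sqdist_notin_cube r0); rewrite leNgt.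
by rewrite (_ : (3 * rho) ^+ 2 = 9 * rho ^+ 2) ?h//; ring.
Qed.

Definition bump (p : X) : R := cut_kernel rho eps (sqdist P (nearest p)).

Lemma bump_proj4 y : W y -> bump (proj4 G y) = cut_kernel rho eps (sqdist P y).
Proof. by move=> Wy; rewrite /bump nearest_proj4. Qed.

Let rho2 : 0 < rho ^+ 2. Proof. by rewrite exprn_gt0. Qed.

Lemma bump_neq0 p : bump p != 0 -> exists2 y, cube P (2 * rho) y & p = proj4 G y.
Proof.
move=> h; have r0 : 0 <= 2 * rho by apply: mulr_ge0 => //; exact: ltW.
exists (nearest p); last by rewrite proj4_nearest.
apply: contrapT => /(sqdist_notin_cube r0); rewrite (_ : (2 * rho) ^+ 2 = 4 * rho ^+ 2); last by ring.
by move=> H; move/negP: h; apply; rewrite /bump cut_kernel_eq0.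
Qed.

Lemma near_coord (i : nat) (a b : R) (x : E4 R) : (i < 4)%N -> `|(coords x)`_i + a| < b ->
  \forall y \near x, `|(coords y)`_i + a| < b.
Proof.
move=> i4 xab.
have cc : {for x, continuous (fun y : E4 R => (coords y)`_i)}.
  have [l0 l1 l2 l3] := linear_like_coords R.
  by case: i i4 {xab} => [|[|[|[|//]]]] _ /=; apply: differentiable_continuous;
    [exact: l0.1|exact: l1.1|exact: l2.1|exact: l3.1].
have cn : (fun y : E4 R => `|(coords y)`_i + a|) y @[y --> x] --> `|(coords x)`_i + a|.
  by apply: cvg_norm; apply: cvgD; [exact: cc|exact: cvg_cst].
exact: (cvgr_lt _ cn _ xab).
Qed.

Definition lattice4 (n : {ffun 'I_3 -> int}) : E4 R := (lvec G n, 0).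

Lemma coords_lshift n x i : (i < 4)%N ->
  (coords (lshift G n x))`_i = (coords x)`_i + (coords (lattice4 n))`_i.
Proof. by case: i => [|[|[|[|//]]]]. Qed.

Lemma near_all4 (Q : nat -> E4 R -> Prop) (x : E4 R) :
  (forall i, (i < 4)%N -> \forall y \near x, Q i y) ->
  \forall y \near x, forall i, (i < 4)%N -> Q i y.
Proof.
move=> H; near=> y; move=> [|[|[|[|//]]]] _; near: y; exact: H.
Unshelve. all: by end_near. Qed.

Lemma near_cube_lshift n (x : E4 R) (r : R) : cube P r (lshift G n x) ->
  \forall y \near x, cube P r (lshift G n y).
Proof.
move=> Wx; apply: near_all4 => i i4.
have := Wx i i4; rewrite coords_lshift// -addrA => /(near_coord i4).
by apply: filterS => y; rewrite coords_lshift// addrA.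
Qed.

Lemma near_cube (x : E4 R) (r : R) : 0 < r -> \forall y \near x, cube x r y.
Proof.
move=> r0; apply: near_all4 => i i4; apply: (@near_coord i _ r) => //.
by rewrite subrr normr0.
Qed.

Lemma lift_bump x : Defs.lift bump x = bump (proj4 G x).
Proof. by []. Qed.

Lemma sqdist_lshift n x : sqdist P (lshift G n x) = sqdist (P - lattice4 n) x.
Proof.
by rewrite !sqdistE /lshift /shift4 /=; congr (_ ^+ 2 + _ ^+ 2 + _ ^+ 2 + _ ^+ 2); ring.
Qed.

Lemma lift_bump_near n (x : E4 R) : W (lshift G n x) ->
  \forall y \near x, Defs.lift bump y = cut_kernel rho eps (sqdist (P - lattice4 n) y).
Proof.
move=> /near_cube_lshift; apply: filterS => y Wy.
by rewrite lift_bump -(proj4_lshift G n) bump_proj4// sqdist_lshift.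
Qed.

Lemma lift_bump_near0 (x : E4 R) : (forall n, ~ W (lshift G n x)) ->
  \forall y \near x, Defs.lift bump y = 0.
Proof.
move=> nW; apply: filterS (near_cube x rho0) => y xy.
apply/eqP; apply/negPn/negP; rewrite lift_bump => /bump_neq0[z zP /esym/proj4_eqP[n zE]].
apply: (nW n) => i i4; have := zP i i4; have := xy i i4.
rewrite zE !coords_lshift//.
move: (coords x)`_i (coords y)`_i (coords (lattice4 n))`_i (coords P)`_i => a b c d h1 h2.
rewrite (_ : a + c - d = (b + c - d) - (b - a)); last by ring.
by apply: le_lt_trans (ler_normB _ _) _; lra.
Qed.

Lemma Ck_cut_kernel n Q : differentiable_upto n (fun y : E4 R => cut_kernel rho eps (sqdist Q y)).
Proof.
apply: CkM.
  apply: (@Ck_comp _ n _ (fun y : E4 R => sqdist Q y / rho ^+ 2)); first exact: smooth_cutoff.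
  by apply: CkM; [exact: Ck_sqdist|exact: Ck_cst].
apply: CkV => [x|]; first by rewrite gt_eqF// ltr_wpDl ?sqdist_ge0// exprn_gt0.
by apply: CkD; [exact: Ck_sqdist|exact: Ck_cst].
Qed.

Lemma smooth_lift_bump : smooth (Defs.lift bump).
Proof.
apply/smoothP => m; apply: Ck_local => x.
have [[n Wn]|nW] := pselect (exists n, W (lshift G n x)).
  exists (fun y => cut_kernel rho eps (sqdist (P - lattice4 n) y)); first exact: Ck_cut_kernel.
  exact: lift_bump_near.
exists (fun=> 0); first exact: Ck_cst.
by apply: lift_bump_near0 => n Wn; apply: nW; exists n.
Qed.

Lemma laplacianX_bump p :
  laplacianX L bump p = cut_laplacian rho eps (sqdist P (nearest p)).
Proof.
rewrite laplacianX_lap//; last exact: smooth_lift_bump.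
have [Wp|nWp] := pselect (W (nearest p)).
  rewrite (lap_near (lift_bump_near Wp)).
  have e20 : 0 < eps ^+ 2 by rewrite exprn_gt0.
  rewrite (lap_radial _ _ e20 (@is_derive_cut_kernel R rho eps) (@is_derive_cut_kernel' R rho eps)).
  by rewrite -sqdist_lshift.
have r0 : 0 <= 3 * rho by apply: mulr_ge0 => //; exact: ltW.
have S9 := sqdist_notin_cube r0 nWp.
rewrite cut_laplacian_outer//; last first.
  by apply: lt_le_trans S9; rewrite (_ : (3 * rho) ^+ 2 = 9 * rho ^+ 2) ?ltr_pM2r ?ltr_nat//; ring.
rewrite (@lap_near _ _ (fun=> 0)).
  rewrite /lap big1 ?mulr0// => i _; rewrite (_ : (fun y => _) = fun=> 0) ?derive_cst//.
  by apply/funext => y; rewrite derive_cst.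
apply: lift_bump_near0 => n Wn; apply: nWp; apply: (@xgetPex _ 0 [set n | W (lshift G n (rep4 p))]).
by exists n.
Qed.

(* [nearest] involves arbitrary choices, but the truncated distance depends only
   on the points of that cube, whence its measurability. *)
Definition truncated_sqdist (p : X) : R := Num.min (sqdist P (nearest p)) (5 * rho ^+ 2).

Lemma measurable_truncated_sqdist : measurable_fun [set: X] truncated_sqdist.
Proof.
suff H : forall B, measurable B -> measurable (truncated_sqdist @^-1` B).
  by move=> _ B mB; rewrite setTI; exact: H.
apply: (@real_sigma_algebra_min R [set B | measurable (truncated_sqdist @^-1` B)]).
  split => /=.
  - by rewrite preimage_set0.
  - by move=> A mA; rewrite setTD preimage_setC; exact: measurableC.
  - by move=> F mF; rewrite preimage_bigcup; exact: bigcupT_measurable.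
(* The factor 5 lies between 4, beyond which the kernel vanishes, and 9, below which a point has its
   nearest lift in [W]. Hence each nontrivial sublevel set is the image of a measurable part of
   [W]. *)
move=> a /=; have [a5|a5] := ltP (5 * rho ^+ 2) a.
  rewrite (_ : _ @^-1` _ = setT)//; apply/seteqP; split => // p _ /=.
  by rewrite in_itv/= /truncated_sqdist gt_min a5 orbT.
rewrite (_ : _ @^-1` _ = proj4 G @` (W `&` [set y | sqdist P y < a])).
  apply: measurable_proj4_image; apply: measurableI; first exact: measurable_cube.
  rewrite (_ : [set y | _] = (fun y : mE4 R => sqdist P y) @^-1` `]-oo, a[%classic).
    by rewrite -[X in measurable X]setTI; exact: measurable_sqdist.
  by apply/seteqP; split => y /=; rewrite in_itv.
apply/seteqP; split => [p|p [y [Wy ya] <-]] /=; rewrite in_itv/= /truncated_sqdist gt_min.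
  rewrite [X in _ || X]ltNge a5 orbF => pa.
  have r9 : sqdist P (nearest p) < 9 * rho ^+ 2.
    by apply: lt_le_trans pa (le_trans a5 _); rewrite ler_pM2r// ler_nat.
  have [y Wy pE] := sqdist_nearest r9; exists y => //; split => //=.
  by rewrite pE nearest_proj4// in pa.
by rewrite nearest_proj4// ya.
Qed.

Lemma measurable_cut_laplacian : measurable_fun [set: X] (fun p => cut_laplacian rho eps (truncated_sqdist p)).
Proof.
have mt := measurable_truncated_sqdist.
have ci (g : R -> R) : continuous g -> measurable_fun [set: X] (fun p => g (truncated_sqdist p)).
  by move=> cg; apply: measurableT_comp mt; exact: continuous_measurable_fun.
have cont (g : R -> R) : (forall n, differentiable_upto n g) ->
    measurable_fun [set: X] (fun p => g (truncated_sqdist p / rho ^+ 2)).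
  move=> Cg; apply: (ci (fun s => g (s / rho ^+ 2))); apply: smooth_continuous.
  apply/smoothP => n; apply: (@Ck_comp _ n R (fun s => s / rho ^+ 2)) => //.
  by apply: CkM; [exact: Ck_id|exact: Ck_cst].
have m0 := cont _ (@smooth_cutoff R).
have m1 := cont _ (@Ck_cutoff' R).
have m2 := cont _ (@Ck_cutoff'' R).
have mn : measurable_fun [set: X] (fun p => (truncated_sqdist p + eps ^+ 2)^-1).
  rewrite (_ : (fun p => _) = (fun s : R => (`|s| + eps ^+ 2)^-1) \o truncated_sqdist).
    by apply: measurableT_comp mt; exact: measurable_invD_sq.
  apply/funext => p /=; rewrite ger0_norm// /truncated_sqdist le_min sqdist_ge0/=.
  by apply: mulr_ge0 => //; exact: ltW.
rewrite (_ : (fun p => _) = fun p =>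
  cutoff (truncated_sqdist p / rho ^+ 2) * (4 * (truncated_sqdist p + eps ^+ 2)^-1 ^+ 2 -
     4 * truncated_sqdist p * (truncated_sqdist p + eps ^+ 2)^-1 ^+ 3) -
  (2 * truncated_sqdist p * (truncated_sqdist p + eps ^+ 2)^-1 *
     (cutoff'' (truncated_sqdist p / rho ^+ 2) / rho ^+ 2 / rho ^+ 2) +
   4 * (cutoff' (truncated_sqdist p / rho ^+ 2) / rho ^+ 2) *
     ((truncated_sqdist p + eps ^+ 2)^-1 - truncated_sqdist p * (truncated_sqdist p + eps ^+ 2)^-1 ^+ 2))).
  by repeat first [assumption | exact: measurable_cst | apply: measurable_funB | apply: measurable_funD
    | apply: measurable_funM | apply: measurable_funX].
by apply/funext => p; rewrite cut_laplacianE.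
Qed.

Lemma laplacianX_bump_truncated p :
  laplacianX L bump p = cut_laplacian rho eps (truncated_sqdist p).
Proof.
rewrite laplacianX_bump /truncated_sqdist minEle; case: ifPn => //; rewrite -ltNge => h.
have h4 : 4 * rho ^+ 2 < 5 * rho ^+ 2 by rewrite ltr_pM2r// ltr_nat.
by rewrite !cut_laplacian_outer//; exact: lt_trans h.
Qed.

Lemma bump_truncated p : bump p = cut_kernel rho eps (truncated_sqdist p).
Proof.
rewrite /bump /truncated_sqdist minEle; case: ifPn => //; rewrite -ltNge => h.
have h4 : 4 * rho ^+ 2 < 5 * rho ^+ 2 by rewrite ltr_pM2r// ltr_nat.
by rewrite !cut_kernel_eq0//; apply: ltW => //; exact: lt_trans h.
Qed.

Lemma measurable_bump : measurable_fun [set: X] bump.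
Proof.
have mt := measurable_truncated_sqdist.
rewrite (_ : bump = fun p => cut_kernel rho eps (truncated_sqdist p)); last first.
  by apply/funext => p; rewrite bump_truncated.
apply: measurable_funM.
  apply: (measurableT_comp (f := fun s : R => cutoff (s / rho ^+ 2))) mt.
  apply: continuous_measurable_fun; apply: smooth_continuous.
  apply/smoothP => n; apply: (@Ck_comp _ n R (fun s => s / rho ^+ 2)) => //; first exact: smooth_cutoff.
  by apply: CkM; [exact: Ck_id|exact: Ck_cst].
rewrite (_ : (fun p => _) = (fun s : R => (`|s| + eps ^+ 2)^-1) \o truncated_sqdist).
  by apply: measurableT_comp mt; exact: measurable_invD_sq.
apply/funext => p /=; rewrite ger0_norm// /truncated_sqdist le_min sqdist_ge0/=.
by apply: mulr_ge0 => //; exact: ltW.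
Qed.

End periodized_kernel.

Section local_estimate.
Variables (R : realType) (G : lattice3 R) (L : complex_iso R).
Variables (phi : R -> R) (delta : R).
Hypothesis isoL : cstruct_isometry L.
Hypothesis sphi : smooth phi.
Hypothesis phi_gt0 : forall t, 0 < phi t.
Hypothesis delta0 : 0 < delta.
Hypothesis phiE : forall t, 1 < `|t| -> phi t = expR (- (delta * `|t|)).
Local Notation X := (cylinder G).

Lemma cubeS (P : E4 R) (r s : R) : r <= s -> cube P r `<=` cube P s.
Proof. by move=> rs y H i i4; exact: lt_le_trans (H i i4) rs. Qed.

Lemma local_estimate : exists K e0 : R, [/\ 0 < K, 0 < e0 & forall (B M I : R) (f : X -> R),
  0 < B -> measurable_fun [set: X] f -> (forall p, 0 <= f p <= M) ->
  dist_laplacian_le L f (fun p => B * phi p.2) ->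
  (\int[dvol G]_p (f p * phi p.2)%:E = I%:E)%E ->
  forall (P : E4 R) (eps : R), 0 < eps < e0 ->
  (\int[vol4 R]_(x in cube P eps) (f (proj4 G x))%:E <= (K * (B + I) * eps ^+ 4)%:E)%E].
Proof.
have [c [C1 [c0 C10 phib]]] := weight_bounds sphi phi_gt0 delta0 phiE.
have [C C0 HC] := @cutoff_bound R.
have [K1 K10 HK1] := slab_estimate G isoL sphi phi_gt0 delta0 phiE.
have [r r0 Hr] := short_lattice_vector G.
(* [6 * rho <= r] separates lattice translates. [6 * rho <= 1] puts the cube of radius [3 * rho]
   inside the cube of radius 1, where the kernel integral is bounded, and inside the slab of heights
   within 1 of [P.2]. *)
pose rho := Num.min r 1 / 6.
have m0 : 0 < Num.min r 1 by rewrite lt_min r0 ltr01.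
have rho0 : 0 < rho by rewrite divr_gt0.
have rho6 : 6 * rho <= r by rewrite /rho mulrC divfK// ge_min lexx.
have rho1 : 6 * rho <= 1 by rewrite /rho mulrC divfK// ge_min lexx orbT.
have short n : (forall j, `|coord3 (lvec G n) j| < 6 * rho) -> lvec G n = 0.
  by move=> H; apply: Hr => j; exact: lt_le_trans (H j) rho6.
have rho2 : 0 < rho ^+ 2 by rewrite exprn_gt0.
pose D := 6 * C / rho ^+ 2 / rho ^+ 2.
have D0 : 0 < D by rewrite divr_gt0// divr_gt0// mulr_gt0.
(* [C1 * 128] comes from the integral of [phi] against the kernel, [D * K1] from the negative part
   of the Laplacian over a slab, and 125/4 inverts the lower bound in [A] below. *)
pose K := 125 / 4 * (C1 * 128 + D * K1).
have K0 : 0 < K.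
  by apply: mulr_gt0; [rewrite divr_gt0|apply: addr_gt0; apply: mulr_gt0].
(* For [eps < rho / 2] one has [4 * eps ^+ 2 < rho ^+ 2], so the cube of radius [eps] lies where the
   cutoff is 1. *)
exists K, (rho / 2); split => //; first by rewrite divr_gt0.
move=> B M I f B0 mf fM dle IE P eps /andP[eps0 epsr].
have f0 p : 0 <= f p by have /andP[] := fM p.
have eps2 : 0 < eps ^+ 2 by rewrite exprn_gt0.
have eps4 : 0 < eps ^+ 4 by rewrite exprn_gt0.
have I0 : 0 <= I.
  by rewrite -lee_fin -IE; apply: integral_ge0 => p _; rewrite lee_fin; apply: mulr_ge0 => //; exact: ltW.
have mproj A : measurable A -> measurable (proj4 G @` A) by exact: measurable_proj4_image.
pose W := cube P (3 * rho).
have mW : measurable W by exact: measurable_cube.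
have sW : lattice_separated G W := separated_cube short.
have epsW : cube P eps `<=` W by apply: cubeS; lra.
have seps : lattice_separated G (cube P eps).
  by move=> x n /epsW Wx /epsW; exact: sW.
have mce : measurable (cube P eps) by exact: measurable_cube.
pose chi := @bump R G rho eps P.
have chi_ge0 p : 0 <= chi p.
  apply: mulr_ge0; first exact: cutoff_ge0.
  by rewrite invr_ge0 addr_ge0 ?sqdist_ge0// ltW.
(* On this cube the squared distance is at most 4 eps^2, so the Laplacian 4 eps^2 / (s + eps^2)^3 is
   at least 4 eps^2 / (5 eps^2)^3. *)
pose A (p : X) : R := 4 / 125 / eps ^+ 4 * \1_(proj4 G @` cube P eps) p.
pose E (p : X) : R := D * \1_(slab (P.2 - 1) (P.2 + 1)) p.
have mA : measurable_fun [set: X] A by apply: measurable_funM => //; apply: measurable_indic; exact: mproj.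
have mE : measurable_fun [set: X] E.
  by apply: measurable_funM => //; apply: measurable_indic; exact: measurable_slab.
have c125 : 0 <= 4 / 125 / eps ^+ 4 by apply: divr_ge0; [rewrite divr_ge0|exact: ltW].
have A_ge0 p : 0 <= A p by apply: mulr_ge0 => //; rewrite indicE ler0n.
have E_ge0 p : 0 <= E p by apply: mulr_ge0; [exact: ltW|rewrite indicE ler0n].
have lapE (p : X) := laplacianX_bump isoL P rho0 eps0 short p.
have lapB (p : X) := cut_laplacian_bounds rho0 eps0 C0 HC (sqdist_ge0 P (nearest rho P p)).
have far (p : X) : P.2 + 1 < p.2 \/ p.2 < P.2 - 1 -> 9 * rho ^+ 2 <= sqdist P (nearest rho P p).
  move=> h; rewrite leNgt; apply/negP => /(sqdist_nearest rho0)[y /cubeP[_ _ _ Wy] pE].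
  move: h; rewrite pE /= => h.
  by move: Wy; rewrite ltr_distl => /andP[h1 h2]; case: h => h; lra.
have r49 : 4 * rho ^+ 2 < 9 * rho ^+ 2 by rewrite ltr_pM2r// ltr_nat.
have lap0 (p : X) : P.2 + 1 < p.2 \/ p.2 < P.2 - 1 -> laplacianX L chi p = 0.
  by move=> /far h; rewrite lapE cut_laplacian_outer//; exact: lt_le_trans h.
have chi0 (p : X) : P.2 + 1 < p.2 \/ p.2 < P.2 - 1 -> chi p = 0.
  by move=> /far h; rewrite /chi /bump cut_kernel_eq0//; apply: ltW; exact: lt_le_trans h.
pose N := `|P.2| + 1.
have farN (p : X) : N < `|p.2| -> P.2 + 1 < p.2 \/ p.2 < P.2 - 1.
  rewrite /N => h; have [h1|h1] := ltP (P.2 + 1) p.2; [by left|right].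
  rewrite ltNge; apply/negP => h2; move: h; apply/negP; rewrite -leNgt.
  rewrite -[p.2](subrK P.2) addrC; apply: le_trans (ler_normD _ _) _; rewrite lerD2l.
  by rewrite ler_distl h2.
have tchi : test_function chi.
  apply: (@test_function_of_support R G chi N); first exact: smooth_lift_bump P rho0 eps0 short.
  by move=> p /farN/chi0.
have mlap : measurable_fun [set: X] (laplacianX L chi).
  rewrite (_ : laplacianX L chi = fun p => cut_laplacian rho eps (truncated_sqdist rho P p)).
    exact: (measurable_cut_laplacian P rho0 eps0 short).
  by apply/funext => p; exact: (laplacianX_bump_truncated isoL P rho0 eps0 short).
pose Kb := 4 * (eps ^+ 2)^-1 ^+ 2 + D.
have lapK p : `|laplacianX L chi p| <= Kb.
  rewrite lapE ler_norml; have /andP[b1 b2] := lapB p; rewrite b2 andbT.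
  apply: le_trans b1; rewrite lerN2 /Kb lerDr; apply: mulr_ge0 => //.
  by apply: exprn_ge0; rewrite invr_ge0 ltW.
have h_ge0 (p : X) : 0 <= B * phi p.2 by apply: mulr_ge0; exact: ltW.
have AE p : A p <= laplacianX L chi p + E p.
  rewrite /A; have [/set_mem[y yP yE]|pn] := boolP (p \in proj4 G @` cube P eps).
    rewrite indicE mem_set; last by exists y.
    rewrite mulr1; apply: ler_wpDr => //.
    rewrite lapE -yE (nearest_proj4 short (epsW _ yP)).
    have S4 := sqdist_cube_le yP.
    have e4 : 4 * eps ^+ 2 < rho ^+ 2.
      rewrite (_ : 4 * eps ^+ 2 = (2 * eps) ^+ 2); last by ring.
      by apply: ltrXn2r => //; rewrite ?nnegrE; [apply: mulr_ge0 => //; exact: ltW|lra].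
    rewrite cut_laplacian_inner ?sqdist_ge0//; last exact: le_lt_trans e4.
    rewrite exprVn (_ : 4 / 125 / eps ^+ 4 = 4 * eps ^+ 2 / (5 * eps ^+ 2) ^+ 3); last first.
      by field; rewrite gt_eqF.
    apply: ler_wpM2l; first by apply: mulr_ge0 => //; exact: ltW.
    have S0 := sqdist_ge0 P y.
    rewrite lef_pV2 ?posrE ?exprn_gt0 ?mulr_gt0 ?ltr_wpDl//.
    apply: lerXn2r; rewrite ?nnegrE.
    - by apply: addr_ge0 => //; exact: ltW.
    - by apply: mulr_ge0 => //; exact: ltW.
    - by move: S4 eps2; move: (eps ^+ 2) (sqdist P y) => a b; lra.
  rewrite indicE (negbTE pn) mulr0 /E indicE.
  have [ps|ps] := boolP (p \in slab (P.2 - 1) (P.2 + 1)).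
    rewrite mulr1 lapE -lerBlDr sub0r; by have /andP[] := lapB p.
  rewrite mulr0 addr0 lap0//.
  have [h1|h1] := ltP (P.2 + 1) p.2; [by left|right].
  rewrite ltNge; apply/negP => h2; move/negP: ps; apply.
  by apply/mem_set; rewrite /slab /= h2 h1.
have T := @test_inequality R G L f chi A E (fun p => B * phi p.2) M _ N
  mf fM tchi chi_ge0 mlap lapK (fun p h => lap0 p (farN p h)) mA mE h_ge0 A_ge0 E_ge0 AE dle.
have chiE : (\int[dvol G]_p (chi p)%:E <= 128%:E)%E.
  have mchi : measurable_fun [set: X] (fun p => (chi p)%:E).
    by apply/measurable_EFinP; exact: (measurable_bump P rho0 eps0 short).
  have -> : (\int[dvol G]_p (chi p)%:E = \int[dvol G]_(p in proj4 G @` W) (chi p)%:E)%E.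
    rewrite [RHS]integral_mkcond; apply: eq_integral => p _; rewrite patchE.
    case: ifPn => // pn; congr EFin; apply/eqP; apply/negPn/negP => chip.
    have [y yP pE] := bump_neq0 rho0 chip; move/negP: pn; apply; apply/mem_set.
    by exists y => //; apply: cubeS yP; lra.
  rewrite (ge0_integral_unfold mW sW mchi); last by move=> p; rewrite lee_fin.
  apply: le_trans (newton_kernel_integral P eps0).
  have ms : measurable_fun [set: mE4 R] (fun y : mE4 R => (sqdist P y + eps ^+ 2)^-1).
    rewrite (_ : (fun y : mE4 R => _) = (fun s : R => (`|s| + eps ^+ 2)^-1) \o (fun y : mE4 R => sqdist P y)).
      by apply: measurableT_comp; [exact: measurable_invD_sq|exact: measurable_sqdist].
    by apply/funext => y /=; rewrite ger0_norm// sqdist_ge0.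
  have inv0 y : 0 <= (sqdist P y + eps ^+ 2)^-1 by rewrite invr_ge0 addr_ge0 ?sqdist_ge0// ltW.
  apply: (@le_trans _ _ (\int[vol4 R]_(y in W) ((sqdist P y + eps ^+ 2)^-1)%:E)%E).
    apply: ge0_le_integral => //.
    - by move=> y _; rewrite lee_fin.
    - apply: measurable_funTS; exact: (measurableT_comp mchi (@measurable_proj4 R G)).
    - by apply/measurable_EFinP; exact: measurable_funTS.
    move=> y Wy; rewrite lee_fin /chi (bump_proj4 eps short Wy).
    by rewrite /cut_kernel ler_piMl// cutoff_le1.
  apply: ge0_subset_integral => //.
  - exact: measurable_cube.
  - by apply/measurable_EFinP; exact: measurable_funTS.
  - by move=> y _; rewrite lee_fin.
  - by apply: cubeS; lra.
have mfp : measurable_fun [set: X] (fun p => (f p)%:E) by apply/measurable_EFinP.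
have TA : (\int[dvol G]_p (f p * A p)%:E =
    (4 / 125 / eps ^+ 4)%:E * \int[vol4 R]_(x in cube P eps) (f (proj4 G x))%:E)%E.
  rewrite -(ge0_integral_unfold mce seps mfp); last by move=> p; rewrite lee_fin.
  rewrite [X in (_ * X)%E]integral_mkcond -ge0_integralZl//; last 2 first.
  - by apply/(measurable_restrict _ _ _).1 => //; [exact: mproj|exact: measurable_funTS].
  - by move=> p _; apply: erestrict_ge0 => q _; rewrite lee_fin.
  apply: eq_integral => p _; rewrite /A patchE indicE; case: ifPn => _.
    by rewrite mulr1 -EFinM mulrC.
  by rewrite !mulr0 mule0.
have T1 : (\int[dvol G]_p (B * phi p.2 * chi p)%:E <= (B * C1 * 128)%:E)%E.
  have BC : 0 <= B * C1 by apply: mulr_ge0; exact: ltW.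
  apply: (@le_trans _ _ (\int[dvol G]_p (B * C1 * chi p)%:E)%E).
    apply: ge0_le_integral => //.
    - by move=> p _; rewrite lee_fin; apply: mulr_ge0.
    - apply/measurable_EFinP; apply: measurable_funM; last exact: (measurable_bump P rho0 eps0 short).
      by apply: measurable_funM => //; apply: measurable_height; exact: smooth_continuous.
    - by apply/measurable_EFinP; apply: measurable_funM => //; exact: (measurable_bump P rho0 eps0 short).
    move=> p _; rewrite lee_fin; apply: ler_wpM2r => //; apply: ler_wpM2l; first exact: ltW.
    have /andP[_ h] := phib p.2; apply: le_trans h _; apply: ler_piMr; first exact: ltW.
    by rewrite expR_le1 oppr_le0; apply: mulr_ge0 => //; exact: ltW.
  rewrite ge0_integralZl_real//; last exact: (measurable_bump P rho0 eps0 short).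
  by rewrite [leRHS]EFinM; apply: lee_wpmul2l => //; rewrite lee_fin.
have T2 : (\int[dvol G]_p (f p * E p)%:E <= (D * (K1 * (B + I)))%:E)%E.
  have -> : (\int[dvol G]_p (f p * E p)%:E =
      D%:E * \int[dvol G]_p (f p * \1_(slab (P.2 - 1) (P.2 + 1)) p)%:E)%E.
    rewrite -ge0_integralZl_real; first by apply: eq_integral => p _; rewrite /E mulrCA.
    - exact: ltW.
    - by apply: measurable_funM => //; apply: measurable_indic; exact: measurable_slab.
    - by move=> p; apply: mulr_ge0 => //; rewrite indicE ler0n.
  rewrite [leRHS]EFinM; apply: lee_wpmul2l; first by rewrite lee_fin ltW.
  exact: HK1 B0 mf fM dle IE.
have := le_trans T (leeD T1 T2); rewrite TA -EFinD -lee_pdivlMl; last first.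
  by rewrite divr_gt0// divr_gt0.
move=> H; apply: le_trans H _; rewrite -EFinM lee_fin.
rewrite (_ : (4 / 125 / eps ^+ 4)^-1 = 125 / 4 * eps ^+ 4); last by field; rewrite gt_eqF.
rewrite (_ : K * (B + I) * eps ^+ 4 = 125 / 4 * eps ^+ 4 * ((C1 * 128 + D * K1) * (B + I))); last first.
  by rewrite /K; ring.
apply: ler_wpM2l; first by apply: mulr_ge0; [rewrite divr_ge0|exact: ltW].
rewrite (_ : (C1 * 128 + D * K1) * (B + I) = B * C1 * 128 + D * (K1 * (B + I)) + C1 * 128 * I); last by ring.
by rewrite lerDl; apply: mulr_ge0 => //; apply: mulr_ge0 => //; exact: ltW.
Qed.

End local_estimate.

(** * General test functions *)

Section continuous_measurable.
Variable R : realType.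

(** An open set is the union of the cubes with rational centre and radius 1/(n+1) that it contains.
    It follows that the Laplacian of an arbitrary test function, whose lift is merely known to be
    smooth, is measurable. *)
Lemma open4_measurable (U : set (E4 R)) : open U -> measurable (U : set (mE4 R)).
Proof.
move=> oU.
pose q4 (q : rat * rat * rat * rat) : E4 R := (ratr q.1.1.1, ratr q.1.1.2, ratr q.1.2, ratr q.2).
pose F (i : (rat * rat * rat * rat) * nat) : set (mE4 R) :=
  if asbool (cube (q4 i.1) (i.2.+1%:R^-1) `<=` U) then cube (q4 i.1) (i.2.+1%:R^-1) else set0.
have -> : U = \bigcup_i F i.
  apply/seteqP; split => [x Ux|x [i _]]; last by rewrite /F; case: asboolP => // h; exact: h.
  have /nbhs_ballP[e /= e0 xU] : nbhs x U by exact: open_nbhs_nbhs.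
  have [n ne] : exists n : nat, 0 + n.+1%:R^-1 < e / 2 by apply: ltr_add_invr; rewrite divr_gt0.
  rewrite add0r in ne; pose d : R := n.+1%:R^-1.
  have d0 : 0 < d by rewrite invr_gt0.
  have rat_near (a : R) : exists q : rat, `|a - ratr q| < d.
    have [q] : exists q : rat, ratr q \in `]a - d, a + d[.
      by apply: rat_in_itvoo; rewrite ltrD2l gtrN.
    by rewrite in_itv/= => /andP[h1 h2]; exists q; rewrite distrC ltr_distl h1 h2.
  have [q0 h0] := rat_near x.1.1.1; have [q1 h1] := rat_near x.1.1.2.
  have [q2 h2] := rat_near x.1.2; have [q3 h3] := rat_near x.2.
  have xq : cube (q4 (q0, q1, q2, q3)) d x by apply/cubeP; split.
  exists ((q0, q1, q2, q3), n) => //; rewrite /F /=; case: asboolP => // -[].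
  have tri (a b q : R) : `|a - q| < d -> `|b - q| < d -> `|a - b| < e.
    move=> aq bq; rewrite -(subrKA q); apply: le_lt_trans (ler_normD _ _) _.
    rewrite (distrC q) [e]splitr; apply: ltrD; exact: lt_trans ne.
  move=> y /cubeP[/= y0 y1 y2 y3]; apply: xU.
  by split; [split; [split|]|]; [exact: tri h0 y0|exact: tri h1 y1|exact: tri h2 y2|exact: tri h3 y3].
apply: countable_bigcupT_measurable; first exact: countableP.
by move=> i; rewrite /F; case: asboolP => // _; exact: measurable_cube.
Qed.

Lemma continuous4_measurable (F : E4 R -> R) : continuous F ->
  measurable_fun [set: mE4 R] (F : mE4 R -> R).
Proof.
move=> /continuousP cF; apply: (measurability _ (RGenOpens.measurableE R)).
move=> _ [_ [a [b ->] <-]]; rewrite setTI; apply: open4_measurable.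
exact/cF/interval_open.
Qed.

End continuous_measurable.

Section test_functions.
Variables (R : realType) (G : lattice3 R) (L : complex_iso R).
Hypothesis isoL : cstruct_isometry L.
Local Notation X := (cylinder G).

Lemma derive_translate (V : normedModType R) (F : V -> R) (a v x : V) :
  (forall y, F (y + a) = F y) -> 'D_v F (x + a) = 'D_v F x.
Proof.
move=> Fa; rewrite /derive; set g := (X in lim (X @ _)) => /=; set g' := (X in _ = lim (X @ _)).
rewrite (_ : g = g')//; apply/funext => h; rewrite /g /g' /=.
by rewrite Fa addrA Fa.
Qed.

Lemma smooth_lap_continuous (F : E4 R -> R) : smooth F -> continuous (lap F).
Proof.
move=> sF x; apply: differentiable_continuous; rewrite /lap.
have -> : (fun x => \sum_(i < 4) 'D_(std4 i) (fun y => 'D_(std4 i) F y) x) =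
    \sum_(i < 4) (fun x => 'D_(std4 i) (fun y => 'D_(std4 i) F y) x).
  by apply/funext => y; rewrite fct_sumE.
by apply: differentiable_sum => i; exact: (sF [:: std4 i; std4 i]).
Qed.

Lemma laplacianX_proj4 (chi : X -> R) (x : mE4 R) : smooth (Defs.lift chi) ->
  laplacianX L chi (proj4 G x) = - 2^-1 * lap (Defs.lift chi) x.
Proof.
move=> schi; rewrite (laplacianX_lap isoL _ schi).
have -> // : lap (Defs.lift chi) (repr (proj4 G x).1, (proj4 G x).2) = lap (Defs.lift chi) x.
have /proj4_eqP[n ->] : proj4 G (repr (proj4 G x).1, (proj4 G x).2) = proj4 G x.
  by rewrite /proj4 /= torus_proj_repr.
rewrite /lshift /shift4.
have P y : Defs.lift chi (y + (lvec G n, 0)) = Defs.lift chi y.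
  by rewrite /Defs.lift /= torus_proj_lvec addr0.
apply: eq_bigr => i _; apply: derive_translate => y; exact: derive_translate.
Qed.

Lemma lap_cst0 (x : E4 R) : lap (fun=> 0) x = 0.
Proof.
rewrite /lap big1// => i _.
by rewrite (_ : (fun y => _) = fun=> 0) ?derive_cst//; apply/funext => y; rewrite derive_cst.
Qed.

Lemma bounded_proj4 (g : X -> R) (n : R) : continuous (g \o proj4 G : E4 R -> R) ->
  (forall p : X, n < `|p.2| -> g p = 0) -> exists C, forall p, `|g p| <= C.
Proof.
move=> cg g0; have [K cK KE] := torus_compact_cover G.
pose W : set (E4 R) := K `*` (`[- n, n]%classic : set R).
have cW : compact W by apply: compact_setX => //; exact: segment_compact.
have /compact_bounded[M [Mr HM]] : compact ((g \o proj4 G : E4 R -> R) @` W).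
  by apply: continuous_compact => //; exact: continuous_subspaceT.
exists (`|M| + 1) => p.
have M1 : M < `|M| + 1 by rewrite ltr_pwDr// ler_norm.
have [np|pn] := ltP n `|p.2|.
  by rewrite g0// normr0 addr_ge0.
have [x Kx xE] : (torus_proj G @` K) p.1 by rewrite KE.
apply: (HM _ M1); exists (x, p.2) => //=; last by rewrite /proj4 /= xE; case: (p).
by split => //=; rewrite in_itv /= -ler_norml.
Qed.

(** Compactness of the support bounds its heights; compactness of a set covering the torus at these
    heights then bounds the lifts. Pairing with a bounded [f] thus takes place on a slab of finite
    volume. *)
Lemma test_function_regular (chi : X -> R) : test_function chi -> exists n C : R,
  [/\ 0 < n, 0 < C,
      forall p : X, n < `|p.2| -> chi p = 0 /\ laplacianX L chi p = 0,
      forall p, `|chi p| <= C /\ `|laplacianX L chi p| <= C &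
      measurable_fun [set: X] (laplacianX L chi)].
Proof.
move=> [schi ksupp].
have /compact_bounded[N [Nr HN]] : compact ((snd : X -> R) @` closure [set p : X | chi p != 0]).
  by apply: continuous_compact => //; apply: continuous_subspaceT => p; exact: cvg_snd.
pose n := `|N| + 1.
have n0 : 0 < n by rewrite ltr_wpDl.
have N1 : N < n by rewrite ltr_pwDr// ler_norm.
have chi0 (p : X) : n < `|p.2| -> chi p = 0.
  move=> np; apply/eqP; apply: contraTT np => chip; rewrite -leNgt.
  by apply: (HN _ N1); exists p => //; exact: subset_closure.
have lap0 (p : X) : n < `|p.2| -> laplacianX L chi p = 0.
  move=> np; rewrite laplacianX_lap// (@lap_near _ _ (fun=> 0)) ?lap_cst0 ?mulr0//.
  have oV : open [set x : E4 R | n < `|x.2|].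
    apply: (@open_comp _ _ (fun x : E4 R => `|x.2|) [set y | n < y]); last exact: open_gt.
    by move=> x _; apply: continuous_comp; [exact: cvg_snd|exact: norm_continuous].
  have : nbhs ((repr p.1, p.2) : E4 R) [set x : E4 R | n < `|x.2|] by apply: open_nbhs_nbhs; split.
  by apply: filterS => x nx; exact: chi0.
have cchi : continuous (chi \o proj4 G : E4 R -> R).
  by move=> x; apply: differentiable_continuous; exact: (schi [::] x).
have lE : laplacianX L chi \o proj4 G = (fun x => - 2^-1 * lap (Defs.lift chi) x).
  by apply/funext => x; exact: laplacianX_proj4.
have clap : continuous (laplacianX L chi \o proj4 G : E4 R -> R).
  rewrite lE => x; apply: (@cvgM _ _ _ _ (fun=> - 2^-1) (lap (Defs.lift chi))); first exact: cvg_cst.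
  exact: smooth_lap_continuous.
have [C1 H1] := bounded_proj4 cchi chi0.
have [C2 H2] := bounded_proj4 clap lap0.
exists n, (`|C1| + `|C2| + 1); split => //.
- by move=> p np; split; [exact: chi0|exact: lap0].
- move=> p; split.
    apply: le_trans (H1 p) _; apply: le_trans (ler_norm _) _.
    by rewrite -addrA lerDl addr_ge0.
  apply: le_trans (H2 p) _; apply: le_trans (ler_norm _) _.
  by rewrite addrAC lerDr addr_ge0.
- by apply: measurable_fun_proj4; exact: continuous4_measurable.
Qed.

End test_functions.

(** * The two assertions *)

Section essential_bounds.
Variables (R : realType) (G : lattice3 R) (L : complex_iso R).
Variables (phi : R -> R) (delta : R).
Hypothesis isoL : cstruct_isometry L.
Hypothesis sphi : smooth phi.
Hypothesis phi_gt0 : forall t, 0 < phi t.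
Hypothesis delta0 : 0 < delta.
Hypothesis phiE : forall t, 1 < `|t| -> phi t = expR (- (delta * `|t|)).
Local Notation X := (cylinder G).

Lemma measurable_weight : measurable_fun [set: X] (fun p : X => phi p.2).
Proof. by apply: measurable_height; exact: smooth_continuous. Qed.

Lemma weight_integral_lty : (\int[dvol G]_p (phi p.2)%:E < +oo)%E.
Proof.
have [c [C [c0 C0 H]]] := weight_bounds sphi phi_gt0 delta0 phiE.
apply: (@le_lt_trans _ _ (\int[dvol G]_p (C * expR (- (delta * `|p.2|)))%:E)%E).
  apply: ge0_le_integral => //.
  - by move=> p _; rewrite lee_fin ltW.
  - by apply/measurable_EFinP; exact: measurable_weight.
  - apply/measurable_EFinP; apply: measurable_funM => //.
    by apply: (@measurable_height R G (fun t => expR (- (delta * `|t|)))); exact: continuous_exp_abs.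
  - by move=> p _; rewrite lee_fin; have /andP[] := H p.2.
rewrite ge0_integralZl_real; last 3 first.
- exact: ltW.
- by apply: (@measurable_height R G (fun t => expR (- (delta * `|t|)))); exact: continuous_exp_abs.
- by move=> p; exact: expR_ge0.
by rewrite lte_mul_pinfty ?lee_fin ?(ltW C0)// exp_abs_integral_lty.
Qed.

(** Let [l] be the claimed bound. If [f > l] on a set of positive measure, [density] gives a cube
    that contains at least 8 e^4 of this set, so the integral of [f] over it is at least 8 l e^4,
    while [local_estimate] allows only l e^4. *)
Lemma ae_upper_bound : exists2 K : R, 0 < K & forall (B M I : R) (f : X -> R),
  0 < B -> measurable_fun [set: X] f -> (forall p, 0 <= f p <= M) ->
  dist_laplacian_le L f (fun p => B * phi p.2) ->
  (\int[dvol G]_p (f p * phi p.2)%:E = I%:E)%E ->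
  \forall p \ae dvol G, f p <= K * (B + I).
Proof.
have [K [e0 [K0 e00 HK]]] := local_estimate G isoL sphi phi_gt0 delta0 phiE.
exists K => // B M I f B0 mf fM dle IE.
have f0 p : 0 <= f p by have /andP[] := fM p.
have I0 : 0 <= I.
  rewrite -lee_fin -IE; apply: integral_ge0 => p _; rewrite lee_fin; apply: mulr_ge0 => //.
  exact: ltW.
pose l := K * (B + I); have l0 : 0 < l by apply: mulr_gt0 => //; exact: ltr_wpDr.
pose A : set (mE4 R) := [set x | l < f (proj4 G x)].
have mfx : measurable_fun [set: mE4 R] (fun x => f (proj4 G x)).
  exact: (measurableT_comp mf (@measurable_proj4 R G)).
have mS : measurable [set p : X | l < f p].
  rewrite (_ : [set p | _] = f @^-1` `]l, +oo[%classic); last first.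
    by apply/seteqP; split => p /=; rewrite in_itv/= andbT.
  by rewrite -[X in measurable X]setTI; exact: mf.
have mA : measurable A by exact: (measurable_proj4_preimage mS).
have A0 N : vol4 R (A `&` cube 0 N) = 0%E.
  apply/eqP; rewrite eq_le measure_ge0 andbT leNgt; apply/negP => Apos.
  have [x _ [e [epos ee0 He]]] := density (@vol4_cube R) mA Apos e00.
  have mC : measurable (cube x e) by exact: measurable_cube.
  have mAC : measurable (A `&` cube x e) by exact: measurableI.
  have := HK B M I f B0 mf fM dle IE x e; rewrite epos ee0 => /(_ isT) H.
  have {}H : ((l * (8 * e ^+ 4))%:E <= (l * e ^+ 4)%:E)%E.
    apply: le_trans H; apply: (@le_trans _ _ (\int[vol4 R]_(y in A `&` cube x e) l%:E)%E).
      by rewrite integral_cst// EFinM lee_pmul2l.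
    apply: (@le_trans _ _ (\int[vol4 R]_(y in A `&` cube x e) (f (proj4 G y))%:E)%E).
      apply: ge0_le_integral => //.
      - by move=> y _; rewrite lee_fin ltW.
      - by apply/measurable_EFinP; exact: measurable_funTS.
      - by move=> y [Ay _]; rewrite lee_fin; exact: ltW.
    apply: ge0_subset_integral => //.
    - by apply/measurable_EFinP; exact: measurable_funTS.
    - by move=> y _; rewrite lee_fin.
  move: H; rewrite lee_fin ler_pM2l// leNgt => /negP; apply.
  have e4 : 0 < e ^+ 4 by rewrite exprn_gt0.
  by rewrite ltr_pMl// ltr1n.
have nA : (vol4 R).-negligible A.
  have -> : A = \bigcup_N (A `&` cube 0 N.+1%:R).
    rewrite -setI_bigcupr (_ : \bigcup_N _ = setT) ?setIT//.
    apply/seteqP; split => // x _.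
    pose m := `|x.1.1.1| + `|x.1.1.2| + `|x.1.2| + `|x.2|.
    exists (Num.trunc m) => //.
    have mN : m < (Num.trunc m).+1%:R.
      by apply: truncnS_gt.
    by apply/cubeP; rewrite /= !subr0; split; apply: le_lt_trans mN; rewrite /m;
      move: (normr_ge0 x.1.1.1) (normr_ge0 x.1.1.2) (normr_ge0 x.1.2) (normr_ge0 x.2); lra.
  apply: negligible_bigcup => N; apply/negligibleP; last exact: A0.
  by apply: measurableI => //; exact: measurable_cube.
exists [set p : X | l < f p]; split => //; last by move=> p /= /negP; rewrite -ltNge.
have mF : measurable (fd4 G `&` A) by apply: measurableI => //; exact: measurable_fd4.
rewrite dvolE//; apply/eqP; rewrite eq_le measure_ge0 andbT.
have vA : vol4 R A = 0%E by apply/negligibleP.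
rewrite -vA; by apply: le_measure; rewrite ?inE//.
Qed.

(** The estimates above assume bounds at every point, the theorem only almost everywhere. Clipping
    changes [f] on a null set, hence changes none of the integrals. *)
Definition clip (T : Type) (a b : R) (f : T -> R) (p : T) : R := Num.max a (Num.min (f p) b).

Lemma measurable_clip d (T : measurableType d) a b (f : T -> R) :
  measurable_fun [set: T] f -> measurable_fun [set: T] (clip a b f).
Proof. by move=> mf; apply: measurable_maxr => //; exact: measurable_minr. Qed.

Lemma clip_bounds (T : Type) a b (f : T -> R) p : a <= b -> a <= clip a b f p <= b.
Proof. by move=> ab; rewrite le_max lexx ge_max ab ge_min lexx orbT. Qed.

Lemma clip_id (T : Type) a b (f : T -> R) p : a <= f p <= b -> clip a b f p = f p.
Proof. by move=> /andP[af fb]; rewrite /clip (min_idPl fb) (max_idPr af). Qed.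

Lemma ae_integral_mul (f f' g : X -> R) : measurable_fun [set: X] f -> measurable_fun [set: X] f' ->
  measurable_fun [set: X] g -> (\forall p \ae dvol G, f p = f' p) ->
  (\int[dvol G]_p (f p * g p)%:E = \int[dvol G]_p (f' p * g p)%:E)%E.
Proof.
move=> mf mf' mg ff'; apply: ae_eq_integral => //.
- by apply/measurable_EFinP; exact: measurable_funM.
- by apply/measurable_EFinP; exact: measurable_funM.
by apply: filterS ff' => p /= -> _.
Qed.

Lemma ae_dist_laplacian (f f' chi : X -> R) : measurable_fun [set: X] f ->
  measurable_fun [set: X] f' -> (\forall p \ae dvol G, f p = f' p) -> test_function chi ->
  dist_laplacian L f chi = dist_laplacian L f' chi.
Proof.
move=> mf mf' ff' tchi; have [n [C [_ _ _ _ mlap]]] := test_function_regular isoL tchi.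
exact: ae_integral_mul.
Qed.

Lemma ess_sup_estimate : exists2 C : R -> R, (forall B, 0 < B -> 0 < C B) &
  forall (B : R) (f : X -> R), 0 < B -> measurable_fun [set: X] f ->
  (\forall p \ae dvol G, 0 <= f p) -> ess_bounded f ->
  dist_laplacian_le L f (fun p => B * phi p.2) ->
  (ess_sup (dvol G) (EFin \o f) <= (C B)%:E * (1 + \int[dvol G]_p (f p * phi p.2)%:E))%E.
Proof.
have [K K0 HK] := ae_upper_bound.
exists (fun B => K * (B + 1)); first by move=> B B0; apply: mulr_gt0 => //; exact: addr_gt0.
move=> B f B0 mf f0 [M fM] dle.
pose g := clip 0 `|M| f.
have mg : measurable_fun [set: X] g by exact: measurable_clip.
have gM p : 0 <= g p <= `|M| by exact: clip_bounds.
have g0 p : 0 <= g p by have /andP[] := gM p.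
have fg : \forall p \ae dvol G, f p = g p.
  apply: filterS2 f0 fM => p fp0 fpM; rewrite /g clip_id// fp0 /=.
  by apply: le_trans (ler_norm _) (le_trans fpM (ler_norm _)).
have mphi := measurable_weight.
rewrite (ae_integral_mul mf mg mphi fg).
have dleg : dist_laplacian_le L g (fun p => B * phi p.2).
  by move=> chi tchi chi0; rewrite -(ae_dist_laplacian mf mg fg tchi); exact: dle.
have Ioo : (\int[dvol G]_p (g p * phi p.2)%:E < +oo)%E.
  apply: (@le_lt_trans _ _ (\int[dvol G]_p (`|M| * phi p.2)%:E)%E).
    apply: ge0_le_integral => //.
    - by move=> p _; rewrite lee_fin; apply: mulr_ge0 => //; exact: ltW.
    - by apply/measurable_EFinP; exact: measurable_funM.
    - by apply/measurable_EFinP; exact: measurable_funM.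
    - move=> p _; rewrite lee_fin; apply: ler_wpM2r; first exact: ltW.
      by have /andP[] := gM p.
  rewrite ge0_integralZl_real//; last by move=> p; exact: ltW.
  by rewrite lte_mul_pinfty ?lee_fin// weight_integral_lty.
have I0 : (0 <= \int[dvol G]_p (g p * phi p.2)%:E)%E.
  by apply: integral_ge0 => p _; rewrite lee_fin; apply: mulr_ge0 => //; exact: ltW.
pose I := fine (\int[dvol G]_p (g p * phi p.2)%:E)%E.
have IE : (\int[dvol G]_p (g p * phi p.2)%:E = I%:E)%E by rewrite fineK// ge0_fin_numE.
have I_ge0 : 0 <= I by rewrite -lee_fin -IE.
rewrite IE; apply/ess_sup_inf.ess_supP.
apply: filterS2 fg (HK B `|M| I g B0 mg gM dleg IE) => p fp /= gp; rewrite fp.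
rewrite -EFinD -EFinM lee_fin; apply: le_trans gp _.
rewrite -mulrA ler_pM2l// (_ : (B + 1) * (1 + I) = B + I + (1 + B * I)); last by ring.
by rewrite lerDl; apply: addr_ge0 => //; apply: mulr_ge0 => //; exact: ltW.
Qed.

End essential_bounds.

Lemma integral_comb d (T : measurableType d) (R : realType)
    (mu : {measure set T -> \bar R}) (g h : T -> \bar R) (a b : R) :
  mu.-integrable setT g -> mu.-integrable setT h ->
  (\int[mu]_x (a%:E * g x + b%:E * h x) =
   a%:E * \int[mu]_x g x + b%:E * \int[mu]_x h x)%E.
Proof.
move=> ig ih; rewrite integralD//; [|exact: integrableZl..].
by rewrite !integralZl.
Qed.

(** * Bounded functions with nonpositive Laplacian *)

Section subharmonic.
Variables (R : realType) (G : lattice3 R) (L : complex_iso R).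
Hypothesis isoL : cstruct_isometry L.
Local Notation X := (cylinder G).

Lemma lap_comb (F H : E4 R -> R) (a b : R) x : smooth F -> smooth H ->
  lap (fun y => a * F y + b * H y) x = a * lap F x + b * lap H x.
Proof.
move=> sF sH; rewrite /lap !mulr_sumr -big_split; apply: eq_bigr => i _ /=.
have comb (f h : E4 R -> R) v y : differentiable f y -> differentiable h y ->
    'D_v (fun y => a * f y + b * h y) y = a * 'D_v f y + b * 'D_v h y.
  move=> df dh; rewrite (_ : (fun y => _) = (a \*: f) + (b \*: h))//.
  rewrite deriveD; last 2 first.
  - by apply: derivableZ; exact: diff_derivable.
  - by apply: derivableZ; exact: diff_derivable.
  by rewrite !deriveZ//; exact: diff_derivable.
have -> : (fun y => 'D_(std4 i) (fun y => a * F y + b * H y) y) =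
    fun y => a * 'D_(std4 i) F y + b * 'D_(std4 i) H y.
  by apply/funext => y; rewrite (comb _ _ _ _ (sF [::] y) (sH [::] y)).
by rewrite (comb _ _ _ _ (sF [:: std4 i] x) (sH [:: std4 i] x)).
Qed.

Lemma smooth_comb (F H : E4 R -> R) (a b : R) : smooth F -> smooth H ->
  smooth (fun y => a * F y + b * H y).
Proof.
move=> /smoothP sF /smoothP sH; apply/smoothP => n.
by apply: CkD; apply: CkM => //; exact: Ck_cst.
Qed.

Lemma test_function_comb (chi psi : X -> R) (a b : R) :
  test_function chi -> test_function psi -> test_function (fun p => a * chi p + b * psi p).
Proof.
move=> tchi tpsi.
have [n [_ [_ _ H _ _]]] := test_function_regular isoL tchi.
have [m [_ [_ _ H' _ _]]] := test_function_regular isoL tpsi.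
apply: (@test_function_of_support _ _ _ (Num.max n m)).
  by apply: (@smooth_comb (Defs.lift chi) (Defs.lift psi)); [exact: tchi.1|exact: tpsi.1].
move=> p; rewrite gt_max => /andP[np mp].
by rewrite (H p np).1 (H' p mp).1 !mulr0 addr0.
Qed.

Lemma laplacianX_comb (chi psi : X -> R) (a b : R) p :
  test_function chi -> test_function psi ->
  laplacianX L (fun p => a * chi p + b * psi p) p = a * laplacianX L chi p + b * laplacianX L psi p.
Proof.
move=> tchi tpsi; have tcomb := test_function_comb a b tchi tpsi.
rewrite (laplacianX_lap isoL _ tcomb.1) (laplacianX_lap isoL _ tchi.1) (laplacianX_lap isoL _ tpsi.1).
rewrite (@lap_comb (Defs.lift chi) (Defs.lift psi) a b _ tchi.1 tpsi.1).
move: (lap (Defs.lift chi) _) (lap (Defs.lift psi) _) => x y; ring.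
Qed.

Lemma dist_laplacian_comb (f chi psi : X -> R) (M : R) :
  measurable_fun [set: X] f -> (forall p, `|f p| <= M) ->
  test_function chi -> test_function psi ->
  exists u v : R, [/\ dist_laplacian L f chi = u%:E, dist_laplacian L f psi = v%:E &
    forall a b, dist_laplacian L f (fun p => a * chi p + b * psi p) = (a * u + b * v)%:E].
Proof.
move=> mf fM tchi tpsi.
have int chi' : test_function chi' ->
    (dvol G).-integrable setT (fun p => (f p * laplacianX L chi' p)%:E).
  move=> /(test_function_regular isoL)[n [C [_ _ H bd ml]]].
  apply: (@integrable_slab _ _ _ _ M C n) => // p; first by have [] := bd p.
  by move=> /H[].
have fin chi' : test_function chi' -> exists u : R, dist_laplacian L f chi' = u%:E.
  move=> /int i; exists (fine (dist_laplacian L f chi')); rewrite fineK//.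
  exact: integrable_fin_num.
have [u uE] := fin _ tchi; have [v vE] := fin _ tpsi.
exists u, v; split => // a b.
transitivity (a%:E * dist_laplacian L f chi + b%:E * dist_laplacian L f psi)%E; last by rewrite uE vE.
apply: etrans (integral_comb a b (int _ tchi) (int _ tpsi)); apply: eq_integral => p _.
rewrite (laplacianX_comb a b p tchi tpsi) -!EFinM -EFinD.
by move: (laplacianX L chi p) (laplacianX L psi p) (f p) => x y z; congr EFin; ring.
Qed.

Lemma slab_cutoffs : exists2 K : R, 0 <= K & forall n : R, 0 < n ->
  exists psi : X -> R, [/\ test_function psi, forall p, 0 <= psi p,
    forall p : X, `|p.2| <= n -> psi p = 1 &
    forall (f : X -> R) (M : R), measurable_fun [set: X] f -> (forall p, `|f p| <= M) ->
      (`|dist_laplacian L f psi| <= (M * K / n)%:E)%E].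
Proof.
have [C C0 HC] := cutoff_height R.
(* The Laplacian of the cutoff is at most [2^-1 * C / n ^+ 2], on the slab of heights at most
   [2 * n], whose volume is [torus_volume G * (4 * n)]. *)
exists (2^-1 * C * (torus_volume G * 4)).
  by apply: mulr_ge0; apply: mulr_ge0 => //; [exact: ltW|exact: torus_volume_ge0].
move=> n n0.
have d1 (s : R) : is_derive s (1 : R) (fun=> 1 : R) 0 by exact: is_derive_cst.
have d0 (s : R) : is_derive s (1 : R) (fun=> 0 : R) 0 by exact: is_derive_cst.
have s1 : smooth (fun _ : R => 1 : R) by apply/smoothP => m; exact: Ck_cst.
have [chi1 [chi2 [sc dc dc1 Hin Hout]]] := HC (fun=> 1) (fun=> 0) (fun=> 0) n s1 n0 d1 d0.
pose c (t : R) : R := 1 * cutoff (t ^+ 2 / n ^+ 2).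
pose psi (p : X) : R := c p.2.
have n20 : 0 < n ^+ 2 by rewrite exprn_gt0.
have lapE (p : X) : laplacianX L psi p = - 2^-1 * chi2 p.2.
  exact: (laplacianX_height isoL p sc dc dc1).
have tpsi : test_function psi.
  apply: (@test_function_of_support _ _ _ (2 * n)); first exact: smooth_height.
  move=> p np; rewrite /psi /c mul1r cutoff0// ler_pdivlMr//.
  rewrite -(real_normK (num_real p.2)) (_ : 4 * n ^+ 2 = (2 * n) ^+ 2); last by ring.
  by apply: lerXn2r; rewrite ?nnegrE ?normr_ge0//; [apply: mulr_ge0 => //; exact: ltW|exact: ltW].
have [_ [_ [_ _ _ _ ml]]] := test_function_regular isoL tpsi.
exists psi; split => //.
- by move=> p; rewrite /psi /c mul1r cutoff_ge0.
- move=> p pn; rewrite /psi /c mul1r cutoff1// ler_pdivrMr// mul1r.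
  rewrite -(real_normK (num_real p.2)).
  by apply: lerXn2r; rewrite ?nnegrE ?normr_ge0//; exact: ltW.
move=> f M mf fM.
pose D := 2^-1 * (C / n ^+ 2).
have lapD (p : X) : `|laplacianX L psi p| <= D.
  rewrite lapE normrM normrN (ger0_norm (_ : 0 <= 2^-1)) ?invr_ge0//.
  apply: ler_wpM2l; first by rewrite invr_ge0.
  have Cn : 0 <= C / n ^+ 2 by apply: divr_ge0; exact: ltW.
  have [h1|h1] := ltP `|p.2| n; first by rewrite Hout ?mul0r ?normr0//; left.
  have [h2|h2] := ltP (2 * n) `|p.2|; first by rewrite Hout ?mul0r ?normr0//; right.
  have := Hin p.2; rewrite h1 h2 => /(_ isT).
  by rewrite mul0r subr0 normr0 mul0r add0r normr1 mul1r.
have lap0 (p : X) : 2 * n < `|p.2| -> laplacianX L psi p = 0.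
  by move=> h; rewrite lapE Hout ?mul0r ?mulr0//; right.
have mflap : measurable_fun [set: X] (fun p => (f p * laplacianX L psi p)%:E).
  by apply/measurable_EFinP; exact: measurable_funM.
apply: le_trans (le_abse_integral _ _ _) _ => //.
apply: le_trans (integral_slab_le mf ml fM lapD lap0) _.
have nn : - (2 * n) <= 2 * n by rewrite -subr_ge0 opprK addr_ge0// mulr_ge0// ltW.
rewrite dvol_slab// -EFinM lee_fin /D le_eqVlt; apply/orP; left; apply/eqP.
by field; rewrite gt_eqF.
Qed.

Lemma subharmonic_harmonic (f : X -> R) : measurable_fun [set: X] f -> ess_bounded f ->
  dist_laplacian_le L f (fun=> 0) -> dist_laplacian_eq0 L f.
Proof.
move=> mf [M0 fM0] dle chi tchi.
pose M := `|M0|; pose g := clip (- M) M f.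
have mg : measurable_fun [set: X] g by exact: measurable_clip.
have gM p : `|g p| <= M by rewrite ler_norml; apply: clip_bounds; rewrite ge0_cp// normr_ge0.
have fg : \forall p \ae dvol G, f p = g p.
  apply: filterS fM0 => p fp; rewrite /g clip_id// -ler_norml; exact: le_trans fp (ler_norm _).
rewrite (ae_dist_laplacian isoL mf mg fg tchi).
have {}dle psi : test_function psi -> (forall p, 0 <= psi p) -> (dist_laplacian L g psi <= 0)%E.
  move=> tpsi psi0; rewrite -(ae_dist_laplacian isoL mf mg fg tpsi).
  apply: le_trans (dle _ tpsi psi0) _.
  by rewrite (eq_integral (cst 0%E)) ?integral0// => p _; rewrite mul0r.
have [n [C [n0 C0 supp bd _]]] := test_function_regular isoL tchi.
have [K K0 HK] := slab_cutoffs.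
have [u [_ [uE _ _]]] := dist_laplacian_comb mg gM tchi tchi.
rewrite uE; congr EFin; apply/eqP; rewrite -normr_le0; apply/ler_addgt0Pr => e e0; rewrite add0r.
(* The first entry makes [C * psi] dominate [chi], which vanishes above height [n]; the second makes
   the pairing of [g] with [C * psi] at most [e]. *)
pose k := Num.max n (C * (M * K) / e).
have k0 : 0 < k by rewrite lt_max n0.
have [psi [tpsi psi0 psi1 Hpsi]] := HK k k0.
have [u' [v [u'E vE comb]]] := dist_laplacian_comb mg gM tchi tpsi.
have uu : u' = u by move: u'E; rewrite uE => -[].
have chi_le p : `|chi p| <= C * psi p.
  have [pk|kp] := leP `|p.2| k; first by rewrite psi1// mulr1; have [] := bd p.
  have [-> _] : chi p = 0 /\ laplacianX L chi p = 0.
    by apply: supp; apply: le_lt_trans kp; rewrite le_max lexx.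
  by rewrite normr0; apply: mulr_ge0 => //; exact: ltW.
have side (s : R) : `|s| = 1 -> s * u <= C * (M * K / k).
  move=> s1; have t := test_function_comb s C tchi tpsi.
  have := dle _ t; rewrite comb uu lee_fin => H.
  have {}H : s * u + C * v <= 0.
    apply: H => p; rewrite -lerBlDl sub0r; apply: le_trans (chi_le p).
    by rewrite -[leRHS]mul1r -s1 -normrM -normrN ler_norm.
  have := Hpsi g M mg gM; rewrite vE abse_EFin lee_fin ler_norml => /andP[h _].
  have {}h : - (C * (M * K / k)) <= C * v by rewrite -mulrN ler_pM2l.
  by move: H h; move: (s * u) (C * v) (C * (M * K / k)) => x y z; lra.
have ek : C * (M * K / k) <= e.
  rewrite [C * (M * K / k)]mulrA ler_pdivrMr// [e * k]mulrC -ler_pdivrMr//.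
  by rewrite /k le_max lexx orbT.
rewrite ler_norml; apply/andP; split.
  by rewrite lerNl -mulN1r; apply: le_trans ek; apply: side; rewrite normrN1.
by rewrite -[u]mul1r; apply: le_trans ek; apply: side; rewrite normr1.
Qed.

End subharmonic.

Theorem proposition3p9 (R : realType) (G : lattice3 R) (L : complex_iso R)
    (phi : R -> R) (delta : R) :
  cstruct_isometry L ->
  smooth phi -> (forall t, 0 < phi t) ->
  0 < delta -> (forall t, 1 < `|t| -> phi t = expR (- (delta * `|t|))) ->
  let phiX := fun p : cylinder G => phi p.2 in
  (\int[dvol G]_p (phiX p)%:E < +oo)%E /\
  exists C : R -> R,
    [/\ forall B, 0 < B -> 0 < C B,
        forall (B : R) (f : cylinder G -> R), 0 < B ->
          measurable_fun [set: cylinder G] f ->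
          (\forall p \ae dvol G, 0 <= f p) ->
          ess_bounded f ->
          dist_laplacian_le L f (fun p => B * phiX p) ->
          (ess_sup (dvol G) (EFin \o f) <=
             (C B)%:E * (1 + \int[dvol G]_p (f p * phiX p)%:E))%E
      & forall f : cylinder G -> R,
          measurable_fun [set: cylinder G] f ->
          ess_bounded f ->
          dist_laplacian_le L f (fun=> 0) ->
          dist_laplacian_eq0 L f].
Proof.
move=> isoL sphi phi_gt0 delta0 phiE phiX; split.
  exact: (weight_integral_lty G sphi phi_gt0 delta0 phiE).
have [C C0 HC] := ess_sup_estimate G isoL sphi phi_gt0 delta0 phiE.
by exists C; split => // f; exact: subharmonic_harmonic.
Qed.
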